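(* If $u\in L^\infty(\mathbb B)$ is a viscosity solution of $$t^{-2}\Delta_{\mathbb B}u+t^{-2}(n-2)(t\partial_t u)+h(u)=f(t,x)\quad\text{in }\mathbb B$$ and $f\in C(\overline{\mathbb B})\cap L^\infty(\mathbb B)$, then $u$ is a weak solution of this equation and $u\in\mathbb H_2^{1,\frac{n-2}{2}}(\mathbb B)$.
   Context: Standing setting. $n\ge 3$; $X\subset\mathbb R^{n-1}$ is a bounded convex open set with smooth boundary; $\mathbb B=(0,1)\times X$ with points $(t,x)$; $\partial\mathbb B=(\{1\}\times X)\cup((0,1]\times\partial X)$, and $\overline{\mathbb B}=\mathbb B\cup\partial\mathbb B=(0,1]\times\overline X$. The function $h:\mathbb R\to\mathbb R$ is continuous, non-increasing, $h(0)=0$. Operators. $\nabla_{\mathbb B}=(t\partial_t,\partial_{x_1},\dots,\partial_{x_{n-1}})$ and $\Delta_{\mathbb B}u=(t\partial_t)^2u+\sum_{i=1}^{n-1}\partial_{x_i}^2u$. Viscosity solution. $u\in USC(\mathbb B)$ (resp. $u\in LSC(\mathbb B)$) is a viscosity subsolution (resp. supersolution) of the equation if for every $\phi\in C^2(\mathbb B)$ and every local maximum (resp. minimum) point $(t_0,x_0)\in\mathbb B$ of $u-\phi$ one has $t_0^{-2}\Delta_{\mathbb B}\phi(t_0,x_0)+t_0^{-2}(n-2)(t\partial_t\phi)(t_0,x_0)+h(u(t_0,x_0))\ge f(t_0,x_0)$ (resp. $\le$). A viscosity solution is both. Weighted spaces. With $d(x,\partial X)$ the Euclidean distance to $\partial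 X$, for $\gamma\in\mathbb R$ and $1\le q<\infty$, $$\|u\|_{\mathbb L^\gamma_q(\mathbb B)}=\left(\int_{\mathbb B}\big|(t(1-t)d(x,\partial X))^{\frac nq-\gamma}u\big|^q\frac{dt}{t}dx\right)^{1/q},$$ and $\mathbb L_q^\gamma(\mathbb B)$ is the space of distributions for which this is finite. $\mathbb H^{1,\gamma}_2(\mathbb B)$ is the space of distributions $u$ on $\mathbb B$ with $(t\partial_t)^\alpha\partial_x^\beta u\in\mathbb L^\gamma_2(\mathbb B)$ for all $\alpha\in\mathbb N$, $\beta\in\mathbb N^{n-1}$, $\alpha+|\beta|\le1$. Weak solution. $u\in\mathbb H^{1,\gamma}_2(\mathbb B)$ ($\gamma\in\mathbb R$) is a weak supersolution (resp. subsolution) of the equation if $h(u)\in\mathbb L^n_{1,loc}(\mathbb B)$ (i.e. $\int_K|h(u)|\frac{dt}{t}dx<\infty$ for compact $K\subset\mathbb B$) and, for all non-negative $\psi\in C_0^\infty(\mathbb B)$, $$\int_{\mathbb B}t^{-2}\nabla_{\mathbb B}u\cdot\nabla_{\mathbb B}\psi\,\frac{dt}{t}dx\ge(\text{resp. }\le)\int_{\mathbb B}\big(-f+h(u)+nt^{-2}(t\partial_tu)\big)\psi\,\frac{dt}{t}dx.$$ A weak solution is both. *)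

(* Defs.v *)
From HB Require Import structures.
From mathcomp Require Import all_boot all_order all_algebra.
From mathcomp Require Import all_classical all_reals all_analysis.

Set Implicit Arguments.
Unset Strict Implicit.
Unset Printing Implicit Defensive.

Import Order.TTheory GRing.Theory Num.Theory.
Import numFieldNormedType.Exports.

Local Open Scope classical_set_scope.
Local Open Scope ring_scope.

(* Borel sets of 'rV[R]_m, generated by the coordinates as the library does for
   tuples. *)
Section measurable_rV.
Variables (R : realType) (m : nat).

Let coord (i : 'I_m) (v : 'rV[R]_m) : R := v ord0 i.

Let rV_set0 : g_sigma_preimage coord set0.
Proof. exact: sigma_algebra0. Qed.

Let rV_setC A : g_sigma_preimage coord A -> g_sigma_preimage coord (~` A).
Proof. exact: sigma_algebraC. Qed.

Let rV_bigcup (F : _^nat) : (forall i, g_sigma_preimage coord (F i)) ->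
  g_sigma_preimage coord (\bigcup_i (F i)).
Proof. exact: sigma_algebra_bigcup. Qed.

HB.instance Definition _ :=
  @isMeasurable.Build (measure_tuple_display default_measure_display)
    'rV[R]_m (g_sigma_preimage coord) rV_set0 rV_setC rV_bigcup.

Lemma measurable_coord i : measurable_fun [set: 'rV[R]_m] (fun v => v ord0 i).
Proof.
move=> _ Y mY; rewrite setTI; apply: sub_sigma_algebra => /=.
rewrite -bigcup_seq/=; exists i => /=; first by rewrite mem_index_enum.
by exists Y => //; rewrite setTI.
Qed.

Lemma measurable_fun_rVP d (T : measurableType d) (f : T -> 'rV[R]_m) :
  (forall i, measurable_fun [set: T] (fun x => f x ord0 i)) ->
  measurable_fun [set: T] f.
Proof.
move=> mf.
suff H : g_sigma_preimage (fun i => coord i \o f) `<=` measurable.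
  move=> _ A mA; apply: H; rewrite g_sigma_preimage_comp.
  by exists A.
apply: smallest_sub; first exact: sigma_algebra_measurable.
rewrite -bigcup_seq; apply: bigcup_sub => i _.
by move=> A [B mB <-]; exact: mf.
Qed.

End measurable_rV.

Section lebesgue_rV.
Variable R : realType.

Let consV m (p : R * 'rV[R]_m) : 'rV[R]_m.+1 :=
  \row_i (if unlift ord0 i is Some j then p.2 ord0 j else p.1).

Let measurable_consV m : measurable_fun [set: R * 'rV[R]_m] (@consV m).
Proof.
apply: measurable_fun_rVP => i.
case: (unliftP ord0 i) => [j|] ->.
- under eq_fun do rewrite mxE liftK.
  exact: (measurableT_comp (measurable_coord j) measurable_snd).
- under eq_fun do rewrite mxE unlift_none.
  exact: measurable_fst.
Qed.

Let unconsV m (v : 'rV[R]_m.+1) : R * 'rV[R]_m :=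
  (v ord0 ord0, \row_j v ord0 (lift ord0 j)).

Let consVK m : cancel (@consV m) (@unconsV m).
Proof.
move=> [x v]; rewrite /unconsV /consV mxE unlift_none; congr pair.
by apply/rowP => j; rewrite !mxE liftK.
Qed.

Let measurable_unconsV m : measurable_fun [set: 'rV[R]_m.+1] (@unconsV m).
Proof.
apply/measurable_fun_pairP; split; first exact: measurable_coord.
apply: measurable_fun_rVP => j.
under eq_fun do rewrite /= mxE.
exact: measurable_coord.
Qed.

Section step.
Variables (m : nat) (mu : {sigma_finite_measure set 'rV[R]_m -> \bar R}).

Definition lebesgue_rV_step : set 'rV[R]_m.+1 -> \bar R :=
  pushforward (lebesgue_measure \x mu)%E (@consV m).

Let step0 : lebesgue_rV_step set0 = 0%E.
Proof. by rewrite /lebesgue_rV_step /pushforward preimage_set0 measure0. Qed.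

Let step_ge0 A : (0 <= lebesgue_rV_step A)%E.
Proof. exact: (measure_ge0 (lebesgue_measure \x mu)%E). Qed.

Let step_sigma_additive : semi_sigma_additive lebesgue_rV_step.
Proof.
move=> F mF tF mUF; rewrite /lebesgue_rV_step /pushforward preimage_bigcup.
apply: measure_semi_sigma_additive.
- by move=> k; rewrite -[X in measurable X]setTI; exact: measurable_consV.
- apply/trivIsetP => /= i j _ _ ij; rewrite -preimage_setI.
  by move/trivIsetP : tF => /(_ _ _ _ _ ij) ->//; rewrite preimage_set0.
- rewrite -preimage_bigcup -[X in measurable X]setTI.
  exact: measurable_consV.
Qed.

HB.instance Definition _ := isMeasure.Build _ _ _ lebesgue_rV_step
  step0 step_ge0 step_sigma_additive.

Let step_sigma_finite : sigma_finite setT lebesgue_rV_step.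
Proof.
have /sigma_finiteP[F [TF ndF Foo]] := sigma_finiteT (@lebesgue_measure R).
have /sigma_finiteP[G [TG ndG Goo]] := sigma_finiteT mu.
exists (fun k => @unconsV m @^-1` (F k `*` G k)).
  rewrite -preimage_bigcup (_ : \bigcup_k _ = setT) ?preimage_setT//.
  rewrite -subTset => -[x v] _.
  have [k _ Fkx] : (\bigcup_k F k) x by rewrite -TF.
  have [l _ Glv] : (\bigcup_k G k) v by rewrite -TG.
  exists (maxn k l) => //; split => /=.
  - by move: x Fkx; exact/subsetPset/ndF/leq_maxl.
  - by move: v Glv; exact/subsetPset/ndG/leq_maxr.
move=> k; have [mF Fk] := Foo k; have [mG Gk] := Goo k; split.
  rewrite -[X in measurable X]setTI; apply: measurable_unconsV => //.
  exact: measurableX.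
rewrite /lebesgue_rV_step /pushforward -comp_preimage.
rewrite (_ : _ \o _ = id) ?preimage_id; last first.
  by apply/funext => p /=; rewrite consVK.
by rewrite product_measure1E// lte_mul_pinfty// ge0_fin_numE.
Qed.

HB.instance Definition _ := Measure_isSigmaFinite.Build _ _ _ lebesgue_rV_step
  step_sigma_finite.

End step.

(* Lebesgue measure on 'rV[R]_m: image of lebesgue_measure \x lebesgue_rV m.-1
   under (t, v) |-> the row vector with entries t, v_0, v_1, ... *)
Fixpoint lebesgue_rV (m : nat) : {sigma_finite_measure set 'rV[R]_m -> \bar R} :=
  match m with
  | 0 => \d_(0 : 'rV[R]_0)
  | m'.+1 => lebesgue_rV_step (lebesgue_rV m')
  end.

End lebesgue_rV.
Arguments lebesgue_rV {R} m.

Section euclidean.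
Variables (R : realType) (m : nat).
Implicit Types (X : set 'rV[R]_m) (x : 'rV[R]_m).

(* The norm of the library on 'rV[R]_m is the sup norm. *)
Definition enorm x : R := Num.sqrt (\sum_i x ord0 i ^+ 2).

Definition boundary X : set 'rV[R]_m := closure X `\` X°.

Definition bdist X x : R := inf [set enorm (x - y) | y in boundary X].

End euclidean.

(* k-fold continuous differentiability on an open set U, through directional
   derivatives; in finite dimension this is the usual class C^k(U). *)
Fixpoint Ck (R : realType) (V : normedModType R) (k : nat) (U : set V)
    (g : V -> R) : Prop :=
  (forall p, U p -> {for p, continuous g}) /\
  match k with
  | 0 => True
  | k'.+1 => forall v : V,
      (forall p, U p -> derivable g p v) /\ Ck k' U (fun p => 'D_v g p)
  end.

Definition smooth (R : realType) (V : normedModType R) (U : set V)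
  (g : V -> R) : Prop := forall k, Ck k U g.

(* Near each boundary point, X is a sublevel set of a smooth function with
   nonvanishing differential. *)
Definition smooth_boundary (R : realType) (m : nat) (X : set 'rV[R]_m) : Prop :=
  forall x, boundary X x ->
  exists (U : set 'rV[R]_m) (rho : 'rV[R]_m -> R),
    [/\ open U /\ U x, smooth U rho,
        (exists v, 'D_v rho x != 0) &
        forall y, U y -> X y <-> rho y < 0].

Section cone.
Variables (R : realType) (n : nat).

Local Notation pt := (R * 'rV[R]_n.-1)%type.
Implicit Types (X : set 'rV[R]_n.-1) (p : pt) (u f g phi psi : pt -> R).

Definition leb : {measure set (measurableTypeR R * 'rV[R]_n.-1)%type -> \bar R} :=
  (lebesgue_measure \x lebesgue_rV n.-1)%E.

Definition coneB X : set pt := `]0, 1[%classic `*` X.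
Definition coneBbar X : set pt := `]0, 1]%classic `*` closure X.

Definition tdt phi p : R := p.1 * 'D_((1, 0) : pt) phi p.
Definition dx (i : 'I_n.-1) phi p : R :=
  'D_((0, delta_mx ord0 i) : pt) phi p.

Definition lapB phi p : R := tdt (tdt phi) p + \sum_i dx i (dx i phi) p.

Definition usc X u : Prop :=
  forall p, coneB X p -> forall a, u p < a -> \forall q \near p, coneB X q -> u q < a.
Definition lsc X u : Prop :=
  forall p, coneB X p -> forall a, a < u p -> \forall q \near p, coneB X q -> a < u q.

Definition local_max X g p : Prop :=
  coneB X p /\ \forall q \near p, coneB X q -> g q <= g p.
Definition local_min X g p : Prop :=
  coneB X p /\ \forall q \near p, coneB X q -> g p <= g q.

Definition viscosity_operator (h : R -> R) u phi p : R :=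
  p.1 ^- 2 * lapB phi p + p.1 ^- 2 * (n%:R - 2) * tdt phi p + h (u p).

Definition viscosity_subsolution X (h : R -> R) f u : Prop :=
  usc X u /\
  forall phi, Ck 2 (coneB X) phi ->
  forall p, local_max X (fun q => u q - phi q) p ->
    f p <= viscosity_operator h u phi p.

Definition viscosity_supersolution X (h : R -> R) f u : Prop :=
  lsc X u /\
  forall phi, Ck 2 (coneB X) phi ->
  forall p, local_min X (fun q => u q - phi q) p ->
    viscosity_operator h u phi p <= f p.

Definition viscosity_solution X (h : R -> R) f u : Prop :=
  viscosity_subsolution X h f u /\ viscosity_supersolution X h f u.

Definition Linfty X u : Prop := (u \_ (coneB X)) \in Lfun leb +oo%E.

(* Integral over a subset of coneB against (dt/t) dx. *)
Definition mellin_int (K : set pt) u : \bar R :=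
  (\int[leb]_(p in K) (u p / p.1)%:E)%E.

Definition weight X (a : R) p : R := (p.1 * (1 - p.1) * bdist X p.2) `^ a.

Definition wnorm X (gamma q : R) u : \bar R :=
  (mellin_int (coneB X) (fun p => (`|weight X (n%:R / q - gamma) p * u p| `^ q)%R)
    `^ q^-1)%E.

Definition wL X (gamma q : R) u : Prop :=
  measurable_fun (coneB X) u /\ (wnorm X gamma q u < +oo)%E.

Definition L1loc X u : Prop :=
  measurable_fun (coneB X) u /\
  forall K : set pt, compact K -> K `<=` coneB X ->
    (mellin_int K (fun p => `|u p|%R) < +oo)%E.

Definition test_fun X psi : Prop :=
  [/\ smooth setT psi,
      compact (closure [set p | psi p != 0]) &
      closure [set p | psi p != 0] `<=` coneB X].

(* g is the distribution D u, where functions are paired with test functions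
   through (dt/t) dx: both D = t d/dt and D = d/dx_i are formally
   skew-symmetric for this measure. *)
Definition weak_deriv X (D : (pt -> R) -> pt -> R) u g : Prop :=
  [/\ L1loc X u, L1loc X g &
      forall psi, test_fun X psi ->
        mellin_int (coneB X) (fun p => g p * psi p) =
        (- mellin_int (coneB X) (fun p => (u p * D psi p)%R))%E].

(* (gt, gx) is the gradient (t d/dt, d/dx) of u in the sense of distributions *)
Definition weak_grad X u (gt : pt -> R) (gx : 'I_n.-1 -> pt -> R) : Prop :=
  weak_deriv X tdt u gt /\ forall i, weak_deriv X (dx i) u (gx i).

Definition H1 X (gamma : R) u : Prop :=
  wL X gamma 2 u /\
  exists (gt : pt -> R) (gx : 'I_n.-1 -> pt -> R),
    [/\ weak_grad X u gt gx, wL X gamma 2 gt & forall i, wL X gamma 2 (gx i)].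

Definition dirichlet_form X (gt : pt -> R) (gx : 'I_n.-1 -> pt -> R) psi :
    \bar R :=
  mellin_int (coneB X) (fun p =>
    p.1 ^- 2 * (gt p * tdt psi p + \sum_i gx i p * dx i psi p)).

Definition weak_rhs X (h : R -> R) f u (gt : pt -> R) psi : \bar R :=
  mellin_int (coneB X) (fun p =>
    (- f p + h (u p) + n%:R * p.1 ^- 2 * gt p) * psi p).

(* Weak gradients are unique almost everywhere, and membership in H1 provides
   one, so the quantification over (gt, gx) names the weak gradient of u. *)
Definition weak_supersolution X (h : R -> R) f u : Prop :=
  [/\ exists gamma, H1 X gamma u, L1loc X (h \o u) &
      forall gt gx, weak_grad X u gt gx ->
      forall psi, test_fun X psi -> (forall p, 0 <= psi p) ->
        (weak_rhs X h f u gt psi <= dirichlet_form X gt gx psi)%E].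

Definition weak_subsolution X (h : R -> R) f u : Prop :=
  [/\ exists gamma, H1 X gamma u, L1loc X (h \o u) &
      forall gt gx, weak_grad X u gt gx ->
      forall psi, test_fun X psi -> (forall p, 0 <= psi p) ->
        (dirichlet_form X gt gx psi <= weak_rhs X h f u gt psi)%E].

Definition weak_solution X (h : R -> R) f u : Prop :=
  weak_supersolution X h f u /\ weak_subsolution X h f u.

End cone.

(* Main.v *)
Require Import Defs.
From HB Require Import structures.
From mathcomp Require Import all_boot all_order all_algebra.
From mathcomp Require Import all_classical all_reals all_analysis.
From mathcomp Require Import measurable_realfun ess_sup_inf ring lra zify.

Set Implicit Arguments.
Unset Strict Implicit.
Unset Printing Implicit Defensive.

Import Order.TTheory GRing.Theory Num.Theory.
Import numFieldNormedType.Exports.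

Local Open Scope classical_set_scope.
Local Open Scope ring_scope.

(* In the coordinates [(s, x) = (log t, x)] and with [u = t^-a U], [a = (n - 2) / 2],
   the equation becomes the Poisson equation [laplacian U = H], where [H] is a
   continuous function computed from [f], [h], and [u], and [U] is a viscosity solution
   of it.  On a small ball, let [F] be the polynomial with [laplacian F] close to [H]
   that is close to [U] on the boundary: it exists by Weierstrass approximation and
   because the Dirichlet problem on a ball has polynomial solutions for polynomial
   data.  Comparison makes [U - F] uniformly small.  An interior gradient estimate for
   polynomials, obtained by doubling the variables, passes to [U], and applied to
   [U - F] it shows that [U] is [C^1] and is approximated by [F] in [C^1].  The weak
   formulation holds for the lifts of the polynomials [F], hence for [u] against test
   functions with small support, and then for all of them by a partition of unity.
   Finally the gradient estimate on a ball of radius comparable with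
   [(1 - t) d(x, dX)] bounds [(1 - t) d(x, dX) |grad u|], which is what the weight of
   exponent [n/2 - (n - 2)/2 = 1] requires. *)

(** The exponent [a] is chosen to remove the first-order term: [(d/ds - a)^2 + 2 a (d/ds - a) =
    d^2/ds^2 - a^2], and [2 a = n - 2] is the coefficient of [t d/dt]. The nonlinearity is frozen: a
    viscosity test evaluates [h] at [u], not at the test function, and the two semicontinuities make
    [u] continuous, so [h(u)] joins [f] as a known source.

    A merely continuous source does not make [U] twice differentiable, and at first [U] has no
    derivative at all. The equation and the a priori estimate are therefore proved for polynomials
    and carried over by uniform or C^1 limits; the weak form contains first derivatives only, so C^1
    limits suffice. Polynomials also keep existence finite: solvability on a ball is linear algebra
    plus uniqueness, and the maximum principle is the second derivative test along lines. The
    derivatives of [U] are obtained along coordinate directions, which is why calculus is done on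
    lines. *)

Section Calculus.
Variables (R : realType) (V : normedModType R).
Implicit Types (f g : V -> R) (x v : V).

Lemma is_derive_affine f x v (d : R) :
  (forall h, f (h *: v + x) = f x + h * d) -> is_derive x v f d.
Proof.
move=> fE.
have lim : h^-1 *: (f (h *: v + x) - f x) @[h --> 0^'] --> d.
  apply: cvg_near_cst; near=> h.
  have h0 : h != 0 by near: h; exact: nbhs_dnbhs_neq.
  by rewrite fE [f x + _]addrC addrK scalerA mulVf// scale1r.
by apply: DeriveDef; [exact: cvgP lim|exact: cvg_lim lim].
Unshelve. all: by end_near. Qed.

Lemma derive_line f x v (t : R) :
  derivable f (x + t *: v) v ->
  is_derive t (1 : R) (fun s => f (x + s *: v)) ('D_v f (x + t *: v)).
Proof.
move=> df.
have E : (fun h : R => h^-1 *: (((fun s => f (x + s *: v)) \o shift t) (h *: (1:R))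
     - f (x + t *: v))) = (fun h => h^-1 *: ((f \o shift (x + t *: v)) (h *: v) - f (x + t *: v))).
  apply/funext => h /=; congr (_ *: (f _ - _)).
  by rewrite scalerDl [h *: 1]mulr1 addrCA.
by apply: DeriveDef; rewrite ?/derivable ?/derive E.
Qed.

Lemma is_derive_line f x v (d : R) :
  is_derive (0 : R) (1 : R) (fun s => f (x + s *: v)) d -> is_derive x v f d.
Proof.
have E : (fun h : R => h^-1 *: (((fun s => f (x + s *: v)) \o shift 0) (h *: (1:R))
     - f (x + (0 : R) *: v))) = (fun h => h^-1 *: ((f \o shift x) (h *: v) - f x)).
  apply/funext => h /=; rewrite scale0r !addr0; congr (_ *: (f _ - _)).
  by rewrite [h *: 1]mulr1 addrC.
by case=> df dE; apply: DeriveDef; move: df dE; rewrite /derivable /derive E.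
Qed.

(** Restricting [f] to the line through [x] reduces this to the one-variable chain rule, so that a
    directional derivative of [f] is enough. *)
Lemma is_derive_comp_dir (k : R -> R) f x v (dk df : R) :
  is_derive x v f df -> is_derive (f x) (1 : R) k dk ->
  is_derive x v (fun y => k (f y)) (dk * df).
Proof.
move=> [df' <-] dk'; apply: is_derive_line.
have := @derive_line f x v 0; rewrite scale0r addr0 => /(_ df') dl.
have dk'' : is_derive (f (x + (0 : R) *: v)) (1 : R) k dk by rewrite scale0r addr0.
exact: (@is_derive1_comp R k (fun s => f (x + s *: v)) 0 _ _ dk'' dl).
Qed.

(** Only the derivative of [dg] at 0 enters: if it were positive, [dg] would be positive just to the
    right of 0, where [dg 0 = 0], and the mean value theorem would give some [g t > g 0]. *)
Lemma second_derivative_test (g dg : R -> R) (e d2 : R) : 0 < e ->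
  (forall t, `|t| < e -> is_derive t (1 : R) g (dg t)) ->
  (forall t, `|t| < e -> g t <= g 0) ->
  is_derive (0 : R) (1 : R) dg d2 -> dg 0 = 0 /\ d2 <= 0.
Proof.
move=> e0 dgE gmax d2E.
have z : dg 0 = 0.
  have z0 : (0 : R) \in `]-e, e[ by rewrite in_itv/= oppr_lt0 e0.
  have ab t : t \in `]-e, e[ -> `|t| < e by rewrite in_itv/= ltr_norml.
  have := @derive1_at_max R g (- e) e 0.
  move=> /(_ _ _ z0); rewrite -[`]-e, e[]/`]-e, e[.
  have h1 : - e <= e by lra.
  move=> /(_ h1); case.
  - by move=> t /ab /dgE [].
  - by move=> t /ab /gmax.
  have [_ ->] := dgE 0 (ab _ z0).
  by [].
split => //; rewrite leNgt; apply/negP => d20.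
have [dd dE] := d2E.
have lim : h^-1 *: (dg (h *: 1 + 0) - dg 0) @[h --> 0^'] --> d2.
  by rewrite -dE.
have : \forall h \near (0 : R)^', 0 < h^-1 *: (dg (h *: 1 + 0) - dg 0).
  exact: (cvgr_gt d2 lim).
rewrite near_withinE => /nbhs_ballP[r /= r0 hr].
have pos t : 0 < t -> t < r -> 0 < dg t.
  move=> t0 tr; have := hr t; rewrite /ball /= sub0r normrN gtr0_norm// => /(_ tr).
  rewrite gt_eqF// => /(_ isT); rewrite addr0 [t *: 1]mulr1 z subr0 => h.
  by move: h; rewrite pmulr_rgt0 ?invr_gt0.
pose t := Order.min e r / 2.
have t0 : 0 < t by rewrite divr_gt0// lt_min e0 r0.
have te : t < Order.min e r by rewrite /t ltr_pdivrMr// mulr2n mulrDr mulr1 ltrDl lt_min e0 r0.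
move: te; rewrite lt_min => /andP[te tr].
have ab s : s \in `]0, t[ -> `|s| < e.
  by rewrite in_itv/= => /andP[s0 st]; rewrite gtr0_norm// (lt_trans st).
have [|||c] := @MVT _ g dg 0 t.
- exact: t0.
- by move=> s /ab /dgE.
- apply: derivable_within_continuous => s; rewrite in_itv/= => /andP[s0 st].
  by have [|] := dgE s => //; rewrite ger0_norm// (le_lt_trans st).
rewrite in_itv/= => /andP[c0 ct] gE.
have := gmax t; rewrite gtr0_norm// => /(_ te).
rewrite -subr_le0 gE subr0 pmulr_lle0// leNgt pos//.
exact: lt_trans ct tr.
Qed.

Lemma is_derive_bigsum (J : Type) (s : seq J) (P : pred J) (F : J -> V -> R) (dF : J -> R) x v :
  (forall j, is_derive x v (F j) (dF j)) ->
  is_derive x v (fun y => \sum_(j <- s | P j) F j y) (\sum_(j <- s | P j) dF j).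
Proof.
move=> dFE; elim: s => [|j s IH].
  by under eq_fun do rewrite big_nil; rewrite big_nil; exact: is_derive_cst.
under eq_fun do rewrite big_cons.
by rewrite big_cons; case: (P j) => //; exact: is_deriveD.
Qed.

End Calculus.

(** * Polynomials in [R * 'rV[R]_m] *)

Section Polynomials.
Variables (R : realType) (m : nat).
Local Notation E := (R * 'rV[R]_m)%type.
Implicit Types (F G : E -> R) (z v : E) (i j : option 'I_m).

(* [None] indexes the variable [t], or [log t], and [Some k] the variable [x_k]. *)
Definition ebase i : E := if i is Some k then (0, delta_mx ord0 k) else (1, 0).

Definition coord i z : R := if i is Some k then z.2 ord0 k else z.1.

Definition of_coord (c : option 'I_m -> R) : E := (c None, \row_k c (Some k)).

Lemma of_coordE c i : coord i (of_coord c) = c i.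
Proof. by case: i => [k|] //=; rewrite mxE. Qed.

Lemma coordD i z w : coord i (z + w) = coord i z + coord i w.
Proof. by case: i => [k|] //=; rewrite mxE. Qed.

Lemma coordZ i a z : coord i (a *: z) = a * coord i z.
Proof. by case: i => [k|] //=; rewrite mxE. Qed.

Lemma coord_ebase i j : coord i (ebase j) = (i == j)%:R.
Proof. by case: i j => [k|] [l|] //=; rewrite mxE ?eqxx. Qed.

Lemma continuous_coord i : continuous (coord i).
Proof.
case: i => [k|] z /=; last exact: cvg_fst.
apply: (@continuous_comp E _ _ snd (fun x : 'rV[R]_m => x ord0 k)); first exact: cvg_snd.
exact: coord_continuous.
Qed.

Lemma is_derive_coord i z v : is_derive z v (coord i) (coord i v).
Proof. by apply: is_derive_affine => h; rewrite coordD coordZ addrC. Qed.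

(* [pol d] are the polynomials of degree less than [d]. *)
Inductive pol : nat -> (E -> R) -> Prop :=
| pol0 d : pol d (fun=> 0)
| pol_cst d c : pol d.+1 (fun=> c)
| pol_add d F G : pol d F -> pol d G -> pol d (fun z => F z + G z)
| pol_coord d i F : pol d F -> pol d.+1 (fun z => coord i z * F z).

Lemma pol_leq d e F : (d <= e)%N -> pol d F -> pol e F.
Proof.
move=> de pF; elim: pF e de => {d F}.
- by move=> d e _; exact: pol0.
- by move=> d c [//|e] _; exact: pol_cst.
- by move=> d F G _ IF _ IG e de; apply: pol_add; [exact: IF|exact: IG].
- by move=> d i F _ IF [//|e] de; apply: pol_coord; exact: IF.
Qed.

Lemma pol_zero F : pol 0 F -> F = fun=> 0.
Proof.
move=> pF; have {pF} : exists2 d, d = 0%N & pol d F by exists 0%N.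
case=> d d0 pF; elim: pF d0 => // {}d F1 G _ IF _ IG d0.
by apply/funext => z; rewrite IF// IG// addr0.
Qed.

Lemma pol_scale d c F : pol d F -> pol d (fun z => c * F z).
Proof.
elim => {d F}.
- by move=> d; rewrite mulr0; exact: pol0.
- by move=> d b; exact: pol_cst.
- move=> d F G _ IF _ IG; under eq_fun do rewrite mulrDr; exact: pol_add.
- by move=> d i F _ IF; under eq_fun do rewrite mulrCA; exact: pol_coord.
Qed.

Lemma pol_sum d (J : Type) (s : seq J) (P : pred J) (F : J -> E -> R) :
  (forall k, pol d (F k)) -> pol d (fun z => \sum_(k <- s | P k) F k z).
Proof.
move=> pF; elim: s => [|k s IH].
  by under eq_fun do rewrite big_nil; exact: pol0.
under eq_fun do rewrite big_cons.
by case: (P k) => //; exact: pol_add.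
Qed.

(** Since [pol] bounds the degree strictly, the first factor has degree at most [d] and the bound is
    sharp. Sharpness matters for [pol_dirichlet]: multiplying by a quadratic and taking the
    Laplacian must lead back to [pol d]. *)
Lemma pol_mul d e F G : pol d.+1 F -> pol e G -> pol (d + e) (fun z => F z * G z).
Proof.
move=> pF pG; move: {2 3}d.+1 (erefl d.+1) pF => d' dd' pF.
elim: pF d dd' => {d' F}.
- by move=> ? d _; under eq_fun do rewrite mul0r; exact: pol0.
- by move=> ? c d _; apply: (@pol_leq e); [exact: leq_addl|exact: pol_scale].
- move=> ? F1 F2 _ IF1 _ IF2 d dd'; under eq_fun do rewrite mulrDl.
  by apply: pol_add; [exact: IF1|exact: IF2].
- move=> ? i F pF IF [|d] [dd']; under eq_fun do rewrite -mulrA.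
    move: pF; rewrite -dd' => /pol_zero ->.
    by under eq_fun do rewrite mul0r mulr0; exact: pol0.
  by apply: pol_coord; exact: IF.
Qed.

Lemma pol_derive d F v : pol d F ->
  (forall z, derivable F z v) /\ pol d.-1 ('D_v F).
Proof.
elim => {d F}.
- move=> d; split=> [z|]; first exact: derivable_cst.
  rewrite (_ : 'D_v _ = fun=> 0); first exact: pol0.
  by apply/funext => z; rewrite derive_cst.
- move=> d c; split=> [z|]; first exact: derivable_cst.
  rewrite (_ : 'D_v _ = fun=> 0); first exact: pol0.
  by apply/funext => z; rewrite derive_cst.
- move=> d F G _ [dF pF] _ [dG pG]; split => [z|].
    by apply: derivableD; [exact: dF|exact: dG].
  rewrite (_ : 'D_v _ = fun z => 'D_v F z + 'D_v G z); first exact: pol_add.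
  by apply/funext => z; rewrite deriveD.
- move=> d i F pF [dF pDF]; split => [z|].
    by apply: derivableM; [have [] := is_derive_coord i z v|exact: dF].
  rewrite (_ : 'D_v _ = fun z => coord i z * 'D_v F z + coord i v * F z); last first.
    apply/funext => z; have [dc cE] := is_derive_coord i z v.
    by rewrite deriveM// cE/= [F z *: _]mulrC.
  apply: pol_add; last exact: pol_scale.
  (* The predecessor is truncated: for [d = 0] the degree count fails, but then the derivative of
     [F] is zero. *)
  case: d pF pDF => [_ /= /pol_zero DF0 | d pF pDF]; last exact: pol_coord.
  rewrite (_ : (fun z => _) = fun=> 0); first exact: pol0.
  by apply/funext => z; rewrite [X in _ * X](congr1 (@^~ z) DF0) mulr0.
Qed.

Definition laplacian F z : R := \sum_i 'D_(ebase i) ('D_(ebase i) F) z.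

Definition ispol F := exists d, pol d F.

Lemma ispol_cst c : ispol (fun=> c).
Proof. by exists 1%N; exact: pol_cst. Qed.

Lemma ispol_add F G : ispol F -> ispol G -> ispol (fun z => F z + G z).
Proof.
move=> [d pF] [e pG]; exists (maxn d e); apply: pol_add.
  by apply: pol_leq pF; rewrite leq_maxl.
by apply: pol_leq pG; rewrite leq_maxr.
Qed.

Lemma ispol_mul F G : ispol F -> ispol G -> ispol (fun z => F z * G z).
Proof.
move=> [d pF] [e pG]; exists (d + e)%N; apply: pol_mul => //.
exact: pol_leq (leqnSn d) pF.
Qed.

Lemma ispol_coord i : ispol (coord i).
Proof.
exists 2%N; rewrite (_ : coord i = fun z => coord i z * 1).
  exact: pol_coord (pol_cst _ _).
by apply/funext => z; rewrite mulr1.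
Qed.

Lemma ispol_opp F : ispol F -> ispol (fun z => - F z).
Proof.
move=> pF; rewrite (_ : (fun z => - F z) = fun z => (-1) * F z).
  exact: ispol_mul (ispol_cst _) pF.
by apply/funext => z; rewrite mulN1r.
Qed.

Lemma ispol_sub F G : ispol F -> ispol G -> ispol (fun z => F z - G z).
Proof. by move=> pF pG; apply: ispol_add => //; exact: ispol_opp. Qed.

Lemma ispol_exp F k : ispol F -> ispol (fun z => F z ^+ k).
Proof.
move=> pF; elim: k => [|k IH]; first by under eq_fun do rewrite expr0; exact: ispol_cst.
by under eq_fun do rewrite exprS; exact: ispol_mul.
Qed.

Lemma ispol_sum (J : Type) (s : seq J) (P : pred J) (F : J -> E -> R) :
  (forall k, ispol (F k)) -> ispol (fun z => \sum_(k <- s | P k) F k z).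
Proof.
move=> pF; elim: s => [|k s IH].
  by under eq_fun do rewrite big_nil; exact: ispol_cst.
under eq_fun do rewrite big_cons.
by case: (P k) => //; exact: ispol_add.
Qed.

Lemma ispol_prod (J : Type) (s : seq J) (P : pred J) (F : J -> E -> R) :
  (forall k, ispol (F k)) -> ispol (fun z => \prod_(k <- s | P k) F k z).
Proof.
move=> pF; elim: s => [|k s IH].
  by under eq_fun do rewrite big_nil; exact: ispol_cst.
under eq_fun do rewrite big_cons.
by case: (P k) => //; exact: ispol_mul.
Qed.

Lemma ispol_derivable F z v : ispol F -> derivable F z v.
Proof. by case=> d /(pol_derive v)[+ _]; exact. Qed.

Lemma ispol_derive F v : ispol F -> ispol ('D_v F).
Proof. by case=> d /(pol_derive v)[_]; exists d.-1. Qed.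

Lemma pol_laplacian d F : pol d.+2 F -> pol d (laplacian F).
Proof.
move=> pF; apply: pol_sum => i.
by have [_ /(pol_derive (ebase i))[]] := pol_derive (ebase i) pF.
Qed.

Lemma ispol_laplacian F : ispol F -> ispol (laplacian F).
Proof.
by case=> d pF; exists d; apply: pol_laplacian; apply: pol_leq pF; rewrite -addn2 leq_addr.
Qed.

Lemma ispol_continuous F : ispol F -> continuous F.
Proof.
case=> d; elim => {d F}.
- by move=> d z; exact: cvg_cst.
- by move=> d c z; exact: cvg_cst.
- by move=> d F G _ IF _ IG z; apply: cvgD; [exact: IF|exact: IG].
- by move=> d i F _ IF z; apply: cvgM; [exact: continuous_coord|exact: IF].
Qed.

Lemma laplacianD F G : ispol F -> ispol G ->
  laplacian (fun z => F z + G z) = fun z => laplacian F z + laplacian G z.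
Proof.
move=> pF pG; apply/funext => z; rewrite /laplacian -big_split/=.
apply: eq_bigr => i _.
rewrite (_ : 'D_(ebase i) (fun z => F z + G z) =
  fun z => 'D_(ebase i) F z + 'D_(ebase i) G z); last first.
  by apply/funext => w; rewrite deriveD//; exact: ispol_derivable.
by rewrite deriveD//; apply: ispol_derivable; exact: ispol_derive.
Qed.

Lemma laplacianZ c F : ispol F ->
  laplacian (fun z => c * F z) = fun z => c * laplacian F z.
Proof.
move=> pF; apply/funext => z; rewrite /laplacian mulr_sumr.
apply: eq_bigr => i _.
rewrite (_ : 'D_(ebase i) (fun z => c * F z) =
  fun z => c * 'D_(ebase i) F z); last first.
  by apply/funext => w; rewrite deriveMl//; exact: ispol_derivable.
by rewrite deriveMl//; apply: ispol_derivable; exact: ispol_derive.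
Qed.

Lemma laplacianB F G : ispol F -> ispol G ->
  laplacian (fun z => F z - G z) = fun z => laplacian F z - laplacian G z.
Proof.
move=> pF pG.
rewrite (_ : (fun z => F z - G z) = fun z => F z + (-1) * G z); last first.
  by apply/funext => z; rewrite mulN1r.
rewrite laplacianD//; last exact: ispol_mul (ispol_cst _) pG.
by rewrite laplacianZ//; apply/funext => z; rewrite mulN1r.
Qed.

Lemma laplacian_cst c : laplacian (fun=> c) = fun=> 0.
Proof.
apply/funext => z; rewrite /laplacian big1// => i _.
rewrite (_ : 'D_(ebase i) (fun=> c) = fun=> 0); first by rewrite derive_cst.
by apply/funext => w; rewrite derive_cst.
Qed.

(** The norm of [E] is the sup norm; the Euclidean distance enters through its square, which is a
    polynomial. *)
Definition sqdist z w : R := \sum_i (coord i z - coord i w) ^+ 2.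

Lemma sqdist_ge0 z w : 0 <= sqdist z w.
Proof. by apply: sumr_ge0 => i _; exact: sqr_ge0. Qed.

Lemma pol_sqdist w : pol 3 (sqdist^~ w).
Proof.
apply: pol_sum => i; under eq_fun do rewrite expr2.
have p : pol 2 (fun z => coord i z - coord i w).
  apply: pol_add; last exact: pol_cst.
  rewrite (_ : coord i = fun z => coord i z * 1); first exact: pol_coord (pol_cst _ _).
  by apply/funext => z; rewrite mulr1.
exact: (@pol_mul 1 2).
Qed.

Lemma derive_sqdist w i : 'D_(ebase i) (sqdist^~ w) = fun z => 2 * (coord i z - coord i w).
Proof.
apply/funext => z.
have dc k : is_derive z (ebase i) (fun z => coord k z - coord k w) (k == i)%:R.
  by apply: is_derive_affine => h; rewrite coordD coordZ coord_ebase; ring.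
have d2 k : is_derive z (ebase i) (fun z => (coord k z - coord k w) ^+ 2)
    (2 * (coord k z - coord k w) * (k == i)%:R).
  have := is_deriveX 2 (dc k); rewrite /= expr1 => /is_derive_eq; apply.
  by rewrite /GRing.scale /=; ring.
have [_ ->] := is_derive_bigsum (index_enum (option 'I_m)) xpredT d2.
rewrite (bigD1 i)//= eqxx mulr1 big1 ?addr0// => k /negbTE ->.
by rewrite mulr0.
Qed.

Lemma laplacian_sqdist w : laplacian (sqdist^~ w) = fun=> 2 * m.+1%:R.
Proof.
apply/funext => z; rewrite /laplacian.
under eq_bigr => i _.
  rewrite derive_sqdist.
  have -> : 'D_(ebase i) (fun z => 2 * (coord i z - coord i w)) z = 2.
    have [] // : is_derive z (ebase i) (fun z => 2 * (coord i z - coord i w)) 2.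
    by apply: is_derive_affine => h; rewrite coordD coordZ coord_ebase eqxx mulr1n; ring.
  over.
by rewrite sumr_const card_option card_ord mulr_natr.
Qed.

End Polynomials.
Arguments sqdist {R m} z w.
Arguments coord {R m} i z.
Arguments ebase {R m} i.
Arguments laplacian {R m} F z.
Arguments ispol {R m} F.

(* Cayley-Hamilton: [C] kills [X^k * q] with [q(0) != 0]; by hypothesis the
   factor [X^k] can be dropped in front of [a], and [q(C)] exhibits the constant
   term as a multiple of [C]. *)
Lemma row_family_surj (K : fieldType) N (T : Type) (D : set T) (a : T -> 'rV[K]_N)
    (C : 'M[K]_N) :
  (forall c : 'cV_N, (forall z, D z -> a z *m C *m c = 0) ->
     forall z, D z -> a z *m c = 0) ->
  exists B : 'M[K]_N, forall z, D z -> a z = a z *m C *m B.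
Proof.
have colM p q r (A : 'M[K]_(p, q)) (B : 'M[K]_(q, r)) j :
    col j (A *m B) = A *m col j B.
  by apply/matrixP => x y; rewrite !mxE; apply: eq_bigr => l _; rewrite !mxE.
case: N a C => [|N] a C inj.
  by exists C => z _; rewrite [LHS]thinmx0 [RHS]thinmx0.
have injM : forall p (M : 'M[K]_(N.+1, p)), (forall z, D z -> a z *m C *m M = 0) ->
      forall z, D z -> a z *m M = 0.
  move=> p M M0 z Dz; apply/rowP => j.
  have /inj /(_ _ Dz) /(congr1 (fun A : 'M[K]_1 => A ord0 ord0)) : forall w, D w -> a w *m C *m col j M = 0.
    by move=> w /M0 /(congr1 (col j)); rewrite -!colM => ->; rewrite col0.
  by rewrite -colM mxE [RHS]mxE => ->; rewrite mxE.
have injX k (M : 'M[K]_N.+1) : (forall z, D z -> a z *m (C ^+ k *m M) = 0) ->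
      forall z, D z -> a z *m M = 0.
  elim: k M => [|k IH] M M0 z Dz; first by have := M0 _ Dz; rewrite expr0 mul1mx.
  apply: IH Dz; apply: injM => w Dw; rewrite -(M0 _ Dw).
  have -> : C ^+ k.+1 = C *m C ^+ k by rewrite exprS.
  by rewrite !mulmxA.
have [k [q q0 pE]] := multiplicity_XsubC (char_poly C) 0.
move: q0; rewrite monic_neq0 ?char_poly_monic//= => q0.
have qC0 z : D z -> a z *m horner_mx C q = 0.
  apply: (injX k) => w _; rewrite mulmxE -[C in C ^+ k]horner_mx_X -rmorphXn -rmorphM/=.
  have -> : 'X^k * q = char_poly C by rewrite pE mulrC polyC0 subr0.
  by rewrite Cayley_Hamilton mulmx0.
have /factor_theorem[q1 q1E] : root (q - q.[0]%:P) 0.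
  by rewrite /root !hornerE subrr.
exists (- q.[0]^-1 *: horner_mx C q1) => z Dz.
have {q1E}qE : q = q.[0]%:P + 'X * q1.
  by rewrite mulrC -['X]subr0 -polyC0 -q1E addrC subrK.
have := qC0 _ Dz; rewrite {1}qE rmorphD rmorphM/= horner_mx_C horner_mx_X.
rewrite mulmxDr mul_mx_scalar -mulmxE mulmxA => /eqP.
rewrite addr_eq0 => /eqP aE.
rewrite scaleNr mulmxN -scalemxAr -[RHS]scalerN -aE scalerA mulVf ?scale1r//.
Qed.

(** * Finite spanning families of polynomials *)

Section Solve.
Variables (R : realType) (m : nat).
Local Notation E := (R * 'rV[R]_m)%type.
Implicit Types (F G : E -> R) (z v : E).

(** The family consists of 1 and of each coordinate times a member of the family one degree lower,
    so monomials repeat. Spanning is enough: [row_family_surj] speaks of the values [a z], never of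
    coefficients, and tolerates linear dependence. *)
Lemma pol_span d : exists N, exists a : E -> 'rV[R]_N,
  (forall j, pol d (fun z => a z ord0 j)) /\
  (forall F, pol d F -> exists c : 'cV_N, forall z, F z = (a z *m c) ord0 ord0).
Proof.
suff [J [a [pa sa]]] : exists J : finType, exists a : J -> E -> R,
    (forall j, pol d (a j)) /\
    forall F, pol d F -> exists c : J -> R, forall z, F z = \sum_j a j z * c j.
  exists #|J|, (fun z => \row_j a (enum_val j) z); split => [j|F /sa[c cE]].
    by under eq_fun do rewrite mxE; exact: pa.
  exists (\col_j c (enum_val j)) => z; rewrite cE !mxE.
  rewrite (reindex (@enum_val J predT)); last first.
    by apply: onW_bij; exact: enum_val_bij.
  by apply: eq_bigr => j _; rewrite !mxE.
elim: d => [|d [J [a [pa sa]]]].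
  exists 'I_0, (fun _ _ => 0); split=> [j|F /pol_zero ->]; first exact: pol0.
  by exists (fun=> 0) => z; rewrite big_ord0.
exists (option (option 'I_m * J)), (fun x z => if x is Some (i, j) then coord i z * a j z else 1).
split=> [[[i j]|]|F pF]; [exact: pol_coord|exact: pol_cst|].
move: {2 3}d.+1 (erefl d.+1) pF => d' dd' pF; elim: pF dd' => {d' F}.
- by move=> d' _; exists (fun=> 0) => z; rewrite big1// => x _; rewrite mulr0.
- move=> d' c _; exists (fun x => if x is Some _ then 0 else c) => z.
  by rewrite (bigD1 None)//= mul1r big1 ?addr0// => -[x|] // _; rewrite mulr0.
- move=> d' F G _ IF _ IG dd'; have [c cE] := IF dd'; have [b bE] := IG dd'.
  exists (fun x => c x + b x) => z; rewrite cE bE -big_split/=.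
  by apply: eq_bigr => x _; rewrite mulrDr.
- move=> d' i F pF _ [dd']; have [c cE] : exists c : J -> R, forall z, F z = \sum_j a j z * c j.
    by apply: sa; rewrite dd'.
  exists (fun x => if x is Some (k, j) then (k == i)%:R * c j else 0) => z.
  rewrite cE (bigD1 None)//= mulr0 add0r.
  rewrite (reindex_omap Some id)/=; last by case.

  rewrite [RHS](_ : _ = \sum_k \sum_j coord k z * a j z * ((k == i)%:R * c j)); last first.
    by rewrite pair_bigA/=; apply: eq_big => [x|[k j] _]//=; rewrite eqxx.
  rewrite (bigD1 i)//= [X in _ + X]big1 ?addr0 => [|k /negbTE ki].
    by rewrite mulr_sumr; apply: eq_bigr => j _; rewrite eqxx mul1r mulrA.
  by rewrite big1// => j _; rewrite ki mul0r mulr0.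
Qed.

End Solve.

(** * Comparison principle and polynomial Dirichlet problem on a ball *)

Section Ball.
Variables (R : realType) (m : nat).
Local Notation E := (R * 'rV[R]_m)%type.
Implicit Types (F G U H : E -> R) (z w v : E) (r e : R).

(** Two shapes are needed: cubes suit Bernstein approximation and the doubling argument, while disks
    have a quadratic boundary equation, on which the Dirichlet problem rests. *)
Definition cube r z0 : set E := [set z | forall i, `|coord i z - coord i z0| <= r].
Definition disk r z0 : set E := [set z | sqdist z z0 <= r ^+ 2].
Definition open_disk r z0 : set E := [set z | sqdist z z0 < r ^+ 2].

Lemma compact_cube r z0 : compact (cube r z0).
Proof.
pose I k := `[coord k z0 - r, coord k z0 + r]%classic.
have inI k x : (I k x) <-> (`|x - coord k z0| <= r).
  rewrite /I /= in_itv/= ler_norml; split=> /andP[? ?]; apply/andP; split; lra.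
have -> : cube r z0 = I None `*` [set v : 'rV[R]_m | forall k, I (Some k) (v ord0 k)].
  apply/seteqP; split => z /= zr; first by split=> [|k]; apply/inI; [exact: (zr None)|exact: (zr (Some k))].
  by case: zr => z1 z2 [k|]; apply/inI; [exact: z2|exact: z1].
apply: compact_setX; first exact: segment_compact.
by apply: (@rV_compact _ _ (fun k => I (Some k))) => k; exact: segment_compact.
Qed.

Lemma sqdist_continuous z0 : continuous (sqdist^~ z0 : E -> R).
Proof. by apply: ispol_continuous; exists 3%N; exact: pol_sqdist. Qed.

Lemma disk_cube r z0 : 0 <= r -> disk r z0 `<=` cube r z0.
Proof.
move=> r0 z zr i; rewrite -(@ler_pXn2r _ 2)// ?nnegrE// -normrX ger0_norm ?sqr_ge0//.
apply: le_trans zr; rewrite /sqdist (bigD1 i)//= lerDl.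
by apply: sumr_ge0 => k _; exact: sqr_ge0.
Qed.

Lemma closed_disk r z0 : closed (disk r z0).
Proof.
rewrite -[disk r z0]setCK; apply: open_closedC.
rewrite (_ : ~` _ = (sqdist^~ z0) @^-1` [set x | r ^+ 2 < x]).
  by apply: open_comp (@open_gt R _) => z _; exact: sqdist_continuous.
by apply/seteqP; split => z /=; rewrite /disk/= ltNge => /negP.
Qed.

Lemma open_open_disk r z0 : open (open_disk r z0).
Proof.
by apply: (@open_comp E R (sqdist^~ z0) [set x | x < r ^+ 2] _ (@open_lt R _)) => z _; exact: sqdist_continuous.
Qed.

Lemma compact_disk r z0 : 0 <= r -> compact (disk r z0).
Proof.
move=> r0; apply: (subclosed_compact (@closed_disk _ _) (@compact_cube r z0)).
exact: disk_cube.
Qed.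

Lemma sqdistxx z : sqdist z z = 0.
Proof. by rewrite /sqdist big1// => i _; rewrite subrr expr0n. Qed.

Lemma open_line (O : set E) z v : open O -> O z ->
  exists2 e, 0 < e & forall t : R, `|t| < e -> O (z + t *: v).
Proof.
move=> oO Oz.
have cl : (z + t *: v) @[t --> (0 : R)] --> z + (0 : R) *: v.
  by apply: cvgD; [exact: cvg_cst|exact: cvgZl].
have : \forall t \near (0 : R), O (z + t *: v).
  by apply: cl; rewrite scale0r addr0; exact: open_nbhs_nbhs.
move=> /nbhs_ballP[e /= e0 he]; exists e => // t te; apply: he.
by rewrite /ball/= sub0r normrN.
Qed.

Lemma pol_max_test (O : set E) F z : open O -> O z -> ispol F ->
  (forall w, O w -> F w <= F z) ->
  forall i, 'D_(ebase i) F z = 0 /\ 'D_(ebase i) ('D_(ebase i) F) z <= 0.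
Proof.
move=> oO Oz pF Fmax i.
have [e e0 he] := open_line (ebase i) oO Oz.
have line (G : E -> R) t : ispol G ->
    is_derive t (1 : R) (fun s => G (z + s *: ebase i)) ('D_(ebase i) G (z + t *: ebase i)).
  by move=> pG; apply: derive_line; exact: ispol_derivable.
have [] := @second_derivative_test R (fun s => F (z + s *: ebase i))
  (fun s => 'D_(ebase i) F (z + s *: ebase i)) e ('D_(ebase i) ('D_(ebase i) F) (z + (0 : R) *: ebase i)) e0.
- by move=> t _; exact: line.
- by move=> t /he; rewrite scale0r addr0; exact: Fmax.
- by apply: line; exact: ispol_derive.
by rewrite scale0r addr0.
Qed.

(** The subsolution half of [laplacian U = H], required only for polynomials and for maxima over the
    whole of [K]; the comparison argument produces just such a maximum. *)
Definition touches_above (K O : set E) U H := forall P, ispol P -> forall z, O z ->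
  (forall w, K w -> U w - P w <= U z - P z) -> H z <= laplacian P z.

Lemma pol_touches r z0 F : ispol F -> touches_above (disk r z0) (open_disk r z0) F (laplacian F).
Proof.
move=> pF P pP z Oz FP; rewrite -subr_le0 -[_ - _]/((fun z => laplacian F z - laplacian P z) z).
rewrite -laplacianB//; apply: sumr_le0 => i _.
have := @pol_max_test (open_disk r z0) (fun z => F z - P z) z.
case/(_ _ _ _ _ i) => //; first exact: open_open_disk; first exact: ispol_sub.
by move=> w Ow; apply: FP; exact: ltW.
Qed.

(** Lowering [F] by [e * sqdist] makes it a strict supersolution: an interior maximum of [U - P]
    would give [H <= laplacian F - 2 (m + 1) e < H]. The maximum thus lies on the sphere, where the
    boundary bound applies, and the barrier costs at most [e * r ^+ 2]. *)
Lemma comparison r z0 e U H F : 0 < r -> 0 < e -> {within disk r z0, continuous U} ->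
  touches_above (disk r z0) (open_disk r z0) U H -> ispol F ->
  (forall z, open_disk r z0 z -> laplacian F z <= H z + e) ->
  (forall z, sqdist z z0 = r ^+ 2 -> U z <= F z + e) ->
  forall z, disk r z0 z -> U z <= F z + e * (1 + r ^+ 2).
Proof.
move=> r0 e0 cU vU pF LF bF z Kz.
have ps : ispol (sqdist^~ z0 : E -> R) by exists 3%N; exact: pol_sqdist.
pose P w := F w - e * sqdist w z0.
have pP : ispol P by apply: ispol_sub => //; exact: ispol_mul (ispol_cst _ _) ps.
have [|||w Kw wmax] := @compact_EVT_max E R (fun w => U w - P w) (disk r z0).
- by exists z.
- exact/compact_disk/ltW.
- move=> x; apply: cvgB; first exact: cU.
  by have /continuous_subspaceT := ispol_continuous pP; exact.
rewrite inE in Kw; have := wmax z (mem_set Kz); rewrite /P.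
move: Kw; rewrite /disk/= le_eqVlt => /orP[/eqP wr|wr].
  have := bF _ wr; rewrite wr; have := mulr_ge0 (ltW e0) (sqdist_ge0 z z0); lra.
have := vU P pP w wr; rewrite /P laplacianB//; last exact: ispol_mul (ispol_cst _ _) ps.
rewrite laplacianZ// laplacian_sqdist => h; exfalso.
have /h : forall w0, disk r z0 w0 -> U w0 - P w0 <= U w - P w.
  by move=> x Kx; apply: wmax; rewrite inE.
rewrite leNgt => /negP; apply; have := LF _ wr.
have : 1 <= m.+1%:R :> R by rewrite ler1n.
nra.
Qed.

Lemma laplacian_comb N (a : 'I_N -> E -> R) (c : 'I_N -> R) : (forall j, ispol (a j)) ->
  laplacian (fun z => \sum_j a j z * c j) = fun z => \sum_j laplacian (a j) z * c j.
Proof.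
move=> pa; elim: (index_enum _) => [|k s IH].
  under eq_fun do rewrite big_nil.
  by rewrite laplacian_cst; apply/funext => z; rewrite big_nil.
under eq_fun do rewrite big_cons.
rewrite laplacianD; last 2 first.
- exact: ispol_mul (ispol_cst _ _).
- by apply: ispol_sum => j; exact: ispol_mul (ispol_cst _ _).
apply/funext => z; rewrite big_cons; have /= <- := congr1 (@^~ z) IH; congr (_ + _).
rewrite (_ : (fun z => a k z * c k) = fun z => c k * a k z).
  by rewrite laplacianZ// mulrC.
by apply/funext => w; rewrite mulrC.
Qed.

(* By [comparison], [q |-> laplacian ((r^2 - |z - z0|^2) q)] is injective on the
   finite-dimensional space of polynomials of degree less than [d], hence onto. *)
Lemma pol_dirichlet r z0 d G : 0 < r -> pol d G -> exists2 q, ispol q &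
  forall z, open_disk r z0 z -> laplacian (fun w => (r ^+ 2 - sqdist w z0) * q w) z = G z.
Proof.
move=> r0 pG; pose rho w := r ^+ 2 - sqdist w z0.
have prho : pol 3 rho.
  rewrite (_ : rho = fun w => r ^+ 2 + (-1) * sqdist w z0).
    by apply: pol_add; [exact: pol_cst|apply: pol_scale; exact: pol_sqdist].
  by apply/funext => w; rewrite mulN1r.
have [N [a [pa sa]]] := pol_span R m d.
have pcomb (c : 'cV[R]_N) : pol d (fun z => (a z *m c) ord0 ord0).
  under eq_fun do rewrite mxE; apply: pol_sum => k.
  by under eq_fun do rewrite mulrC; exact: pol_scale.
have pTa j : pol d (laplacian (fun w => rho w * a w ord0 j)).
  by apply: pol_laplacian; exact: (@pol_mul _ _ 2 d).
have {}/choice[C CE] : forall j, exists c : 'cV[R]_N, forall z,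
    laplacian (fun w => rho w * a w ord0 j) z = (a z *m c) ord0 ord0.
  by move=> j; exact: sa.
(* A matrix of [q |-> laplacian (rho q)] in the family [a]; column [j] holds some choice of
   coefficients of the image of the [j]-th member. *)
pose CM := \matrix_(i, j) C j i ord0.
have TE (c : 'cV[R]_N) z :
    laplacian (fun w => rho w * (a w *m c) ord0 ord0) z = (a z *m CM *m c) ord0 ord0.
  rewrite (_ : (fun w => _) = fun w => \sum_j (rho w * a w ord0 j) * c j ord0); last first.
    by apply/funext => w; rewrite mxE mulr_sumr; apply: eq_bigr => j _; rewrite mulrA.
  rewrite laplacian_comb => [|j]; last first.
    by apply: ispol_mul; [exists 3%N|exists d; exact: pa].
  rewrite mxE; apply: eq_bigr => j _; rewrite CE !mxE; congr (_ * _).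
  by apply: eq_bigr => k _; rewrite !mxE.
have [|B BE] := @row_family_surj R N E (open_disk r z0) a CM.
  move=> c c0 z Oz; rewrite [LHS]mx11_scalar [RHS]mx11_scalar; congr _%:M.
  rewrite [RHS]mxE; set q := fun w => (a w *m c) ord0 ord0; rewrite -[LHS]/(q z).
  have pq : ispol q by exists d; exact: pcomb.
  have prq : ispol (fun w => rho w * q w) by apply: ispol_mul => //; exists 3%N.
  have prq' : ispol (fun w => - (rho w * q w)) by exact: ispol_opp.
  have L0 w : open_disk r z0 w -> laplacian (fun w => rho w * q w) w = 0.
    by move=> Ow; rewrite TE c0// mxE.
  have L0' w : open_disk r z0 w -> laplacian (fun w => - (rho w * q w)) w = 0.
    move=> Ow; under eq_fun do rewrite -mulN1r.
    by rewrite laplacianZ// L0// mulr0.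
  (* The maximum principle for polynomials: [comparison] with the zero polynomial, at every error
     [e]. Applied to [rho q] and to its opposite it gives uniqueness. *)
  have small F : ispol F -> (forall w, open_disk r z0 w -> laplacian F w = 0) ->
      (forall w, sqdist w z0 = r ^+ 2 -> F w = 0) -> F z <= 0.
    move=> pF LF bF; apply/ler_addgt0Pr => e e0; rewrite add0r.
    have e1 : 0 < e / (1 + r ^+ 2) by rewrite divr_gt0// ltr_wpDr// sqr_ge0.
    have := @comparison r z0 _ F (laplacian F) (fun=> 0) r0 e1.
    rewrite mulfVK; last by rewrite gt_eqF// ltr_wpDr// sqr_ge0.
    move=> cmp; rewrite -[e]add0r; apply: cmp.
    - by apply: continuous_subspaceT; exact: ispol_continuous.
    - exact: pol_touches.
    - exact: ispol_cst.
    - by move=> w Ow; rewrite laplacian_cst LF// add0r ltW.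
    - by move=> w /bF ->; rewrite add0r ltW.
    - exact: ltW.
  have rq : rho z * q z = 0.
    have bd w : sqdist w z0 = r ^+ 2 -> rho w * q w = 0.
      by move=> wr; rewrite /rho wr subrr mul0r.
    apply/eqP; rewrite eq_le; apply/andP; split; first exact: small prq L0 bd.
    rewrite -oppr_le0; apply: (small (fun w => - (rho w * q w)) prq' L0') => w wr.
    by rewrite bd// oppr0.
  by move/eqP: rq; rewrite mulf_eq0 gt_eqF/= ?subr_gt0// => /eqP.
(* If [c] are coefficients of [G], then [B *m c] are coefficients of the solution, because
   [a z *m CM *m B = a z] on the disk. *)
have [c cE] := sa _ pG.
exists (fun w => (a w *m (B *m c)) ord0 ord0); first by exists d; exact: pcomb.
by move=> z Oz; rewrite TE cE mulmxA -(BE _ Oz).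
Qed.

End Ball.

(** * Polynomial approximation *)

Section Bernstein.
Variable R : realType.
Implicit Types (y : R) (g : nat -> R).

Definition bernstein N (k : nat) y : R := (y ^+ k * (1 - y) ^+ (N - k)) *+ 'C(N, k).

Lemma bernstein_ge0 N k y : 0 <= y <= 1 -> 0 <= bernstein N k y.
Proof.
move=> /andP[y0 y1]; rewrite mulrn_wge0// mulr_ge0// exprn_ge0// subr_ge0//.
Qed.

Let B N y g := \sum_(k < N.+1) bernstein N k y * g k.

(** Pascal's rule, read as conditioning a binomial count on one trial; the moments below follow from
    it by induction on [N]. *)
Let BS N y g : B N.+1 y g = y * B N y (fun k => g k.+1) + (1 - y) * B N y g.
Proof.
have w0 : bernstein N.+1 0 y = (1 - y) * bernstein N 0 y.
  by rewrite /bernstein !bin0 !mulr1n !expr0 !mul1r !subn0 exprS.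
have wS k : (k <= N)%N -> bernstein N.+1 k.+1 y = y * bernstein N k y + (1 - y) * bernstein N k.+1 y.
  move=> kN; rewrite /bernstein binS subSS mulrnDr addrC; congr (_ + _).
    by rewrite exprS -mulrA mulrnAr.
  (* For [k = N] the subtraction in the exponent is truncated, but the binomial coefficient is then
     zero. *)
  have [kN'|Nk] := ltnP k N; last by rewrite (bin_small (n := N)) ?mulr0n ?mulr0.
  by rewrite -(subnSK kN') [(1 - y) ^+ _.+1]exprS mulrCA mulrnAr.
have wN : bernstein N N.+1 y = 0 by rewrite /bernstein bin_small.
rewrite /B big_ord_recl w0 /=.
under eq_bigr => k _ do rewrite /bump/= add1n wS ?leq_ord// mulrDl -!mulrA.
rewrite big_split/= -!mulr_sumr [X in _ = _ + _ * X]big_ord_recl/= mulrDr.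
have -> : \sum_(k < N.+1) bernstein N k.+1 y * g k.+1 = \sum_(k < N) bernstein N (bump 0 k) y * g (bump 0 k).
  by rewrite big_ord_recr/= wN mul0r addr0; apply: eq_bigr => k _; rewrite /bump add1n.
by rewrite addrCA mulrA.
Qed.

Let BD N y g1 g2 : B N y (fun k => g1 k + g2 k) = B N y g1 + B N y g2.
Proof. by rewrite /B -big_split/=; apply: eq_bigr => k _; rewrite mulrDr. Qed.

Let BZ N y c g : B N y (fun k => c * g k) = c * B N y g.
Proof. by rewrite /B mulr_sumr; apply: eq_bigr => k _; rewrite mulrCA. Qed.

Let B1 N y : B N y (fun=> 1) = 1.
Proof.
elim: N => [|N IH]; last by rewrite BS !IH; ring.
by rewrite /B big_ord1 /bernstein !expr0 !mulr1.
Qed.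

Let Bk N y : B N y (fun k => k%:R) = N%:R * y.
Proof.
elim: N => [|N IH]; first by rewrite /B big_ord1 mulr0 mul0r.
rewrite BS (_ : (fun k => _) = fun k => k%:R + 1); last by apply/funext => k; rewrite natr1.
by rewrite BD B1 IH -natr1; ring.
Qed.

Let Bk2 N y : B N y (fun k => k%:R ^+ 2) = N%:R * y * (1 - y) + (N%:R * y) ^+ 2.
Proof.
elim: N => [|N IH]; first by rewrite /B big_ord1 expr0n mulr0 !mul0r expr0n addr0.
rewrite BS (_ : (fun k => _) = fun k => k%:R ^+ 2 + (2 * k%:R + 1)); last first.
  by apply/funext => k; rewrite -natr1; ring.
by rewrite BD BD BZ B1 Bk IH -natr1; ring.
Qed.

Lemma bernstein_sum N y : \sum_(k < N.+1) bernstein N k y = 1.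
Proof. by rewrite -[RHS](B1 N y); apply: eq_bigr => k _; rewrite mulr1. Qed.

Lemma bernstein_variance N y :
  \sum_(k < N.+2) bernstein N.+1 k y * (y - k%:R / N.+1%:R) ^+ 2 = y * (1 - y) / N.+1%:R.
Proof.
have N0 : N.+1%:R != 0 :> R by rewrite pnatr_eq0.
rewrite -[LHS]/(B N.+1 y (fun k => (y - k%:R / N.+1%:R) ^+ 2)).
rewrite (_ : (fun k => _) = fun k => N.+1%:R ^- 2 * k%:R ^+ 2 + (y ^+ 2 * 1 + (- 2 * y / N.+1%:R) * k%:R)).
  by rewrite !(BD, BZ) B1 Bk Bk2; field.
by apply/funext => k; field.
Qed.

End Bernstein.

Section Weierstrass.
Variables (R : realType) (m : nat).
Local Notation E := (R * 'rV[R]_m)%type.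
Implicit Types (F G f : E -> R) (z w v : E) (r e : R).

Lemma nbhs_coord z (A : set E) : nbhs z A ->
  exists2 e, 0 < e & forall w, (forall i, `|coord i w - coord i z| < e) -> A w.
Proof.
move=> /nbhs_ballP[e /= e0 eA]; exists e => // w we; apply: eA; split => /=.
  by rewrite /ball/= distrC; exact: (we None).
split=> // i j; rewrite /ball/= distrC ord1; exact: (we (Some j)).
Qed.

Lemma coord_nbhs z e : 0 < e -> nbhs z [set w | forall i, `|coord i w - coord i z| < e].
Proof.
move=> e0; apply: (@filter_forall E _ (fun i w => `|coord i w - coord i z| < e) (nbhs z) _) => i.
have /cvgr_distC_lt ci : coord i w @[w --> z] --> coord i z by exact: continuous_coord.
exact: ci.
Qed.

(* With a modulus of this form the error of Bernstein's operator is bounded by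
   the variance of the binomial law. *)
Lemma quadratic_modulus r z0 f e : 0 < e -> {within cube r z0, continuous f} ->
  exists2 C, 0 <= C & forall z w, cube r z0 z -> cube r z0 w ->
    `|f z - f w| <= e + C * sqdist z w.
Proof.
move=> e0 cf.
have [[z1 z1r]|] := pselect (exists z, cube r z0 z); last first.
  by move=> nz; exists 0 => // z w zr; exfalso; apply: nz; exists z.
have [c _ fM] : exists2 c, c \in cube r z0 & forall t, t \in cube r z0 -> `|f t| <= `|f c|.
  apply: (@compact_EVT_max E R (fun z => `|f z|)); [by exists z1|exact: compact_cube|].
  by move=> x; apply: cvg_norm; exact: cf.
pose M := `|f c|.
have /pinfty_ex_gt0[C C0 HC] : \forall C \near +oo, cube r z0 `<=` (fun z => forall w, cube r z0 w ->
    `|f z - f w| <= e + C * sqdist z w).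
  have /compact_near_coveringP/near_covering_withinP := @compact_cube R m r z0.
  apply => x xr.
  have : f w @[w --> within (cube r z0) (nbhs x)] --> f x.
    by move/subspace_continuousP : cf => /(_ x xr).
  move=> /cvgr_distC_lt /(_ (e / 2)); rewrite divr_gt0// => /(_ isT) /nbhs_coord[d d0 fx].
  (* If [w] is at least [d] away from [x] in some coordinate, then [sqdist z w >= d ^+ 2 / 4], and
     this threshold makes [C * sqdist z w] exceed [2 * M], the largest possible oscillation.
     Compactness of the cube makes [C] uniform in [x]. *)
  exists ([set z | forall i, `|coord i z - coord i x| < d / 2], [set C : R | 8 * M / d ^+ 2 <= C]).
    by split => /=; [apply: coord_nbhs; rewrite divr_gt0|apply: nbhs_pinfty_ge; exact: num_real].
  move=> [z C]/= [zx CM] zr w wr.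
  have dd : 0 < d ^+ 2 by rewrite exprn_gt0.
  have C0 : 0 <= C by apply: le_trans CM; rewrite divr_ge0 ?(ltW dd)// mulr_ge0// normr_ge0.
  have [wx|] := pselect (forall i, `|coord i w - coord i x| < d).
    have h1 : `|f z - f x| < e / 2.
      by apply: fx => // i; apply: lt_trans (zx i) _; lra.
    have h2 : `|f w - f x| < e / 2 by exact: fx.
    have h3 := mulr_ge0 C0 (sqdist_ge0 z w).
    have h4 := ler_distD (f x) (f z) (f w); move: h4; rewrite (distrC (f x) (f w)).
    lra.
  move=> /existsNP[i /negP]; rewrite -leNgt => wx.
  have zw : d / 2 <= `|coord i z - coord i w|.
    have := ler_distD (coord i z) (coord i w) (coord i x).
    by rewrite (distrC (coord i w) (coord i z)); have := zx i; lra.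
  have : d ^+ 2 / 4 <= sqdist z w.
    rewrite /sqdist (bigD1 i)//= -[leLHS]addr0 lerD ?sumr_ge0// => [|? _]; last exact: sqr_ge0.
    have : (d / 2) ^+ 2 <= `|coord i z - coord i w| ^+ 2.
      by rewrite ler_pXn2r// nnegrE ?normr_ge0// divr_ge0// ltW.
    by rewrite -normrX ger0_norm ?sqr_ge0//; apply: le_trans; rewrite le_eqVlt; apply/orP; left; apply/eqP; field.
  move=> h; have h1 : 2 * M <= C * (d ^+ 2 / 4).
    by move: CM; rewrite ler_pdivrMr//; lra.
  have h2 := ler_wpM2l C0 h.
  have h3 := ler_normB (f z) (f w).
  have := fM z (mem_set zr); have := fM w (mem_set wr); rewrite -/M; lra.
exists C; first exact: ltW.
by move=> z w zr wr; exact: HC.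
Qed.

(** The Bernstein operator in all coordinates at once averages [f] over a grid with product binomial
    weights [W]. By [quadratic_modulus] the error is at most [e / 2] plus [C] times the mean square
    distance to the grid point. *)
Lemma weierstrass r z0 f e : 0 < r -> 0 < e -> {within cube r z0, continuous f} ->
  exists2 F, ispol F & forall z, cube r z0 z -> `|f z - F z| <= e.
Proof.
move=> r0 e0 cf; have [|C C0 fC] := quadratic_modulus _ cf (e := e / 2).
  by rewrite divr_gt0.
(* Each of the [m + 1] coordinates is rescaled by [2 * r] and contributes a variance of at most
   [1 / N.+1], so the averaged error term is at most [D / N.+1]. *)
pose D := C * (4 * r ^+ 2 * m.+1%:R).
have D0 : 0 <= D by apply: mulr_ge0 => //; rewrite mulr_ge0// mulr_ge0// exprn_ge0// ltW.
have [N ND] : exists N, D / N.+1%:R <= e / 2.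
  exists (Num.truncn (D / (e / 2))).
  have e2 : 0 < e / 2 by rewrite divr_gt0.
  rewrite ler_pdivrMr ?ltr0n// -ler_pdivrMl// mulrC ltW//.
  exact: truncnS_gt.
pose K := {ffun option 'I_m -> 'I_N.+2}.
pose y z i := (coord i z - coord i z0 + r) / (2 * r).
pose node (k : K) : E := of_coord (fun i => coord i z0 - r + 2 * r * ((k i)%:R / N.+1%:R)).
pose W (k : K) z := \prod_i bernstein N.+1 (k i) (y z i).
have r20 : 2 * r != 0 by rewrite mulf_neq0// gt_eqF.
have y01 z i : cube r z0 z -> 0 <= y z i <= 1.
  move=> /(_ i); rewrite ler_norml => /andP[h1 h2].
  apply/andP; split; first by rewrite divr_ge0//; lra.
  by rewrite ler_pdivrMr; lra.
have nodeC k : cube r z0 (node k).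
  move=> i; rewrite of_coordE.
  have k1 : (k i)%:R / N.+1%:R <= 1 :> R by rewrite ler_pdivrMr ?ltr0n// mul1r ler_nat -ltnS.
  have k0 : 0 <= (k i)%:R / N.+1%:R :> R by rewrite divr_ge0.
  move: k0 k1; set t := _ / _ => k0 k1.
  have h1 := mulr_ge0 (ltW r0) k0; have h2 : r * t <= r * 1 by rewrite ler_wpM2l// ltW.
  by rewrite ler_norml; apply/andP; split; lra.
exists (fun z => \sum_k W k z * f (node k)).
  apply: ispol_sum => k; apply: ispol_mul; last exact: ispol_cst.
  apply: ispol_prod => i; under eq_fun do rewrite /bernstein -mulr_natr.
  have py : ispol (y^~ i).
    apply: ispol_mul; last exact: ispol_cst.
    apply: ispol_add; last exact: ispol_cst.
    exact: ispol_sub (ispol_coord _ _) (ispol_cst _ _).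
  apply: ispol_mul; last exact: ispol_cst.
  apply: ispol_mul; apply: ispol_exp => //.
  exact: ispol_sub (ispol_cst _ _) py.
move=> z zr.
have W0 k : 0 <= W k z by apply: prodr_ge0 => i _; apply: bernstein_ge0; exact: y01.
have W1 : \sum_k W k z = 1.
  rewrite /W -(bigA_distr_bigA (fun i (k : 'I_N.+2) => bernstein N.+1 k (y z i))).
  by rewrite big1// => i _; exact: bernstein_sum.
have W2 j : \sum_k W k z * (y z j - (k j)%:R / N.+1%:R) ^+ 2 <= N.+1%:R^-1.
  rewrite (eq_bigr (fun k : K => \prod_i (bernstein N.+1 (k i) (y z i) *
      (if i == j then (y z j - (k i)%:R / N.+1%:R) ^+ 2 else 1)))); last first.
    by move=> k _; rewrite big_split/= -big_mkcond big_pred1_eq.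
  rewrite -(bigA_distr_bigA (fun i (k : 'I_N.+2) => bernstein N.+1 k (y z i) *
      (if i == j then (y z j - k%:R / N.+1%:R) ^+ 2 else 1))).
  rewrite (bigD1 j)//= eqxx [X in _ * X]big1 ?mulr1 => [|i /negbTE ->]; last first.
    by under eq_bigr do rewrite mulr1; exact: bernstein_sum.
  rewrite bernstein_variance ler_piMl ?invr_ge0//.
  by have /andP[? ?] := y01 z j zr; nra.
rewrite -[f z]mul1r -W1 mulr_suml -sumrB.
under eq_bigr do rewrite -mulrBr.
apply: le_trans (ler_norm_sum _ _ _) _.
have le1 k : `|W k z * (f z - f (node k))| <= W k z * (e / 2) +
    C * (4 * r ^+ 2) * \sum_j W k z * (y z j - (k j)%:R / N.+1%:R) ^+ 2.
  rewrite normrM ger0_norm//.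
  rewrite (_ : _ + _ = W k z * (e / 2 + C * sqdist z (node k))).
    by rewrite ler_wpM2l// fC.
  rewrite mulrDr; congr (_ + _); rewrite /sqdist !mulr_sumr.
  apply: eq_bigr => j _; rewrite of_coordE /y.
  by field; rewrite nat1r pnatr_eq0/= gt_eqF.
apply: le_trans (ler_sum _ (fun k _ => le1 k)) _.
rewrite big_split/= -mulr_suml W1 mul1r -mulr_sumr exchange_big/=.
rewrite [leRHS](splitr e) lerD2l; apply: le_trans ND.
rewrite (_ : D / _ = C * (4 * r ^+ 2) * (m.+1%:R / N.+1%:R)); last by rewrite /D !mulrA.
apply: ler_wpM2l; first by rewrite !mulr_ge0// ltW.
apply: le_trans (ler_sum _ (fun j _ => W2 j)) _.
by rewrite sumr_const card_option card_ord mulr_natl.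
Qed.

End Weierstrass.

(** * Interior regularity for the Poisson equation *)

Section LocalApproximation.
Variables (R : realType) (m : nat).
Local Notation E := (R * 'rV[R]_m)%type.
Implicit Types (F G U H : E -> R) (z w v : E) (r e : R).

Definition touches_below (K O : set E) U H := forall P, ispol P -> forall z, O z ->
  (forall w, K w -> U z - P z <= U w - P w) -> laplacian P z <= H z.

Lemma laplacianN F : ispol F -> laplacian (fun z => - F z) = fun z => - laplacian F z.
Proof.
move=> pF; rewrite (_ : (fun z => - F z) = fun z => (-1) * F z).
  by rewrite laplacianZ//; apply/funext => z; rewrite mulN1r.
by apply/funext => z; rewrite mulN1r.
Qed.

Lemma touches_belowN (K O : set E) U H : touches_below K O U H ->
  touches_above K O (fun z => - U z) (fun z => - H z).
Proof.
move=> tU P pP z Oz zmax; rewrite lerNl.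
have := tU (fun z => - P z) (ispol_opp pP) z Oz.
rewrite laplacianN//; apply => w Kw; have := zmax w Kw; lra.
Qed.

(* [F] is the exact solution of [laplacian F = G] with boundary values [P], for
   polynomials [P] and [G] close to [U] and [H]. *)
Lemma local_poisson r z0 U H e : 0 < r -> 0 < e ->
  {within cube r z0, continuous U} -> {within cube r z0, continuous H} ->
  touches_above (disk r z0) (open_disk r z0) U H ->
  touches_below (disk r z0) (open_disk r z0) U H ->
  exists2 F, ispol F & (forall z, disk r z0 z -> `|U z - F z| <= e) /\
    (forall z, open_disk r z0 z -> `|H z - laplacian F z| <= e).
Proof.
move=> r0 e0 cU cH aU bU.
have r1 : 1 <= 1 + r ^+ 2 by rewrite lerDl sqr_ge0.
have r1' : 0 < 1 + r ^+ 2 by apply: lt_le_trans r1.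
(* Compensates the factor [1 + r ^+ 2] lost in [comparison]. *)
pose d := e / (1 + r ^+ 2).
have d0 : 0 < d by rewrite divr_gt0.
have de : d <= e by rewrite ler_pdivrMr// ler_peMr// ltW.
have dE : d * (1 + r ^+ 2) = e by rewrite mulfVK// gt_eqF.
have [P pP PU] := weierstrass r0 d0 cU.
have [G pG GH] := weierstrass r0 d0 cH.
have [n pn] := ispol_sub pG (ispol_laplacian pP).
have [q pq qE] := @pol_dirichlet R m r z0 n _ r0 pn.
have ps : ispol (sqdist^~ z0 : E -> R) by exists 3%N; exact: pol_sqdist.
have prq : ispol (fun w => (r ^+ 2 - sqdist w z0) * q w).
  by apply: ispol_mul => //; exact: ispol_sub (ispol_cst _ _) ps.
pose F w := P w + (r ^+ 2 - sqdist w z0) * q w.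
have pF : ispol F by exact: ispol_add.
have LF z : open_disk r z0 z -> laplacian F z = G z.
  by move=> Oz; rewrite laplacianD// qE// addrC subrK.
have kc := @disk_cube R m r z0 (ltW r0).
have ok : open_disk r z0 `<=` disk r z0 by move=> z; exact: ltW.
have bF z : sqdist z z0 = r ^+ 2 -> disk r z0 z /\ F z = P z.
  by move=> zr; rewrite /disk/= /F zr lexx subrr mul0r addr0.
have cK (f : E -> R) : {within cube r z0, continuous f} -> {within disk r z0, continuous f}.
  exact: continuous_subspaceW.
exists F => //; split=> z zr; last first.
  by rewrite LF//; apply: le_trans de; exact/GH/kc/ok.
rewrite -dE ler_distl; apply/andP; split; last first.
  apply: (@comparison R m r z0 d U H F) => //; first exact: cK.
    move=> w Ow; rewrite LF//; have := GH w (kc _ (ok _ Ow)); rewrite ler_norml => /andP[]; lra.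
  move=> w /bF[/kc wr ->]; have := PU w wr; rewrite ler_norml => /andP[]; lra.
suff : - U z <= - F z + d * (1 + r ^+ 2) by lra.
apply: (@comparison R m r z0 d (fun z => - U z) (fun z => - H z) (fun z => - F z)) => //.
- by move=> x; apply: cvgN; exact: cK cU x.
- exact: touches_belowN.
- exact: ispol_opp.
- move=> w Ow; rewrite laplacianN// LF//.
  have := GH w (kc _ (ok _ Ow)); rewrite ler_norml => /andP[]; lra.
- move=> w /bF[/kc wr ->]; have := PU w wr; rewrite ler_norml => /andP[]; lra.
Qed.

Lemma is_derive_quadratic (a b c t : R) :
  is_derive t (1 : R) (fun s => a + b * s + c * s ^+ 2) (b + 2 * c * t).
Proof.
have i1 := @is_derive_id R R t (1 : R).
have i2 := is_deriveX 2 i1.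
have := is_deriveD (is_deriveD (is_derive_cst a t (1 : R)) (is_deriveZ b i1)) (is_deriveZ c i2).
move=> /is_derive_eq; apply.
by rewrite add0r /GRing.scale/= expr1; ring.
Qed.

Lemma is_derive_pol F z v (t : R) : ispol F ->
  is_derive t (1 : R) (fun s => F (z + s *: v)) ('D_v F (z + t *: v)).
Proof. by move=> pF; apply: derive_line; exact: ispol_derivable. Qed.

Lemma is_derive_oppline (g : R -> R) (dg : R -> R) (t : R) :
  is_derive (- t) (1 : R) g (dg (- t)) -> is_derive t (1 : R) (fun s => g (- s)) (- dg (- t)).
Proof.
move=> h.
have i : is_derive t (1 : R) (fun s : R => - s) (- 1) by exact: is_deriveNid.
have := @is_derive1_comp R g (fun s => - s) t _ _ h i.
by rewrite mulrN1.
Qed.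

Lemma sqdist_line z w i (t : R) :
  sqdist (z + t *: ebase i) w = sqdist z w + 2 * (coord i z - coord i w) * t + 1 * t ^+ 2.
Proof.
rewrite /sqdist (bigD1 i)//= [in RHS](bigD1 i)//=.
rewrite [X in _ + X](eq_bigr (fun j => (coord j z - coord j w) ^+ 2)).
  by rewrite coordD coordZ coord_ebase eqxx mulr1n; ring.
by move=> j /negbTE ji; rewrite coordD coordZ coord_ebase ji mulr0 addr0.
Qed.

(* Doubling of variables: the maximum principle is applied, in [(z, t)], to
   [F (z + t e_i) - F (z - t e_i)] minus a quadratic barrier vanishing at
   [z = z0, t = 0]; the second [t]-derivative plays the role of the [i]-th one. *)
Lemma symmetric_difference_le F z0 (d M N : R) i (t : R) : ispol F -> 0 < d -> 0 < N -> 0 <= M ->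
  (forall z, cube (2 * d) z0 z -> `|F z| <= M) ->
  (forall z, cube (2 * d) z0 z -> `|laplacian F z| <= N) -> 0 <= t <= d ->
  F (z0 + t *: ebase i) - F (z0 - t *: ebase i) <= t * (2 * m.+1%:R * M / d + 2 * N * d).
Proof.
move=> pF d0 N0 M0 FM LN t0d.
pose k := 2 * M / d ^+ 2.
have d20 : 0 < d ^+ 2 by rewrite exprn_gt0.
have k0 : 0 <= k by rewrite divr_ge0 ?mulr_ge0// ltW.
have kd : k * d ^+ 2 = 2 * M by rewrite mulfVK// gt_eqF.
pose Phi z s := F (z + s *: ebase i) - F (z - s *: ebase i).
(* Since [k * d ^+ 2 = 2 * M] bounds [Phi], the barrier dominates [Phi] on the lateral faces and at
   [s = d], while at [s = 0] one has [Phi = 0 <= psi]; a positive maximum of [Phi - psi] is thus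
   interior. The term [- m * s ^+ 2] cancels the second derivatives [2 * k] of the other [m]
   directions, and the last term adds [- 4 * N]. *)
pose psi z s := k * (sqdist z z0 + s * (m.+1%:R * d - m%:R * s)) + 2 * N * s * (d - s).
suff : Phi z0 t - psi z0 t <= 0.
  rewrite subr_le0 => /le_trans; apply; rewrite /psi sqdistxx add0r.
  have -> : 2 * m.+1%:R * M / d = k * m.+1%:R * d by rewrite /k; field; rewrite gt_eqF.
  have h1 : 0 <= k * (m%:R * t ^+ 2) by rewrite mulr_ge0// mulr_ge0// sqr_ge0.
  have h2 : 0 <= N * t ^+ 2 by rewrite mulr_ge0 ?sqr_ge0// ltW.
  nra.
have z0r : cube d z0 z0 by move=> j; rewrite subrr normr0 ltW.
have [|||[z s]] := @compact_EVT_max (E * R)%type R (fun p => Phi p.1 p.2 - psi p.1 p.2) (cube d z0 `*` `[0, d]%classic).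
- by exists (z0, 0); split => //=; rewrite in_itv/= lexx ltW.
- by apply: compact_setX; [exact: compact_cube|exact: segment_compact].
- apply: continuous_subspaceT => p.
  have c1 : p.1 @[p --> p] --> p.1 by exact: cvg_fst.
  have c2 : p.2 @[p --> p] --> p.2 by exact: cvg_snd.
  have cF : continuous F by exact: ispol_continuous.
  have cs : continuous (sqdist^~ z0 : E -> R) by exact: sqdist_continuous.
  have cc (G : E -> R) (g : E * R -> E) : continuous G ->
      g q @[q --> p] --> g p -> G (g q) @[q --> p] --> G (g p).
    by move=> cG cg; apply: (cvg_comp _ _ cg); exact: cG.
  apply: cvgB.
    apply: cvgB; apply: cc => //.
      by apply: cvgD => //; exact: cvgZl.
    by apply: cvgB => //; exact: cvgZl.
  have cst (c : R) : c @[_ --> p] --> c by exact: cvg_cst.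
  apply: cvgD.
    apply: cvgM; first exact: cst.
    apply: cvgD; first exact: (cc (sqdist^~ z0) fst).
    apply: cvgM => //; apply: cvgB; first exact: cst.
    by apply: cvgM => //; exact: cst.
  apply: cvgM; first by apply: cvgM => //; exact: cst.
  by apply: cvgB => //; exact: cst.
rewrite inE => -[/= zr]; rewrite in_itv/= => /andP[s0 sd] zmax.
have {}zmax w u : cube d z0 w -> 0 <= u <= d -> Phi w u - psi w u <= Phi z s - psi z s.
  by move=> wr ur; apply: (zmax (w, u)); rewrite inE; split => //=; rewrite in_itv.
apply: le_trans (zmax z0 t z0r t0d) _; rewrite leNgt; apply/negP => pos.
have in2 w u : cube d z0 w -> `|u| <= d -> cube (2 * d) z0 (w + u *: ebase i).
  move=> wr ud j; rewrite coordD coordZ coord_ebase.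
  have := wr j; rewrite !ler_norml => /andP[? ?]; move: ud; rewrite ler_norml => /andP[? ?].
  by case: (j == i); rewrite ?mulr1n ?mulr1 ?mulr0n ?mulr0; apply/andP; split; lra.
have PhiM w u : cube d z0 w -> `|u| <= d -> Phi w u <= 2 * M.
  move=> wr ud; have := FM _ (in2 _ _ wr ud).
  have := FM _ (in2 w (- u) wr _); rewrite normrN scaleNr /Phi => /(_ ud).
  by rewrite !ler_norml => /andP[? ?] /andP[? ?]; lra.
have sd' : `|s| <= d by rewrite ger0_norm.
have hs : 0 <= s * (m.+1%:R * d - m%:R * s).
  rewrite mulr_ge0// -natr1; have : 0 <= m%:R * (d - s) by rewrite mulr_ge0// subr_ge0.
  nra.
have hN : 0 <= 2 * N * s * (d - s) by rewrite !mulr_ge0// ?subr_ge0// ltW.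
have s_gt0 : 0 < s.
  rewrite lt_neqAle s0 andbT; apply/negP => /eqP s00; move: pos.
  rewrite -s00 /Phi /psi !scale0r subr0 addr0 subrr !(mul0r, mulr0) !addr0 sub0r.
  by rewrite oppr_gt0 ltNge mulr_ge0 ?sqdist_ge0.
have s_ltd : s < d.
  rewrite lt_neqAle sd andbT; apply/negP => /eqP sde; move: pos.
  have := PhiM z s zr sd'; rewrite /psi sde.
  have : 0 <= k * sqdist z z0 by rewrite mulr_ge0 ?sqdist_ge0.
  rewrite -natr1; move: kd; nra.
have zint j : `|coord j z - coord j z0| < d.
  rewrite lt_neqAle zr andbT; apply/negP => /eqP zd; move: pos.
  have := PhiM z s zr sd'; rewrite /psi.
  have : d ^+ 2 <= sqdist z z0.
    rewrite /sqdist (bigD1 j)//= -[leLHS]addr0 lerD ?sumr_ge0// => [|? _]; last exact: sqr_ge0.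
    by rewrite -zd -normrX ger0_norm ?sqr_ge0.
  move=> /(ler_wpM2l k0); rewrite kd; move: (mulr_ge0 k0 hs) hN; rewrite mulrDr; lra.
pose DD j F := 'D_(ebase j) ('D_(ebase j) F) : E -> R.
have pD j : ispol ('D_(ebase j) F) by exact: ispol_derive.
have testj j : j != i -> DD j F (z + s *: ebase i) - DD j F (z - s *: ebase i) <= 2 * k.
  move=> ji.
  pose e := d - `|coord j z - coord j z0|.
  have e0 : 0 < e by rewrite subr_gt0.
  have psiE u : psi (z + u *: ebase j) s = psi z s + (k * (2 * (coord j z - coord j z0))) * u + k * u ^+ 2.
    by rewrite /psi sqdist_line; ring.
  pose g u := F ((z + s *: ebase i) + u *: ebase j) - F ((z - s *: ebase i) + u *: ebase j) -
     (psi z s + (k * (2 * (coord j z - coord j z0))) * u + k * u ^+ 2).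
  pose dg u := 'D_(ebase j) F ((z + s *: ebase i) + u *: ebase j) -
    'D_(ebase j) F ((z - s *: ebase i) + u *: ebase j) -
    (k * (2 * (coord j z - coord j z0)) + 2 * k * u).
  have [|u ue||] := @second_derivative_test R g dg e (DD j F (z + s *: ebase i + (0 : R) *: ebase j) -
    DD j F (z - s *: ebase i + (0 : R) *: ebase j) - (2 * k + 2 * 0 * 0)) e0.
  - move=> u _; apply: is_deriveB; last exact: is_derive_quadratic.
    by apply: is_deriveB; exact: is_derive_pol.
  - have gE x : g x = Phi (z + x *: ebase j) s - psi (z + x *: ebase j) s.
      by rewrite /g psiE /Phi; congr (F _ - F _ - _); rewrite addrAC.
    rewrite gE [g 0]gE scale0r addr0; apply: zmax; last by rewrite s0.
    move=> l; rewrite coordD coordZ coord_ebase.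
    have [->|lj] := eqVneq l j; last by rewrite mulr0n mulr0 addr0.
    rewrite mulr1n mulr1 addrAC; apply: le_trans (ler_normD _ _) _.
    by move: ue; rewrite /e; lra.
  - apply: is_deriveB; first by apply: is_deriveB; exact: is_derive_pol.
    rewrite (_ : (fun u => _) = fun u => k * (2 * (coord j z - coord j z0)) + (2 * k) * u + 0 * u ^+ 2).
      exact: is_derive_quadratic.
    by apply/funext => u; rewrite mul0r addr0.
  by move=> _; rewrite !scale0r !addr0 !mulr0 addr0 subr_le0.
have testi : DD i F (z + s *: ebase i) - DD i F (z - s *: ebase i) <= - (2 * m%:R * k) - 4 * N.
  pose e := Order.min s (d - s).
  have e0 : 0 < e by rewrite lt_min s_gt0 subr_gt0.
  pose b := k * (m.+1%:R * d - 2 * m%:R * s) + 2 * N * (d - 2 * s).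
  pose c := - (k * m%:R) - 2 * N.
  have psiE u : psi z (s + u) = psi z s + b * u + c * u ^+ 2.
    by rewrite /psi /b /c; ring.
  pose g u := F ((z + s *: ebase i) + u *: ebase i) - F ((z - s *: ebase i) + (- u) *: ebase i) -
     (psi z s + b * u + c * u ^+ 2).
  pose dg u := 'D_(ebase i) F ((z + s *: ebase i) + u *: ebase i) -
    - 'D_(ebase i) F ((z - s *: ebase i) + (- u) *: ebase i) - (b + 2 * c * u).
  have [|u ue||] := @second_derivative_test R g dg e (DD i F (z + s *: ebase i + (0 : R) *: ebase i) -
    - - DD i F (z - s *: ebase i + (- 0 : R) *: ebase i) - (2 * c + 2 * 0 * 0)) e0.
  - move=> u _; apply: is_deriveB; last exact: is_derive_quadratic.
    apply: is_deriveB; first exact: is_derive_pol.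
    apply: (@is_derive_oppline (fun u => F ((z - s *: ebase i) + u *: ebase i))
      (fun u => 'D_(ebase i) F ((z - s *: ebase i) + u *: ebase i))).
    exact: is_derive_pol.
  - have gE x : g x = Phi z (s + x) - psi z (s + x).
      by rewrite /g psiE /Phi; congr (F _ - F _ - _); rewrite ?scaleNr scalerDl ?opprD addrA.
    move: ue; rewrite lt_min !ltr_norml => /andP[/andP[? ?] /andP[? ?]].
    by rewrite !gE addr0; apply: zmax => //; apply/andP; split; lra.
  - apply: is_deriveB.
      apply: is_deriveB; first exact: is_derive_pol.
      apply: is_deriveN.
      apply: (@is_derive_oppline (fun u => 'D_(ebase i) F ((z - s *: ebase i) + u *: ebase i))
        (fun u => DD i F ((z - s *: ebase i) + u *: ebase i))).
      exact: is_derive_pol.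
    rewrite (_ : (fun u => _) = fun u => b + (2 * c) * u + 0 * u ^+ 2).
      exact: is_derive_quadratic.
    by apply/funext => u; rewrite mul0r addr0.
  move=> _; rewrite oppr0 !scale0r !addr0 !mulr0 addr0 subr_le0 opprK => /le_trans; apply.
  by rewrite le_eqVlt; apply/orP; left; apply/eqP; rewrite /c; ring.
have sdN : `|- s| <= d by rewrite normrN.
have := LN _ (in2 z s zr sd'); rewrite ler_norml => /andP[h1 _].
have := LN _ (in2 z (- s) zr sdN); rewrite ler_norml scaleNr => /andP[_ h2].
(* Sum of the tests in the [m + 1] directions: [m * (2 * k) - 2 * m * k - 4 * N]. The bound on
   [laplacian F] gives at least [- 2 * N], a contradiction because [N > 0]. *)
have : laplacian F (z + s *: ebase i) - laplacian F (z - s *: ebase i) <= - 4 * N.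
  rewrite /laplacian -sumrB (bigD1 i)//=.
  have : \sum_(j | j != i) (DD j F (z + s *: ebase i) - DD j F (z - s *: ebase i)) <= \sum_(j | j != i) (2 * k).
    by apply: ler_sum => j; exact: testj.
  have -> : \sum_(j | j != i) (2 * k) = 2 * m%:R * k.
    rewrite sumr_const (_ : #|_| = m) ?mulr_natr; first by rewrite -mulr_natr; ring.
    transitivity #|predC1 i|; first by apply: eq_card => j; rewrite !inE.
    by rewrite cardC1 card_option card_ord.
  move=> /(lerD testi) /le_trans; apply.
  by rewrite le_eqVlt; apply/orP; left; apply/eqP; ring.
suff h3 : - (2 * N) <= laplacian F (z + s *: ebase i) - laplacian F (z - s *: ebase i).
  by move=> /(le_trans h3); clear -N0; lra.
by rewrite mulr_natl mulr2n opprD; exact: lerB.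
Qed.

End LocalApproximation.

(** * Derivatives obtained from approximants *)

Section DirectionalLipschitz.
Variables (R : realType) (V : normedModType R).
Implicit Types (f p : V -> R) (x v : V).

(** No value of the derivative is known in advance. The difference quotients of [f] stay within
    [e / 2] of the convergent quotients of some [p], for every [e], so they are Cauchy and
    completeness supplies the limit. *)
Lemma derivable_approx f x v :
  (forall e, 0 < e -> exists2 p, derivable p x v &
     \forall h \near (0 : R), `|(f (x + h *: v) - p (x + h *: v)) - (f x - p x)| <= e * `|h|) ->
  derivable f x v.
Proof.
move=> fE; apply: cauchy_cvg; apply: cauchy_exP => e e0.
have e2 : 0 < e / 2 by rewrite divr_gt0.
have [p dp fp] := fE _ e2.
exists ('D_v p x).
have pl : h^-1 *: ((p \o shift x) (h *: v) - p x) @[h --> 0^'] --> 'D_v p x by exact: dp.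
have {}pl : \forall h \near (0 : R)^', `|'D_v p x - h^-1 *: ((p \o shift x) (h *: v) - p x)| < e / 2.
  by move/cvgr_dist_lt : pl => /(_ _ e2).
have fp' : \forall h \near (0 : R)^', `|(f (x + h *: v) - p (x + h *: v)) - (f x - p x)| <= e / 2 * `|h|.
  by apply: filterS fp => h hh _.
change (\forall h \near (0 : R)^', ball ('D_v p x) e (h^-1 *: ((f \o shift x) (h *: v) - f x))).
near=> h; rewrite /ball/=.
have h0 : h != 0 by near: h; exact: nbhs_dnbhs_neq.
have H1 : `|'D_v p x - h^-1 *: ((p \o shift x) (h *: v) - p x)| < e / 2 by near: h.
have H2 : `|(f (x + h *: v) - p (x + h *: v)) - (f x - p x)| <= e / 2 * `|h| by near: h.
move: H1; rewrite /= ![h *: v + x]addrC /GRing.scale/= => H1.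
have {}H2 : `|h^-1 * ((f (x + h *: v) - p (x + h *: v)) - (f x - p x))| <= e / 2.
  by rewrite normrM normfV ler_pdivrMl ?normr_gt0// mulrC.
rewrite [X in `|X|](_ : _ = ('D_v p x - h^-1 * (p (x + h *: v) - p x)) -
   h^-1 * ((f (x + h *: v) - p (x + h *: v)) - (f x - p x))); last by ring.
by apply: le_lt_trans (ler_normB _ _) _; rewrite (splitr e) ltr_leD.
Unshelve. all: by end_near. Qed.

Lemma derive_lipschitz_le f x v e : derivable f x v ->
  (\forall h \near (0 : R), `|f (x + h *: v) - f x| <= e * `|h|) -> `|'D_v f x| <= e.
Proof.
move=> df fL.
have fl : `|h^-1 *: ((f \o shift x) (h *: v) - f x)| @[h --> 0^'] --> `|'D_v f x|.
  by apply: cvg_norm; exact: df.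
apply: (cvgr_to_le fl); rewrite near_withinE; near=> h => h0 /=.
rewrite [h *: v + x]addrC normrM normfV ler_pdivrMl ?normr_gt0// mulrC; near: h.
exact: fL.
Unshelve. all: by end_near. Qed.

End DirectionalLipschitz.

(** * C^1 regularity from polynomial approximation *)

Section FlatRegularity.
Variables (R : realType) (m : nat).
Local Notation E := (R * 'rV[R]_m)%type.
Implicit Types (F G U H : E -> R) (z w v : E) (r e : R).

Definition flat_viscosity (O : set E) U H := forall P, ispol P -> forall z, O z ->
  ((\forall w \near z, U w - P w <= U z - P z) -> H z <= laplacian P z) /\
  ((\forall w \near z, U z - P z <= U w - P w) -> laplacian P z <= H z).

(** Linearity of the Laplacian lets a polynomial be absorbed into the test polynomial; for two
    general viscosity solutions no such subtraction is available. *)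
Lemma flat_viscosity_sub O U H F : ispol F -> flat_viscosity O U H ->
  flat_viscosity O (fun z => U z - F z) (fun z => H z - laplacian F z).
Proof.
move=> pF vU P pP z Oz.
have [h1 h2] := vU (fun w => F w + P w) (ispol_add pF pP) z Oz.
rewrite laplacianD// in h1 h2; split=> zP.
  by rewrite lerBlDl; apply: h1; apply: filterS zP => w; rewrite !opprD !addrA.
by rewrite lerBrDl; apply: h2; apply: filterS zP => w; rewrite !opprD !addrA.
Qed.

(** The factor 7/2 is 3/2 + 2: centres of symmetric differences lie within 3/2 [d], and the estimate
    around each uses a cube of half-side [2 * d]. With [d = r / (4 (m + 1))] the squared
    half-diagonal is [49/4 (m + 1) d^2 < 16 (m + 1)^2 d^2 = r^2]. *)
Lemma small_cube_disk r z0 : 0 < r ->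
  cube (7 / 2 * (r / (4 * m.+1%:R))) z0 `<=` open_disk r z0.
Proof.
move=> r0 w; set d := r / _ => wd.
have m0 : 0 < m.+1%:R :> R by rewrite ltr0n.
have d0 : 0 < d by rewrite divr_gt0// mulr_gt0.
have dE : 4 * m.+1%:R * d = r by rewrite mulrC mulfVK// gt_eqF// mulr_gt0.
clearbody d.
have wz j : (coord j w - coord j z0) ^+ 2 <= (7 / 2 * d) ^+ 2.
  rewrite -[leLHS]real_normK ?num_real// ler_pXn2r// ?nnegrE ?normr_ge0//.
  by rewrite mulr_ge0 ?(ltW d0)// divr_ge0.
rewrite /open_disk/=; apply: (@le_lt_trans _ _ (m.+1%:R * (7 / 2 * d) ^+ 2)).
  apply: le_trans (ler_sum _ (fun j _ => wz j)) _.
  by rewrite sumr_const card_option card_ord [leRHS]mulr_natl.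
have m1 : 1 <= m.+1%:R :> R by rewrite ler1n.
have d2 : 0 < d ^+ 2 by rewrite exprn_gt0.
rewrite -dE.
have : m.+1%:R * d ^+ 2 <= m.+1%:R ^+ 2 * d ^+ 2.
  by rewrite ler_wpM2r ?(ltW d2)// expr2 ler_peMr// ltW.
have : 0 < m.+1%:R * d ^+ 2 by rewrite mulr_gt0.
set X := m.+1%:R * d ^+ 2; set Y := m.+1%:R ^+ 2 * d ^+ 2 => X0 XY.
rewrite [ltLHS](_ : _ = 49 / 4 * X); last by rewrite /X; field.
by rewrite [ltRHS](_ : _ = 16 * Y); [lra|rewrite /Y; ring].
Qed.

Lemma pol_increment r z0 F (M N : R) i : 0 < r -> ispol F -> 0 <= M -> 0 < N ->
  (forall z, open_disk r z0 z -> `|F z| <= M) ->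
  (forall z, open_disk r z0 z -> `|laplacian F z| <= N) ->
  let d := r / (4 * m.+1%:R) in
  forall z t, cube d z0 z -> `|t| <= d ->
  `|F (z + t *: ebase i) - F z| <= `|t| * (m.+1%:R * M / d + N * d).
Proof.
move=> r0 pF M0 N0 FM LN d z t zd td.
have m0 : 0 < m.+1%:R :> R by rewrite ltr0n.
have d0 : 0 < d by rewrite divr_gt0// mulr_gt0.
have dE : 4 * m.+1%:R * d = r by rewrite mulrC mulfVK// gt_eqF// mulr_gt0.
have sub w c : cube (3 / 2 * d) z0 c -> cube (2 * d) c w -> open_disk r z0 w.
  move=> cd wc; apply: small_cube_disk => // j.
  have := ler_distD (coord j c) (coord j w) (coord j z0).
  by have := cd j; have := wc j; rewrite -/d; lra.
have key (G : E -> R) (s : R) w : ispol G -> (forall z, open_disk r z0 z -> `|G z| <= M) ->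
    (forall z, open_disk r z0 z -> `|laplacian G z| <= N) -> cube (3 / 2 * d) z0 w -> 0 <= s <= d ->
    G (w + s *: ebase i) - G (w - s *: ebase i) <= s * (2 * m.+1%:R * M / d + 2 * N * d).
  by move=> pG GM GN wd sd; apply: symmetric_difference_le => // x xw; [apply: GM|apply: GN]; exact: sub xw.
have NM x : open_disk r z0 x -> `|- F x| <= M by move=> /FM; rewrite normrN.
have NN x : open_disk r z0 x -> `|laplacian (fun x => - F x) x| <= N.
  by move=> /LN; rewrite laplacianN// normrN.
(* The increment from [z] to [z + t e_i] is a symmetric difference about the midpoint with step
   [|t| / 2]; [F] and [- F] together give the absolute value. *)
pose s := `|t| / 2.
have s0 : 0 <= s <= d.
  by rewrite /s divr_ge0//=; have := normr_ge0 t; lra.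
pose c := z + (t / 2) *: ebase i.
have cd : cube (3 / 2 * d) z0 c.
  move=> j; rewrite coordD coordZ coord_ebase addrAC.
  apply: le_trans (ler_normD _ _) _; rewrite normrM.
  have := zd j; have : `|t / 2| * `|(j == i)%:R| <= d / 2.
    rewrite normrM [`|2^-1|]ger0_norm//; case: (j == i); last by rewrite normr0 mulr0 divr_ge0// ltW.
    by rewrite normr1 mulr1; lra.
  lra.
have {key} [k1 k2] := (key F s c pF FM LN cd s0, key _ s c (ispol_opp pF) NM NN cd s0).
have {}k1 : `|F (c + s *: ebase i) - F (c - s *: ebase i)| <= `|t| * (m.+1%:R * M / d + N * d).
  rewrite [leRHS](_ : _ = s * (2 * m.+1%:R * M / d + 2 * N * d)); last by rewrite /s; field; rewrite gt_eqF.
  by rewrite ler_norml k1 andbT lerNl opprB; move: k2; rewrite opprK addrC.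
have tc : c + (t / 2) *: ebase i = z + t *: ebase i.
  by rewrite /c -addrA -scalerDl -splitr.
have zc : c - (t / 2) *: ebase i = z by rewrite addrK.
have [t0|t0] := ler0P t; move: k1; rewrite /s.
  rewrite (ler0_norm t0) mulNr scaleNr opprK tc zc distrC//.
by rewrite (gtr0_norm t0) tc zc.
Qed.

Section FlatApproximation.
Variables (O : set E) (U H : E -> R).
Hypothesis cU : forall z, O z -> {for z, continuous U}.
Hypothesis cH : forall z, O z -> {for z, continuous H}.
Hypothesis vU : flat_viscosity O U H.

Lemma flat_approx r z0 e : 0 < r -> 0 < e -> cube r z0 `<=` O ->
  exists2 F, ispol F & (forall z, open_disk r z0 z -> `|U z - F z| <= e) /\
    (forall z, open_disk r z0 z -> `|H z - laplacian F z| <= e).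
Proof.
move=> r0 e0 rO.
have cw (f : E -> R) : (forall z, O z -> {for z, continuous f}) -> {within cube r z0, continuous f}.
  move=> cf; apply: continuous_in_subspaceT => z; rewrite inE => /rO; exact: cf.
have nearD z (Q : E -> Prop) : open_disk r z0 z -> (forall w, disk r z0 w -> Q w) -> \forall w \near z, Q w.
  move=> Oz Qd; have := open_nbhs_nbhs (conj (@open_open_disk R m r z0) Oz).
  by apply: filterS => w Ow; apply: Qd; exact: ltW.
have dO : open_disk r z0 `<=` O.
  by move=> z Oz; apply/rO/disk_cube; [exact: ltW|exact: ltW].
have [||F pF [F1 F2]] := @local_poisson R m r z0 U H e r0 e0 (cw _ cU) (cw _ cH).
- by move=> P pP z Oz zP; apply: (vU pP (dO _ Oz)).1; exact: nearD zP.
- by move=> P pP z Oz zP; apply: (vU pP (dO _ Oz)).2; exact: nearD zP.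
by exists F => //; split => // z Oz; apply: F1; exact: ltW.
Qed.

Lemma flat_increment r z0 (M N : R) i : 0 < r -> cube r z0 `<=` O -> 0 <= M -> 0 <= N ->
  (forall z, open_disk r z0 z -> `|U z| <= M) ->
  (forall z, open_disk r z0 z -> `|H z| <= N) ->
  let d := r / (4 * m.+1%:R) in
  forall z t, cube d z0 z -> `|t| <= d ->
  `|U (z + t *: ebase i) - U z| <= `|t| * (m.+1%:R * M / d + N * d).
Proof.
move=> r0 rO M0 N0 UM HN d z t zd td.
have m0 : 0 < m.+1%:R :> R by rewrite ltr0n.
have d0 : 0 < d by rewrite divr_gt0// mulr_gt0.
(* Total weight of the approximation error: it enlarges [M] and [N] in the bound for [F], and enters
   twice more when [U] is replaced by [F] at the two endpoints. *)
pose K := `|t| * (m.+1%:R / d + d) + 2.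
have K0 : 0 < K by rewrite ltr_wpDl// mulr_ge0// addr_ge0 ?divr_ge0// ltW.
apply/ler_addgt0Pr => e e0.
have e1 : 0 < e / K by rewrite divr_gt0.
have [F pF [F1 F2]] := flat_approx r0 e1 rO.
have zr : open_disk r z0 z by apply: small_cube_disk => // j; have := zd j; rewrite -/d; lra.
have tr : open_disk r z0 (z + t *: ebase i).
  apply: small_cube_disk => // j; rewrite -/d coordD coordZ coord_ebase addrAC.
  apply: le_trans (ler_normD _ _) _; rewrite normrM.
  have := zd j; have : `|t| * `|(j == i)%:R| <= d.
    by case: (j == i); rewrite ?normr1 ?mulr1// normr0 mulr0 ltW.
  lra.
have Fi : `|F (z + t *: ebase i) - F z| <= `|t| * (m.+1%:R * (M + e / K) / d + (N + e / K) * d).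
  apply: (@pol_increment r z0) => //.
  - by rewrite addr_ge0// ltW.
  - by rewrite ltr_wpDl.
  - move=> w wr; have := UM w wr; have := F1 w wr; rewrite distrC.
    by have := ler_normD (F w - U w) (U w); rewrite subrK; lra.
  - move=> w wr; have := HN w wr; have := F2 w wr; rewrite distrC.
    by have := ler_normD (laplacian F w - H w) (H w); rewrite subrK; lra.
rewrite (_ : U _ - U z = (F (z + t *: ebase i) - F z) + (U (z + t *: ebase i) - F (z + t *: ebase i))
  - (U z - F z)); last by ring.
apply: le_trans (ler_normB _ _) _; apply: le_trans (lerD (ler_normD _ _) (lexx _)) _.
apply: le_trans (lerD (lerD Fi (F1 _ tr)) (F1 _ zr)) _.
rewrite le_eqVlt; apply/orP; left; apply/eqP.
rewrite -[e in RHS](@mulfVK _ K) ?gt_eqF//; set k := e / K; rewrite /K; field.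
by rewrite gt_eqF.
Qed.

End FlatApproximation.

Section FlatDifferentiability.
Variables (O : set E) (U H : E -> R).
Hypothesis openO : open O.
Hypothesis cU : forall z, O z -> {for z, continuous U}.
Hypothesis cH : forall z, O z -> {for z, continuous H}.
Hypothesis vU : flat_viscosity O U H.

(* [flat_increment] is applied to [U - F], a solution with source [H - laplacian F]. *)
Lemma flat_C1_approx r z0 e : 0 < r -> 0 < e -> cube r z0 `<=` O ->
  let d := r / (4 * m.+1%:R) in
  exists2 F, ispol F & forall z, cube d z0 z ->
    [/\ `|U z - F z| <= e, `|H z - laplacian F z| <= e &
     forall i t, `|t| <= d ->
     `|(U (z + t *: ebase i) - F (z + t *: ebase i)) - (U z - F z)| <= e * `|t| ].
Proof.
move=> r0 e0 rO d.
have m0 : 0 < m.+1%:R :> R by rewrite ltr0n.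
have d0 : 0 < d by rewrite divr_gt0// mulr_gt0.
(* An error [e / K] in [U] and in [H] makes the Lipschitz constant of [U - F] at most [e]; the
   summand 1 keeps [e / K <= e]. *)
pose K := 1 + (m.+1%:R / d + d).
have K1 : 1 <= K by rewrite lerDl addr_ge0 ?divr_ge0// ltW.
have K0 : 0 < K by apply: lt_le_trans K1.
have e1 : 0 < e / K by rewrite divr_gt0.
have e1e : e / K <= e by rewrite ler_pdivrMr// ler_peMr// ltW.
have [F pF [F1 F2]] := flat_approx cU cH vU r0 e1 rO.
exists F => // z zd.
have zr : open_disk r z0 z by apply: small_cube_disk => // j; have := zd j; rewrite -/d; lra.
split; [exact: le_trans (F1 _ zr) e1e|exact: le_trans (F2 _ zr) e1e|move=> i t td].
have := @flat_increment O (fun z => U z - F z) (fun z => H z - laplacian F z) _ _ (flat_viscosity_sub pF vU)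
  r z0 (e / K) (e / K) i r0 rO (ltW e1) (ltW e1) F1 F2 z t zd td.
have cF (f : E -> R) : ispol f -> forall w, {for w, continuous f} by move=> pf w; exact: ispol_continuous.
move=> /(_ _ _) h; apply: (le_trans (h _ _)).
- by move=> w Ow; apply: cvgB; [exact: cU|exact: cF].
- by move=> w Ow; apply: cvgB; [exact: cH|apply: cF; exact: ispol_laplacian].
rewrite mulrC ler_wpM2r//.
rewrite [X in X + _](_ : _ = e / K * (m.+1%:R / d)); last by ring.
rewrite -mulrDr -mulrA ler_piMr ?(ltW e0)// ler_pdivrMl// mulr1.
by rewrite /K lerDr.
Qed.

Let near_ball z0 : O z0 -> exists r, [/\ 0 < r, cube r z0 `<=` O &
  let d := r / (4 * m.+1%:R) in 0 < d].
Proof.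
move=> Oz; have /nbhs_coord[r r0 rO] : nbhs z0 O by exact: open_nbhs_nbhs.
exists (r / 2); split; first by rewrite divr_gt0.
  by move=> w wr; apply: rO => i; have := wr i; lra.
by rewrite /= !divr_gt0// mulr_gt0// ltr0n.
Qed.

Let near_small (d : R) : 0 < d -> \forall t \near (0 : R), `|t| <= d.
Proof.
move=> d0; near=> t; apply: ltW; near: t.
by have := @nbhs0_lt R R d d0.
Unshelve. all: by end_near. Qed.

Lemma flat_derivable z i : O z -> derivable U z (ebase i).
Proof.
move=> Oz; have [r [r0 rO d0]] := near_ball Oz.
apply: derivable_approx => e e0.
have [F pF /(_ z)[|_ _ FU]] := flat_C1_approx r0 e0 rO.
  by move=> j; rewrite subrr normr0 ltW.
exists F; first exact: ispol_derivable.
by have := near_small d0; apply: filterS => t td; exact: FU.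
Qed.

Lemma flat_derive_approx r z0 e : 0 < r -> 0 < e -> cube r z0 `<=` O ->
  let d := r / (4 * m.+1%:R) in
  exists2 F, ispol F & forall z, cube d z0 z ->
    [/\ `|U z - F z| <= e, `|H z - laplacian F z| <= e &
     forall i, `|'D_(ebase i) U z - 'D_(ebase i) F z| <= e ].
Proof.
move=> r0 e0 rO d; have [F pF FU] := flat_C1_approx r0 e0 rO.
have d0 : 0 < d by rewrite divr_gt0// mulr_gt0// ltr0n.
have dr : d <= r.
  rewrite ler_pdivrMr ?mulr_gt0 ?ltr0n// ler_peMr ?(ltW r0)//.
  have : 1 <= m.+1%:R :> R by rewrite ler1n.
  lra.
exists F => // z zd; have [h1 h2 h3] := FU z zd; split => // i.
have Oz : O z by apply: rO => j; apply: le_trans dr; exact: (zd j).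
have dU := @flat_derivable z i Oz; have dF : derivable F z (ebase i) by exact: ispol_derivable.
rewrite -deriveB//; apply: derive_lipschitz_le; first exact: derivableB.
by have := near_small d0; apply: filterS => t td; exact: h3.
Qed.

Lemma flat_derive_continuous z i : O z -> {for z, continuous ('D_(ebase i) U)}.
Proof.
move=> Oz; have [r [r0 rO d0]] := near_ball Oz.
apply/cvgrPdist_lt => e e0.
have e4 : 0 < e / 4 by rewrite divr_gt0.
have [F pF FU] := flat_derive_approx r0 e4 rO.
have cF : {for z, continuous ('D_(ebase i) F)} by apply: ispol_continuous; exact: ispol_derive.
have [_ _ /(_ i) hz] := FU z (fun j => ltac:(by rewrite subrr normr0 ltW)).
move/cvgr_dist_lt : cF => /(_ _ e4) cF.
have wd := coord_nbhs z d0.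
near=> w.
have /FU[_ _ /(_ i) hw] : cube (r / (4 * m.+1%:R)) z w.
  by move=> j; apply: ltW; move: j; near: w.
have : `|'D_(ebase i) F z - 'D_(ebase i) F w| < e / 4 by near: w.
move: hz hw; rewrite !ltr_norml !ler_norml => /andP[? ?] /andP[? ?] /andP[? ?].
by apply/andP; split; lra.
Unshelve. all: by end_near. Qed.

Lemma flat_derive_bound r z (M N : R) i : 0 < r -> cube r z `<=` O -> 0 <= M -> 0 <= N ->
  (forall w, open_disk r z w -> `|U w| <= M) ->
  (forall w, open_disk r z w -> `|H w| <= N) ->
  `|'D_(ebase i) U z| <= m.+1%:R * M / (r / (4 * m.+1%:R)) + N * (r / (4 * m.+1%:R)).
Proof.
move=> r0 rO M0 N0 UM HN; set d := r / _.
have d0 : 0 < d by rewrite divr_gt0// mulr_gt0// ltr0n.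
have zz : cube d z z by move=> j; rewrite subrr normr0 ltW.
apply: derive_lipschitz_le; first by apply: flat_derivable; apply: rO => j; rewrite subrr normr0 ltW.
have := near_small d0; apply: filterS => t td; rewrite mulrC.
apply: (@flat_increment O U H cU cH vU r z M N i r0 rO M0 N0 UM HN z t zz td).
Qed.

End FlatDifferentiability.

End FlatRegularity.

(** * Lebesgue measure *)

Section Measurability.
Variables (R : realType) (m : nat).
Local Notation E := (R * 'rV[R]_m)%type.
Implicit Types (z w v : E) (r e : R) (f g : E -> R).

Lemma measurable_fun_coord (i : option 'I_m) : measurable_fun [set: E] (coord i : E -> R).
Proof.
case: i => [k|] /=; last exact: measurable_fst.
exact: (measurableT_comp (measurable_coord k) measurable_snd).
Qed.

Definition open_cube r z0 : set E := [set z | forall i, `|coord i z - coord i z0| < r].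

Lemma measurable_open_cube r z0 : measurable (open_cube r z0).
Proof.
rewrite (_ : open_cube r z0 = \big[setI/setT]_(i : option 'I_m) (coord i @^-1` [set x | `|x - coord i z0| < r])).
  apply: bigsetI_measurable => i _.
  rewrite -[X in measurable X]setTI; apply: measurable_fun_coord => //.
  rewrite (_ : [set x | _] = `]coord i z0 - r, coord i z0 + r[%classic); first exact: measurable_itv.
  by apply/seteqP; split=> x /=; rewrite in_itv/= ltr_distl.
rewrite -bigcap_seq_cond; apply/seteqP; split=> z /= zr i; first by move=> _; exact: zr.
by apply: zr; rewrite /= mem_index_enum.
Qed.

(** The sigma-algebra is generated by the coordinates, so open sets must be reached by countable
    unions, here of the cubes contained in [A] with rational centre and half-side [1 / (k + 1)]. *)
Lemma measurable_open (A : set E) : open A -> measurable A.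
Proof.
move=> oA.
pose c (x : {ffun option 'I_m -> rat} * nat) : E := of_coord (fun i => ratr (x.1 i)).
pose F x := if `[< open_cube x.2.+1%:R^-1 (c x) `<=` A >] then open_cube x.2.+1%:R^-1 (c x) else set0.
rewrite (_ : A = \bigcup_x F x).
  apply: countable_bigcupT_measurable => [|x]; first exact: countableP.
  by rewrite /F; case: ifP => _; [exact: measurable_open_cube|exact: measurable0].
apply/seteqP; split=> z; last first.
  by case=> x _; rewrite /F; case: ifPn => // /asboolP; apply.
move=> Az; have /nbhs_coord[e e0 eA] : nbhs z A by exact: open_nbhs_nbhs.
have e2 : 0 < e / 2 by rewrite divr_gt0.
pose k := Num.truncn (e / 2)^-1.
have k0 : 0 < k.+1%:R^-1 :> R by rewrite invr_gt0 ltr0n.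
have ke : k.+1%:R^-1 < e / 2.
  by rewrite -[ltRHS]invrK ltf_pV2 ?posrE ?ltr0n ?invr_gt0// truncnS_gt.
have {}/choice[q qz] : forall i, exists q, `|coord i z - ratr q| < k.+1%:R^-1.
  move=> i.
  have [q] : exists q : rat, ratr q \in `](coord i z - k.+1%:R^-1), (coord i z + k.+1%:R^-1)[.
    by apply: rat_in_itvoo; rewrite ltrBlDr -addrA ltrDl addr_gt0.
  by rewrite in_itv/= => qi; exists q; rewrite distrC ltr_distl.
exists ([ffun i => q i], k) => //; rewrite /F ifT; last first.
  apply/asboolP => w wc; apply: eA => i; have := wc i.
  rewrite /c of_coordE ffunE /= => h; have := qz i; rewrite distrC.
  move=> h1; apply: le_lt_trans (ler_distD (ratr (q i)) _ _) _.
  by rewrite (splitr e); apply: lt_trans (ltrD h h1) _; exact: ltrD.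
by move=> i; rewrite /c of_coordE ffunE/=; exact: qz.
Qed.

Lemma measurable_compact (A : set E) : compact A -> measurable A.
Proof.
move=> cA; rewrite -[A]setCK; apply: measurableC; apply: measurable_open.
by rewrite openC; apply: compact_closed => //; exact: norm_hausdorff.
Qed.

Lemma measurable_fun_continuous (O : set E) f : open O ->
  (forall z, O z -> {for z, continuous f}) -> measurable_fun O f.
Proof.
move=> oO cf; apply: (measurability _ (RGenOpens.measurableE R)).
move=> _ [_ [a [b ->] <-]]; apply: measurable_open.
rewrite openE => z [Oz fz].
apply: filterI; first exact: open_nbhs_nbhs.
apply: (cf z Oz); apply: open_nbhs_nbhs; split => //.
Qed.

End Measurability.

(** * Measure of cubes and integrals of derivatives *)

Section LebesgueRow.
Variable R : realType.

(** The map whose image measure defines [lebesgue_rV] one dimension higher; the bodies coincide, so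
    the measures agree by conversion. *)
Definition cons_rV m (p : R * 'rV[R]_m) : 'rV[R]_m.+1 :=
  \row_i (if unlift ord0 i is Some j then p.2 ord0 j else p.1).

Lemma measurable_cons_rV m : measurable_fun [set: R * 'rV[R]_m] (@cons_rV m).
Proof.
apply: measurable_fun_rVP => i.
case: (unliftP ord0 i) => [j|] ->.
- under eq_fun do rewrite mxE liftK.
  exact: (measurableT_comp (measurable_coord j) measurable_snd).
- under eq_fun do rewrite mxE unlift_none.
  exact: measurable_fst.
Qed.

Lemma cons_rV_coord m (p : R * 'rV[R]_m) i : cons_rV p ord0 i = coord (unlift ord0 i) p.
Proof. by rewrite mxE; case: unlift. Qed.

Definition cube_rV m r (c : 'rV[R]_m) : set 'rV[R]_m := [set v | forall j, `|v ord0 j - c ord0 j| < r].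

Lemma open_cubeE m r (c : R * 'rV[R]_m) :
  open_cube r c = `](c.1 - r), (c.1 + r)[%classic `*` cube_rV r c.2.
Proof.
apply/seteqP; split => z /=.
  move=> zc; split => [|j]; last exact: (zc (Some j)).
  by rewrite /= in_itv/= -ltr_distl; exact: (zc None).
by rewrite in_itv/= => -[z1 z2] [j|] /=; [exact: z2|rewrite ltr_distl].
Qed.

Lemma measurable_cube_rV m r (c : 'rV[R]_m) : measurable (cube_rV r c).
Proof.
rewrite (_ : cube_rV r c = \big[setI/setT]_(i < m) ((fun v : 'rV[R]_m => v ord0 i) @^-1` [set x | `|x - c ord0 i| < r])).
  apply: bigsetI_measurable => i _.
  rewrite -[X in measurable X]setTI; apply: measurable_coord => //.
  rewrite (_ : [set x | _] = `]c ord0 i - r, c ord0 i + r[%classic); first exact: measurable_itv.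
  by apply/seteqP; split=> x /=; rewrite in_itv/= ltr_distl.
rewrite -bigcap_seq_cond; apply/seteqP; split=> z /= zr i; first by move=> _; exact: zr.
by apply: zr; rewrite /= mem_index_enum.
Qed.

Lemma product_cube m r (c : R * 'rV[R]_m) : 0 < r ->
  lebesgue_rV m (cube_rV r c.2) = ((2 * r) ^+ m)%:E ->
  (lebesgue_measure \x lebesgue_rV m)%E (open_cube r c) = ((2 * r) ^+ m.+1)%:E.
Proof.
move=> r0 mc; rewrite open_cubeE product_measure1E; last 2 first.
- exact: measurable_itv.
- exact: measurable_cube_rV.
have mi : lebesgue_measure (`](c.1 - r), (c.1 + r)[%classic : set R) = (2 * r)%:E.
  rewrite lebesgue_measure_itv/= lte_fin ltrD2l ifT; last by lra.
  by rewrite -EFinB; congr (_%:E); ring.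
by rewrite exprS EFinM mc; congr (_ * _)%E; exact: mi.
Qed.

Lemma lebesgue_rV_cube m r (c : 'rV[R]_m) : 0 < r ->
  lebesgue_rV m (cube_rV r c) = ((2 * r) ^+ m)%:E.
Proof.
move=> r0; elim: m c => [|m IH] c.
  rewrite (_ : cube_rV r c = setT) /= ?diracT//.
  by apply/seteqP; split => // v _ [].
pose c' : R * 'rV[R]_m := (c ord0 ord0, \row_j c ord0 (lift ord0 j)).
rewrite -(@product_cube m r c' r0 (IH _)).
change ((lebesgue_measure \x lebesgue_rV m)%E (@cons_rV m @^-1` cube_rV r c) =
    (lebesgue_measure \x lebesgue_rV m)%E (open_cube r c')).
congr (_ _); apply/seteqP; split => p /= pc.
  case=> [j|] /=.
    by have := pc (lift ord0 j); rewrite cons_rV_coord liftK mxE.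
  by have := pc ord0; rewrite cons_rV_coord unlift_none.
move=> i; rewrite cons_rV_coord; case: (unliftP ord0 i) => [j|] ->.
  by have := pc (Some j); rewrite /= mxE.
exact: (pc None).
Qed.

Lemma leb_cube m r (c : R * 'rV[R]_m) : 0 < r ->
  (lebesgue_measure \x lebesgue_rV m)%E (open_cube r c) = ((2 * r) ^+ m.+1)%:E.
Proof. by move=> r0; apply: product_cube => //; exact: lebesgue_rV_cube. Qed.

(** Regularity is asked only along lines in the direction [e]. With joint measurability, a bound and
    bounded support, this is what survives freezing the other coordinates in Fubini's theorem and
    suffices for the fundamental theorem of calculus. *)
Definition line_derivative (V : lmodType R) (e : V) (g dg : V -> R) :=
  (forall z, is_derive (0 : R) (1 : R) (fun t => g (z + t *: e)) (dg z)) /\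
  forall z, continuous (fun t : R => dg (z + t *: e)).

Definition line_C1c_prod m (i : option 'I_m) (g dg : R * 'rV[R]_m -> R) :=
  [/\ measurable_fun [set: R * 'rV[R]_m] dg,
      exists C, forall z, `|dg z| <= C,
      exists2 r, 0 < r & forall z, ~ open_cube r 0 z -> g z = 0 /\ dg z = 0 &
      line_derivative (ebase i) g dg].

Definition line_C1c_rV m (j : 'I_m) (g dg : 'rV[R]_m -> R) :=
  [/\ measurable_fun [set: 'rV[R]_m] dg,
      exists C, forall z, `|dg z| <= C,
      exists2 r, 0 < r & forall z, ~ cube_rV r 0 z -> g z = 0 /\ dg z = 0 &
      line_derivative (delta_mx ord0 j) g dg].

Lemma integrable_bounded d (T : measurableType d) (mu : {measure set T -> \bar R}) (A D : set T) (f : T -> R) C :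
  measurable D -> measurable A -> A `<=` D -> (mu A < +oo)%E -> measurable_fun D f ->
  (forall x, A x -> `|f x| <= C) -> (forall x, D x -> ~ A x -> f x = 0) ->
  mu.-integrable D (EFin \o f).
Proof.
move=> mD mA AD Aoo mf fC f0.
have iA : mu.-integrable A (EFin \o f).
  apply: measurable_bounded_integrable => //; first exact: measurable_funS mf.
  exists C; split; first exact: num_real.
  by move=> x Cx y Ay; exact: le_trans (fC _ Ay) (ltW Cx).
have /(integrable_restrict mu mA mD)fA : mu.-integrable (D `&` A) (EFin \o f) by rewrite setIidr.
apply: eq_integrable fA => // x; rewrite inE => Dx; rewrite patchE.
by case: ifPn => //; rewrite notin_setE => /(f0 x Dx) /= ->.
Qed.

Lemma line_C1c_prod_integrable m (i : option 'I_m) g dg : line_C1c_prod i g dg ->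
  (lebesgue_measure \x lebesgue_rV m)%E.-integrable setT (EFin \o dg).
Proof.
case=> mdg [C dgC] [r r0 gr] _.
apply: (@integrable_bounded _ (measurableTypeR R * 'rV[R]_m)%type
  (lebesgue_measure \x lebesgue_rV m)%E (open_cube r 0) setT dg C) => //.
- exact: measurable_open_cube.
- by rewrite [X in (X < _)%E]leb_cube// ltry.
- by move=> z _ /gr[].
Qed.

Lemma line_integral0 (g dg : R -> R) r : 0 < r ->
  (forall x, is_derive x (1 : R) g (dg x)) -> continuous dg ->
  (forall x, r <= `|x| -> g x = 0 /\ dg x = 0) ->
  (\int[lebesgue_measure]_x (dg x)%:E = 0)%E.
Proof.
move=> r0 gE cdg g0.
rewrite (_ : (fun x => (dg x)%:E) = (fun x => (dg x)%:E) \_ `[-r, r]); last first.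
  apply/funext => x; rewrite patchE; case: ifPn => //; rewrite notin_setE /= in_itv/=.
  move=> /negP; rewrite -ler_norml -ltNge => /ltW /g0[_ ->//].
rewrite -integral_mkcond (@continuous_FTC2 _ dg g).
- have rr : r <= `|r| by rewrite ger0_norm// ltW.
  have rNr : r <= `|- r| by rewrite normrN.
  by rewrite (g0 _ rr).1 (g0 _ rNr).1 subee.
- by lra.
- exact: continuous_subspaceT.
- have cg x : {for x, continuous g}.
    by apply: differentiable_continuous; apply/derivable1_diffP; have [] := gE x.
  split; first by move=> x _; have [] := gE x.
    by apply: cvg_at_right_filter; exact: cg.
  by apply: cvg_at_left_filter; exact: cg.
- by move=> x _; rewrite derive1E; have [_ ->] := gE x.
Qed.

Lemma line_derivative_at (V : lmodType R) (e : V) g dg : line_derivative e g dg ->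
  forall z t, is_derive (t : R) (1 : R) (fun s => g (z + s *: e)) (dg (z + t *: e)).
Proof.
move=> [gE _] z t; have := gE (z + t *: e) => h.
have sh : is_derive t (1 : R) (fun s : R => s - t) 1.
  have := is_deriveB (@is_derive_id R R t 1) (is_derive_cst t t (1 : R)).
  by rewrite subr0.
have h' : is_derive (t - t) (1 : R) (fun s => g (z + t *: e + s *: e)) (dg (z + t *: e)).
  by rewrite subrr.
have := @is_derive1_comp R (fun s => g (z + t *: e + s *: e)) (fun s => s - t) t _ _ h' sh.
rewrite mulr1 (_ : _ \o _ = fun s => g (z + s *: e))//.
by apply/funext => s /=; rewrite -addrA -scalerDl [t + _]addrC subrK.
Qed.

(* [lebesgue_rV] is defined by recursion on the dimension, so this goes by induction,
   through Fubini, down to the integral of a derivative on the line. *)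
Lemma integral_line_derivative0 m :
  (forall (i : option 'I_m) g dg, line_C1c_prod i g dg ->
    (\int[lebesgue_measure \x lebesgue_rV m]_z (dg z)%:E = 0)%E) /\
  (forall (j : 'I_m) g dg, line_C1c_rV j g dg -> (\int[lebesgue_rV m]_v (dg v)%:E = 0)%E).
Proof.
have prod_rV k : (forall (j : 'I_k) g dg, line_C1c_rV j g dg -> (\int[lebesgue_rV k]_v (dg v)%:E = 0)%E) ->
    forall (i : option 'I_k) g dg, line_C1c_prod i g dg ->
    (\int[lebesgue_measure \x lebesgue_rV k]_z (dg z)%:E = 0)%E.
  move=> IH [j|] g dg ndg; have idg := line_C1c_prod_integrable ndg;
    case: ndg => mdg [C dgC] [r r0 gr] ldg.
    have /= <- := integral12_prod_meas1 idg; rewrite integral0_eq// => x _.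
    apply: (IH j (fun v => g (x, v)) (fun v => dg (x, v))); split.
    - exact: (measurableT_comp mdg (measurable_fun_pair (measurable_cst x) (@measurable_id _ _ setT))).
    - by exists C.
    - by exists r => // v vr; apply: gr => /= h; apply: vr => l; have := h (Some l).
    - have E v (t : R) : (x, v) + t *: (ebase (Some j) : R * 'rV[R]_k) = (x, v + t *: delta_mx ord0 j).
        by rewrite /ebase; congr pair; rewrite /= scaler0 addr0.
      by case: ldg => l1 l2; split=> v; [have := l1 (x, v)|have := l2 (x, v)]; under eq_fun do rewrite E.
  (* Here the derivative is along the line factor, so that variable is integrated first; in the
     other case the inner integral was over the rows and vanished by the hypothesis on
     ['rV[R]_k]. *)
  have /= <- := integral21_prod_meas1 idg; rewrite integral0_eq// => v _.
  have E (t : R) : (0, v) + t *: (ebase None : R * 'rV[R]_k) = (t, v).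
    by rewrite /ebase; congr pair; rewrite /= ?scaler0 ?addr0// add0r [LHS]mulr1.
  apply: (@line_integral0 (fun x => g (x, v)) _ r r0).
  - by move=> x; have := line_derivative_at ldg (0, v) x; rewrite E; under eq_fun do rewrite E.
  - by move=> x; have := ldg.2 (0, v) x; under eq_fun do rewrite E.
  - move=> x xr; apply: gr => /(_ None) /=; rewrite subr0; apply/negP.
    by rewrite -leNgt.
suff Q : forall (j : 'I_m) g dg, line_C1c_rV j g dg -> (\int[lebesgue_rV m]_v (dg v)%:E = 0)%E.
  by split=> //; exact: prod_rV.
elim: m => [[]//|m IH] j g dg [mdg [C dgC] [r r0 gr] [l1 l2]].
pose i := unlift ord0 j.
have consE (p : R * 'rV[R]_m) (t : R) : cons_rV (p + t *: ebase i) = cons_rV p + t *: delta_mx ord0 j.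
  apply/rowP => k; rewrite !mxE eqxx/= /i.
  case: (unliftP ord0 k) => [k'|] ->; case: (unliftP ord0 j) => [j'|] ->.
  - by rewrite /= !mxE eqxx/= (inj_eq lift_inj).
  - by rewrite /= !mxE.
  - by rewrite /= /GRing.scale/= !mulr0.
  - by [].
have ndg : line_C1c_prod i (g \o @cons_rV m) (dg \o @cons_rV m).
  split.
  - exact: measurableT_comp mdg (@measurable_cons_rV m).
  - by exists C => z; exact: dgC.
  - exists r => // z zr; apply: gr => h; apply: zr => k; rewrite [coord k 0](_ : _ = 0); last first.
      by case: k => [k|]//=; rewrite mxE.
    case: k => [k|]; [have := h (lift ord0 k)|have := h ord0];
      by rewrite cons_rV_coord ?liftK ?unlift_none mxE.
  - have lineE (h : 'rV[R]_m.+1 -> R) z : (fun t : R => (h \o @cons_rV m) (z + t *: ebase i)) =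
        fun t => h (cons_rV z + t *: delta_mx ord0 j).
      by apply/funext => t; rewrite /= consE.
    by split=> z; rewrite lineE; [exact: l1|exact: l2].
rewrite -[RHS](prod_rV _ IH _ _ _ ndg).
have := @integral_pushforward _ _ (measurableTypeR R * 'rV[R]_m)%type 'rV[R]_m.+1 R (@cons_rV m)
  (@measurable_cons_rV m) (lebesgue_measure \x lebesgue_rV m)%E setT (EFin \o dg).
rewrite preimage_setT => <- //; last 2 first.
- exact/measurable_EFinP.
- exact: line_C1c_prod_integrable ndg.
Qed.

End LebesgueRow.

(** * Logarithmic coordinates *)

Section CkTheory.
Variables (R : realType) (V : normedModType R).
Implicit Types (U : set V) (f g : V -> R) (p v : V) (k : nat).

Lemma near_open U f g p : open U -> U p -> (forall q, U q -> f q = g q) ->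
  \forall q \near p, f q = g q.
Proof.
move=> oU Up fg; have : nbhs p U by exact: open_nbhs_nbhs.
exact: filterS.
Qed.

Lemma near_continuous f g p : (\forall q \near p, f q = g q) ->
  {for p, continuous f} -> {for p, continuous g}.
Proof.
move=> fg cf; rewrite /prop_for /continuous_at -(nbhs_singleton fg).
by apply: cvg_trans cf; apply: near_eq_cvg; apply: filterS fg => q ->.
Qed.

Lemma Ck_ext U f g k : open U -> (forall p, U p -> f p = g p) -> Ck k U f -> Ck k U g.
Proof.
move=> oU; elim: k f g => [|k IH] f g fg [cf df]; split => //.
- by move=> p Up; apply: near_continuous (cf p Up); exact: near_open fg.
- by move=> p Up; apply: near_continuous (cf p Up); exact: near_open fg.
move=> v; have [dfv Cf] := df v; split.
  by move=> p Up; apply: near_eq_derivable (dfv p Up); exact: near_open fg.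
apply: IH Cf => p Up; apply: near_eq_derive; exact: near_open fg.
Qed.

Lemma Ck_S U f k : Ck k.+1 U f -> Ck k U f.
Proof.
elim: k f => [|k IH] f [cf df]; split=> // v.
by have [d C] := df v; split => //; exact: IH.
Qed.

Lemma Ck_add U f g k : open U -> Ck k U f -> Ck k U g -> Ck k U (fun p => f p + g p).
Proof.
move=> oU; elim: k f g => [|k IH] f g [cf df] [cg dg]; split => //.
- by move=> p Up; apply: cvgD; [exact: cf|exact: cg].
- by move=> p Up; apply: cvgD; [exact: cf|exact: cg].
move=> v; have [dfv Cf] := df v; have [dgv Cg] := dg v; split.
  by move=> p Up; apply: derivableD; [exact: dfv|exact: dgv].
apply: Ck_ext oU _ (IH _ _ Cf Cg) => p Up.
by rewrite deriveD//; [exact: dfv|exact: dgv].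
Qed.

Lemma Ck_mul U f g k : open U -> Ck k U f -> Ck k U g -> Ck k U (fun p => f p * g p).
Proof.
move=> oU; elim: k f g => [|k IH] f g Cf Cg.
  by split=> // p Up; apply: cvgM; [exact: Cf.1|exact: Cg.1].
have Cf' := Ck_S Cf; have Cg' := Ck_S Cg.
case: Cf Cg => [cf df] [cg dg]; split.
  by move=> p Up; apply: cvgM; [exact: cf|exact: cg].
move=> v; have [dfv Cfv] := df v; have [dgv Cgv] := dg v; split.
  by move=> p Up; apply: derivableM; [exact: dfv|exact: dgv].
apply: Ck_ext oU _ (Ck_add oU (IH _ _ Cf' Cgv) (IH _ _ Cg' Cfv)) => p Up.
by rewrite deriveM//; [exact: dfv|exact: dgv].
Qed.

Lemma Ck_cst U (c : R) k : Ck k U (fun=> c).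
Proof.
elim: k c => [|k IH] c; split=> //.
- by move=> p _; exact: cvg_cst.
- by move=> p _; exact: cvg_cst.
move=> v; split=> [p _|]; first exact: derivable_cst.
have -> : (fun p => 'D_v (fun=> c) p) = fun=> 0; last exact: IH.
by apply/funext => p; rewrite derive_cst.
Qed.

Lemma Ck_linear U f k : continuous f -> (forall v p, is_derive p v f (f v)) -> Ck k U f.
Proof.
move=> cf fE; case: k => [|k]; split => //; try by move=> p _; exact: cf.
move=> v; split=> [p _|]; first by have [] := fE v p.
have -> : (fun p => 'D_v f p) = fun=> f v; last exact: Ck_cst.
by apply/funext => p; have [_ ->] := fE v p.
Qed.

Lemma Ck_inv U f k : open U -> (forall p, U p -> f p != 0) -> Ck k U f ->
  Ck k U (fun p => (f p)^-1).
Proof.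
move=> oU f0; elim: k => [|k IH] Cf.
  by split=> // p Up; apply: cvgV; [exact: f0|exact: Cf.1].
have IH' := IH (Ck_S Cf); case: Cf => [cf df]; split.
  by move=> p Up; apply: cvgV; [exact: f0|exact: cf].
move=> v; have [dfv Cfv] := df v; split.
  by move=> p Up; apply: derivableV; [exact: f0|exact: dfv].
apply: Ck_ext oU _ (Ck_mul oU (Ck_mul oU (Ck_cst U (-1) k) (Ck_mul oU IH' IH')) Cfv) => p Up.
rewrite deriveV; [|exact: f0|exact: dfv].
by rewrite /GRing.scale/= mulN1r -invfM -expr2.
Qed.

(** Bootstrap: the equation [D_v f = f * q v] makes the derivative as regular as [f], whose class
    climbs order by order to that of [q]. It serves [cone_pow], where [q] is a multiple of
    [1 / t]. *)
Lemma Ck_ode U f (q : V -> V -> R) k : open U -> (forall v, Ck k U (q v)) ->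
  (forall p, U p -> {for p, continuous f}) ->
  (forall v p, U p -> is_derive p v f (f p * q v p)) -> Ck k U f.
Proof.
move=> oU + cf fE; elim: k => [|k IH] Cq; split=> // v; split.
  by move=> p Up; have [] := fE v p Up.
apply: (@Ck_ext _ (fun p => f p * q v p)) => //.
  by move=> p Up; have [_ ->] := fE v p Up.
apply: Ck_mul => //; last exact/Ck_S/Cq.
by apply: IH => w; exact/Ck_S/Cq.
Qed.

End CkTheory.

Section Cone.
Variables (R : realType) (m : nat).
Local Notation E := (R * 'rV[R]_m)%type.
Implicit Types (F G U f : E -> R) (p q z w v : E) (i : option 'I_m).

Definition positive : set E := [set p | 0 < p.1].

Lemma open_positive : open positive.
Proof.
apply: (@open_comp E R fst [set x | 0 < x] _ (@open_gt R _)) => p _.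
exact: cvg_fst.
Qed.

Definition log_cone p : E := (ln p.1, p.2).

Definition exp_cone z : E := (expR z.1, z.2).

Lemma exp_coneK : cancel exp_cone log_cone.
Proof. by case=> s x; rewrite /log_cone /exp_cone/= expRK. Qed.

Lemma log_coneK p : 0 < p.1 -> exp_cone (log_cone p) = p.
Proof. by case: p => t x /= t0; rewrite /log_cone /exp_cone/= lnK. Qed.

Lemma continuous_log_cone p : 0 < p.1 -> {for p, continuous log_cone}.
Proof.
move=> p0.
have c1 : ln q.1 @[q --> p] --> ln p.1.
  apply: (@cvg_comp _ _ _ (fun q : E => q.1) (@ln R)); first exact: cvg_fst.
  exact: continuous_ln.
have c2 : q.2 @[q --> p] --> p.2 by exact: cvg_snd.
exact: cvg_pair c1 c2.
Qed.

Lemma continuous_exp_cone : continuous exp_cone.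
Proof.
move=> z.
have c1 : expR q.1 @[q --> z] --> expR z.1.
  apply: (@cvg_comp _ _ _ (fun q : E => q.1) (@expR R)); first exact: cvg_fst.
  exact: continuous_expR.
have c2 : q.2 @[q --> z] --> z.2 by exact: cvg_snd.
exact: cvg_pair c1 c2.
Qed.

Lemma is_derive_log p v : 0 < p.1 -> is_derive p v (fun q : E => ln q.1) (v.1 * p.1^-1).
Proof.
move=> p0; rewrite mulrC.
apply: (@is_derive_comp_dir R E (@ln R) (fun q => q.1)); first exact: (@is_derive_coord R m None).
exact: is_derive1_ln.
Qed.

Lemma Ck_coord (O : set E) i k : Ck k O (coord i : E -> R).
Proof.
apply: Ck_linear; first exact: continuous_coord.
by move=> v p; exact: is_derive_coord.
Qed.

Lemma Ck_pow_inv k : Ck k positive (fun p : E => p.1^-1).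
Proof.
apply: Ck_inv; [exact: open_positive|by move=> p /= p0; rewrite gt_eqF|exact: (@Ck_coord _ None)].
Qed.

Lemma continuous_lnfst p : 0 < p.1 -> {for p, continuous (fun q : E => ln q.1)}.
Proof.
move=> p0; apply: (@cvg_comp _ _ _ (fun q : E => q.1) (@ln R)); first exact: cvg_fst.
exact: continuous_ln.
Qed.

Lemma Ck_log k : Ck k positive (fun p : E => ln p.1).
Proof.
case: k => [|k]; split=> //; try by move=> p; exact: continuous_lnfst.
move=> v; split=> [p p0|]; first by have [] := is_derive_log v p0.
apply: (@Ck_ext _ _ _ (fun p : E => v.1 * p.1^-1)); first exact: open_positive.
  by move=> p p0; have [_ ->] := is_derive_log v p0.
by apply: Ck_mul; [exact: open_positive|exact: Ck_cst|exact: Ck_pow_inv].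
Qed.

Lemma Ck_pol_log F k : ispol F -> Ck k positive (fun p => F (log_cone p)).
Proof.
case=> d; elim=> {d F}.
- by move=> d; exact: Ck_cst.
- by move=> d c; exact: Ck_cst.
- by move=> d F G _ IF _ IG; apply: Ck_add => //; exact: open_positive.
- move=> d i F _ IF; apply: Ck_mul => //; first exact: open_positive.
  by case: i => [j|]; [exact: (@Ck_coord _ (Some j))|exact: Ck_log].
Qed.

(* [t ^ - a] *)
Definition cone_pow (a : R) p : R := expR (- a * ln p.1).

Lemma cone_pow_gt0 a p : 0 < cone_pow a p.
Proof. exact: expR_gt0. Qed.

Lemma is_derive_cone_pow a v p : 0 < p.1 ->
  is_derive p v (cone_pow a) (cone_pow a p * (- a * v.1 * p.1^-1)).
Proof.
move=> p0; apply: (@is_derive_comp_dir R E (@expR R) (fun q : E => - a * ln q.1)).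
  by rewrite -mulrA; apply: is_deriveZ; exact: is_derive_log.
Qed.

Lemma continuous_cone_pow a p : 0 < p.1 -> {for p, continuous (cone_pow a)}.
Proof.
move=> p0; apply: (@cvg_comp _ _ _ (fun q : E => - a * ln q.1) (@expR R)).
  by apply: cvgM; [exact: cvg_cst|exact: continuous_lnfst].
exact: continuous_expR.
Qed.

Lemma Ck_cone_pow a k : Ck k positive (cone_pow a).
Proof.
apply: (@Ck_ode _ _ _ _ (fun v p => - a * v.1 * p.1^-1)).
- exact: open_positive.
- by move=> v; apply: Ck_mul; [exact: open_positive|exact: Ck_cst|exact: Ck_pow_inv].
- by move=> p; exact: continuous_cone_pow.
- by move=> v p; exact: is_derive_cone_pow.
Qed.

Definition cone_lift a G p : R := cone_pow a p * G (log_cone p).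

Lemma Ck_cone_lift a F k : ispol F -> Ck k positive (cone_lift a F).
Proof.
move=> pF; apply: Ck_mul; [exact: open_positive|exact: Ck_cone_pow|exact: Ck_pol_log].
Qed.

(** [tdt] and all [dx i] in one family, so that sums over [option 'I_m] range over the whole cone
    gradient. *)
Definition cone_derive i f p : R :=
  if i is None then p.1 * 'D_(ebase i) f p else 'D_(ebase i) f p.

(* [t d/dt (t^-a G (log t, x)) = t^-a ((d/ds - a) G) (log t, x)]. *)
Definition twist a i G z : R := 'D_(ebase i) G z - (if i is None then a else 0) * G z.

Lemma is_derive_log_cone G i p : 0 < p.1 -> derivable G (log_cone p) (ebase i) ->
  is_derive p (ebase i) (fun q => G (log_cone q))
    ((if i is None then p.1^-1 else 1) * 'D_(ebase i) G (log_cone p)).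
Proof.
move=> p0 dG; apply: is_derive_line; case: i dG => [j|] dG.
  rewrite mul1r (_ : (fun s => _) = fun s => G (log_cone p + s *: ebase (Some j))).
    have := @derive_line R E G (log_cone p) (ebase (Some j)) 0.
    by rewrite scale0r addr0; apply.
  apply/funext => s; congr (G (_, _)) => /=; by rewrite [s *: 0]mulr0 !addr0.
rewrite (_ : (fun s => _) = fun s => (fun r => G (log_cone p + r *: ebase None)) (ln (p.1 + s) - ln p.1)); last first.
  apply/funext => s; congr (G (_, _)) => /=.
    by rewrite [s *: 1]mulr1 [_ *: 1]mulr1 subrKC.
  by rewrite !scaler0 !addr0.
rewrite mulrC.
have sh : is_derive (0 : R) (1 : R) (fun s => ln (p.1 + s) - ln p.1) p.1^-1.
  rewrite -[p.1^-1]subr0; apply: is_deriveB.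
  have i1 : is_derive (0 : R) (1 : R) (fun s => p.1 + s) 1.
    have := is_deriveD (is_derive_cst p.1 (0 : R) (1 : R)) (@is_derive_id R R 0 1).
    by rewrite add0r.
  have i2 : is_derive (p.1 + 0) (1 : R) (@ln R) p.1^-1.
    by rewrite addr0; exact: is_derive1_ln.
  by have := @is_derive1_comp R (@ln R) (fun s => p.1 + s) 0 _ _ i2 i1; rewrite mulr1.
have dl : is_derive (ln (p.1 + 0) - ln p.1) (1 : R) (fun r => G (log_cone p + r *: ebase None))
      ('D_(ebase None) G (log_cone p)).
  rewrite addr0 subrr; have := @derive_line R E G (log_cone p) (ebase None) 0.
  by rewrite scale0r addr0; apply.
exact: (@is_derive1_comp R _ _ 0 _ _ dl sh).
Qed.

Lemma is_derive_cone_lift a G i p : 0 < p.1 -> derivable G (log_cone p) (ebase i) ->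
  is_derive p (ebase i) (cone_lift a G) ((if i is None then p.1^-1 else 1) * cone_lift a (twist a i G) p).
Proof.
move=> p0 dG.
have := is_deriveM (is_derive_cone_pow a (ebase i) p0) (is_derive_log_cone p0 dG).
move=> /is_derive_eq; apply; rewrite /GRing.scale/= /cone_lift /twist.
by case: i dG => [j|] dG /=; ring.
Qed.

Lemma cone_derive_lift a G i p : 0 < p.1 -> derivable G (log_cone p) (ebase i) ->
  cone_derive i (cone_lift a G) p = cone_lift a (twist a i G) p.
Proof.
move=> p0 dG; rewrite /cone_derive; have [_ ->] := is_derive_cone_lift a p0 dG.
by case: i dG => [j|] dG; rewrite ?mul1r// mulrA mulfV ?mul1r// gt_eqF.
Qed.

Lemma near_cone_derive f G i p : (\forall q \near p, f q = G q) -> cone_derive i f p = cone_derive i G p.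
Proof. by move=> fG; rewrite /cone_derive (near_eq_derive _ fG). Qed.

Lemma ispol_twist a i F : ispol F -> ispol (twist a i F).
Proof.
move=> pF; apply: ispol_sub; first exact: ispol_derive.
by apply: ispol_mul => //; exact: ispol_cst.
Qed.

(** On lifts [t d/dt] acts as [d/ds - a], and [(d/ds - a)^2 + 2 a (d/ds - a) = d^2/ds^2 - a^2]: the
    first-order term disappears. *)
Lemma cone_operator_lift a F p : ispol F -> 0 < p.1 ->
  \sum_i cone_derive i (cone_derive i (cone_lift a F)) p + 2 * a * cone_derive None (cone_lift a F) p =
  cone_lift a (fun z => laplacian F z - a ^+ 2 * F z) p.
Proof.
move=> pF p0.
have D i : cone_derive i (cone_derive i (cone_lift a F)) p = cone_lift a (twist a i (twist a i F)) p.
  rewrite -cone_derive_lift//; last by apply: ispol_derivable; exact: ispol_twist.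
  apply: near_cone_derive; apply: near_open open_positive p0 _ => q q0.
  by apply: cone_derive_lift => //; exact: ispol_derivable.
have T i : twist a i (twist a i F) (log_cone p) = 'D_(ebase i) ('D_(ebase i) F) (log_cone p) +
    (if i is None then - (2 * a * 'D_(ebase None) F (log_cone p)) + a ^+ 2 * F (log_cone p) else 0).
  rewrite {1}/twist (_ : twist a i F = fun z => 'D_(ebase i) F z - (if i is None then a else 0) * F z)//.
  have d1 : derivable F (log_cone p) (ebase i) by exact: ispol_derivable.
  have d2 : derivable ('D_(ebase i) F) (log_cone p) (ebase i) by apply: ispol_derivable; exact: ispol_derive.
  rewrite deriveB//; last exact: derivableM.
  by rewrite deriveMl//; case: i d1 d2 => [j|] d1 d2 /=; ring.
under eq_bigr do rewrite D /cone_lift T mulrDr.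
rewrite cone_derive_lift//; last exact: ispol_derivable.
rewrite big_split/= -mulr_sumr [X in _ + X + _](bigD1 None)//= [X in _ + (_ + X) + _]big1 ?addr0.
  by rewrite /cone_lift /twist/= /laplacian; ring.
by case=> [j|]// _; rewrite mulr0.
Qed.

End Cone.
Arguments exp_cone {R m} z.
Arguments log_cone {R m} p.
Arguments cone_pow {R m} a p.
Arguments cone_lift {R m} a G p.
Arguments cone_derive {R m} i f p.
Arguments twist {R m} a i G z.

(** * Essential bounds, semicontinuity and continuity *)

Section Bounded.
Variables (R : realType) (n : nat).
Local Notation E := (R * 'rV[R]_n.-1)%type.
Implicit Types (f : E -> R) (X : set 'rV[R]_n.-1).

Lemma open_cube_leb (r : R) (z : E) : 0 < r -> leb R n (open_cube r z) = ((2 * r) ^+ n.-1.+1)%:E.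
Proof. exact: leb_cube. Qed.

Lemma open_coneB X : open X -> open (coneB X).
Proof.
move=> oX; rewrite (_ : coneB X = fst @^-1` `]0, 1[%classic `&` snd @^-1` X).
  apply: openI; apply: open_comp => //.
  - by move=> p _; exact: cvg_fst.
  - by move=> p _; exact: cvg_snd.
by apply/seteqP; split => p.
Qed.

(** If the bound failed at [p], it would fail on a cube around [p], which has positive measure and
    cannot lie in a null set. *)
Lemma ae_bounded_continuous (O : set E) f M : open O -> (forall p, O p -> {for p, continuous f}) ->
  {ae leb R n, forall p, `|(f \_ O) p| <= M} -> forall p, O p -> `|f p| <= M.
Proof.
move=> oO cf [N [mN N0 fN]] p Op; rewrite leNgt; apply/negP => Mf.
have cn : `|f q| @[q --> p] --> `|f p| by apply: cvg_norm; exact: cf.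
have /nbhs_coord[e e0 eW] : nbhs p [set q | O q /\ M < `|f q|].
  apply: filterI; first exact: open_nbhs_nbhs.
  exact: (cvgr_gt _ cn).
have sub : open_cube e p `<=` N.
  move=> q qe; apply: fN => /=; have [Oq Mq] := eW q qe.
  by rewrite patchE mem_set//; apply/negP; rewrite -ltNge.
have : (leb R n (open_cube e p) <= leb R n N)%E.
  by apply: le_measure => //; rewrite inE//; exact: measurable_open_cube.
by rewrite N0 open_cube_leb// lee_fin leNgt exprn_gt0// mulr_gt0.
Qed.

Lemma Linfty_bounded X f : open X -> (forall p, coneB X p -> {for p, continuous f}) ->
  Linfty X f -> exists2 M, 0 <= M & forall p, coneB X p -> `|f p| <= M.
Proof.
move=> oX cf; rewrite /Linfty inE => /andP[_]; rewrite inE/= /finite_norm unlock.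
(* The norm of exponent [+oo] is an essential supremum only on a space of positive measure. *)
have leb0 : (0 < leb R n [set: E])%E.
  apply: (@lt_le_trans _ _ (leb R n (open_cube 1 0))).
    by rewrite open_cube_leb// lte_fin exprn_gt0// mulr_gt0.
  by apply: le_measure; rewrite ?inE//; exact: measurable_open_cube.
rewrite leb0 => Moo.
have [M fM] : exists M, \forall p \ae leb R n, (`|(f \_ (coneB X)) p| <= M).
  by apply: ess_supr_bounded; exact: Moo.
exists `|M|; first exact: normr_ge0.
move=> p Xp; apply: le_trans (ler_norm M).
exact: (ae_bounded_continuous (open_coneB oX) cf fM).
Qed.

Lemma semicontinuous_continuous X f : open X -> usc X f -> lsc X f ->
  forall p, coneB X p -> {for p, continuous f}.
Proof.
move=> oX uf lf p Xp; apply/cvgrPdist_lt => e e0.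
have nX : \forall q \near p, coneB X q by apply: open_nbhs_nbhs; split => //; exact: open_coneB.
have h1 := uf p Xp (f p + e); have h2 := lf p Xp (f p - e).
have {}h1 := h1 (ltac:(by rewrite ltrDl)); have {}h2 := h2 (ltac:(by rewrite ltrBlDr ltrDl)).
near=> q; rewrite ltr_distlC; apply/andP; split.
  have : coneB X q -> f p - e < f q by near: q.
  by apply; near: q.
have : coneB X q -> f q < f p + e by near: q.
by apply; near: q.
Unshelve. all: by end_near. Qed.

End Bounded.

(** * The viscosity solution in logarithmic coordinates *)

Section ViscosityCone.
Variables (R : realType) (n : nat) (X : set 'rV[R]_n.-1).
Local Notation E := (R * 'rV[R]_n.-1)%type.
Variables (h : R -> R) (f u : E -> R).
Hypothesis oX : open X.
Hypothesis hcont : continuous h.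
Hypothesis cf : forall p, coneB X p -> {for p, continuous f}.
Hypothesis usol : viscosity_solution X h f u.

Let cu p : coneB X p -> {for p, continuous u}.
Proof. by case: usol => -[us _] [ls _]; exact: semicontinuous_continuous. Qed.

Let a : R := (n%:R - 2) / 2.

Definition log_domain : set E := [set z | z.1 < 0 /\ X z.2].

Lemma log_domainE z : log_domain z <-> coneB X (exp_cone z).
Proof.
rewrite /log_domain /coneB /exp_cone/=; split; move=> [z1 z2]; split=> //=.
  by rewrite in_itv/= expR_gt0 expR_lt1.
by move: z1; rewrite in_itv/= expR_lt1 => /andP[].
Qed.

Lemma coneB_gt0 p : coneB X p -> 0 < p.1.
Proof. by case; rewrite /= in_itv/= => /andP[]. Qed.

Lemma log_domain_log p : coneB X p -> log_domain (log_cone p).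
Proof. by move=> Xp; apply/log_domainE; rewrite log_coneK//; exact: coneB_gt0. Qed.

Lemma open_log_domain : open log_domain.
Proof.
rewrite (_ : log_domain = exp_cone @^-1` coneB X).
  by apply: open_comp => [z _|]; [exact: continuous_exp_cone|exact: open_coneB].
by apply/seteqP; split=> z /log_domainE.
Qed.

Definition flat_source p : R := f p - h (u p).

Definition flat_u z : R := expR (a * z.1) * u (exp_cone z).

(** The equation for a lift, [t^-2 t^-a (laplacian U - a^2 U) = f - h(u)], solved for [laplacian U]
    with [t = exp s]. *)
Definition flat_rhs z : R := expR ((a + 2) * z.1) * flat_source (exp_cone z) + a ^+ 2 * flat_u z.

Lemma flat_source_continuous p : coneB X p -> {for p, continuous flat_source}.
Proof.
move=> Xp; apply: cvgB; first exact: cf.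
by apply: (@cvg_comp _ _ _ u h); [exact: cu|exact: hcont].
Qed.

Let continuous_exp_scale (b : R) : continuous (fun z : E => expR (b * z.1)).
Proof.
move=> z; apply: (@cvg_comp _ _ _ (fun q : E => b * q.1) (@expR R)); last exact: continuous_expR.
by apply: cvgM; [exact: cvg_cst|exact: cvg_fst].
Qed.

Let continuous_exp_comp (g : E -> R) z : log_domain z -> (forall p, coneB X p -> {for p, continuous g}) ->
  {for z, continuous (fun w => g (exp_cone w))}.
Proof.
move=> /log_domainE Oz cg; apply: (@cvg_comp _ _ _ exp_cone g); first exact: continuous_exp_cone.
exact: cg.
Qed.

Lemma flat_u_continuous z : log_domain z -> {for z, continuous flat_u}.
Proof.
move=> Oz; apply: cvgM; first exact: continuous_exp_scale.
exact: continuous_exp_comp.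
Qed.

Lemma flat_rhs_continuous z : log_domain z -> {for z, continuous flat_rhs}.
Proof.
move=> Oz; apply: cvgD; last by apply: cvgM; [exact: cvg_cst|exact: flat_u_continuous].
apply: cvgM; first exact: continuous_exp_scale.
by apply: continuous_exp_comp => // p; exact: flat_source_continuous.
Qed.

Lemma flat_uE p : coneB X p -> u p = cone_lift a flat_u p.
Proof.
move=> Xp; rewrite /cone_lift /flat_u /cone_pow log_coneK; last exact: coneB_gt0.
by rewrite mulrA -expRD mulNr addNr expR0 mul1r.
Qed.

Lemma viscosity_operator_lift F p : ispol F -> 0 < p.1 ->
  viscosity_operator h u (cone_lift a F) p =
  p.1 ^- 2 * cone_lift a (fun z => laplacian F z - a ^+ 2 * F z) p + h (u p).
Proof.
move=> pF p0; rewrite -cone_operator_lift// /viscosity_operator; congr (_ + _).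
rewrite -mulrA -mulrDr; congr (_ * (_ + _ * _)); last by rewrite /a; field.
rewrite /lapB (bigD1 None)//=; congr (_ + _).
rewrite [RHS](reindex_omap Some id)/=; last by case.
by apply: eq_big => [i|i _]//; rewrite eqxx.
Qed.

Let cone_pow_exp (z : E) : (expR z.1) ^- 2 * cone_pow a (exp_cone z) = (expR ((a + 2) * z.1))^-1.
Proof.
rewrite /cone_pow/= expRK -expRM_natl -expRN -expRN -expRD; congr expR; ring.
Qed.

(** The test function is the lift of [P + c], with [c] such that it equals [u] at [p]. Lifting
    multiplies differences by the positive but non-constant factor [t^-a], which preserves a local
    extremum only when its value is 0; the Laplacian ignores [c]. *)
Lemma flat_viscosity_solution : flat_viscosity log_domain flat_u flat_rhs.
Proof.
move=> P pP z Oz; set p := exp_cone z.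
have Xp : coneB X p by apply/log_domainE.
have p0 : 0 < p.1 by exact: coneB_gt0.
pose c := flat_u z - P z.
have pF : ispol (fun w => P w + c) by apply: ispol_add => //; exact: ispol_cst.
pose phi := cone_lift a (fun w => P w + c).
have Cphi : Ck 2 (coneB X) phi.
  have : Ck 2 (@positive R n.-1) phi by exact: Ck_cone_lift.
  have sub : coneB X `<=` @positive R n.-1 by move=> q; exact: coneB_gt0.
  move=> [c0 d0]; split; first by move=> q /sub; exact: c0.
  move=> v; have [d1 [c1 d2]] := d0 v; split; first by move=> q /sub; exact: d1.
  split; first by move=> q /sub; exact: c1.
  move=> w; have [d3 [c3 _]] := d2 w; split; first by move=> q /sub; exact: d3.
  by split => // q /sub; exact: c3.
have zp : log_cone p = z by exact: exp_coneK.
have diffE q : coneB X q -> u q - phi q = cone_pow a q * ((flat_u (log_cone q) - P (log_cone q)) - c).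
  by move=> Xq; rewrite flat_uE// /phi /cone_lift; ring.
have diff0 : u p - phi p = 0 by rewrite diffE// zp /c subrr mulr0.
have opE : viscosity_operator h u phi p = (expR ((a + 2) * z.1))^-1 * (laplacian P z - a ^+ 2 * flat_u z) + h (u p).
  rewrite viscosity_operator_lift// /cone_lift zp.
  rewrite laplacianD//; last exact: ispol_cst.
  rewrite laplacian_cst addr0 mulrA cone_pow_exp// (_ : P z + c = flat_u z)//.
  by rewrite /c addrC subrK.
have e0 : 0 < expR ((a + 2) * z.1) by exact: expR_gt0.
have nearp (Q : E -> Prop) : (\forall w \near z, Q w) -> \forall q \near p, Q (log_cone q).
  move=> Qz; have := @continuous_log_cone R n.-1 p p0; rewrite /prop_for /continuous_at zp.
  by apply; exact: Qz.
have [[_ sub] [_ super]] := usol.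
split=> zP.
  have lm : local_max X (fun q => u q - phi q) p.
    split => //; apply: filterS (nearp _ zP) => q Pq Xq.
    rewrite diff0 diffE// -[leRHS](mulr0 (cone_pow a q)) ler_wpM2l ?(ltW (cone_pow_gt0 _ _))//.
    by rewrite subr_le0.
  have := sub phi Cphi p lm; rewrite opE -lerBlDr.
  by rewrite ler_pdivlMl// lerBrDr.
have lm : local_min X (fun q => u q - phi q) p.
  split => //; apply: filterS (nearp _ zP) => q Pq Xq.
  rewrite diff0 diffE// -[leLHS](mulr0 (cone_pow a q)) ler_wpM2l ?(ltW (cone_pow_gt0 _ _))//.
  by rewrite subr_ge0.
have := super phi Cphi p lm; rewrite opE -lerBrDr.
by rewrite ler_pdivrMl// lerBlDr.
Qed.

End ViscosityCone.

(** * C^1 approximation and gradient bound on the cone *)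

Section ConeRegularity.
Variables (R : realType) (n : nat) (X : set 'rV[R]_n.-1).
Local Notation E := (R * 'rV[R]_n.-1)%type.
Variables (h : R -> R) (f u : E -> R).
Hypothesis n2 : (2 <= n)%N.
Hypothesis oX : open X.
Hypothesis hcont : continuous h.
Hypothesis cf : forall p, coneB X p -> {for p, continuous f}.
Hypothesis usol : viscosity_solution X h f u.

Let a : R := (n%:R - 2) / 2.
Let a0 : 0 <= a.
Proof. by rewrite divr_ge0// subr_ge0 ler_nat. Qed.
Local Notation U := (flat_u u).
Local Notation H := (flat_rhs h f u).
Local Notation O := (log_domain X).

Let oO : open O. Proof. exact: open_log_domain. Qed.
Let cU z : O z -> {for z, continuous U}.
Proof. exact: (flat_u_continuous oX usol). Qed.
Let cH z : O z -> {for z, continuous H}.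
Proof. exact: (flat_rhs_continuous oX hcont cf usol). Qed.
Let vU : flat_viscosity O U H. Proof. exact: flat_viscosity_solution. Qed.

Let u_near p : coneB X p -> \forall q \near p, u q = cone_lift a U q.
Proof. by move=> Xp; apply: near_open (open_coneB oX) Xp _ => q; exact: flat_uE. Qed.

Let dU z i : O z -> derivable U z (ebase i).
Proof. by move=> Oz; exact: (flat_derivable oO cU cH vU). Qed.

Lemma cone_derive_solution p i : coneB X p ->
  cone_derive i u p = cone_lift a (twist a i U) p.
Proof.
move=> Xp; rewrite (near_cone_derive i (u_near Xp)) cone_derive_lift//; first exact: (coneB_gt0 Xp).
by apply: dU; exact: log_domain_log.
Qed.

Lemma derivable_solution p i : coneB X p -> derivable u p (ebase i).
Proof.
move=> Xp; have un : \forall q \near p, cone_lift a U q = u q.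
  by apply: filterS (u_near Xp) => q ->.
apply: near_eq_derivable un _.
have := @is_derive_cone_lift R n.-1 a U i p (coneB_gt0 Xp) (@dU _ i (log_domain_log Xp)).
by case.
Qed.

Lemma continuous_cone_derive_solution p i : coneB X p -> {for p, continuous (cone_derive i u)}.
Proof.
move=> Xp; apply: near_continuous (_ : {for p, continuous (cone_lift a (twist a i U))}).
  by apply: near_open (open_coneB oX) Xp _ => q Xq; rewrite cone_derive_solution.
have p0 := coneB_gt0 Xp.
apply: cvgM; first exact: continuous_cone_pow.
apply: (@cvg_comp _ _ _ log_cone (twist a i U)); first exact: continuous_log_cone.
have Op := log_domain_log Xp.
apply: cvgB; first exact: (flat_derive_continuous oO cU cH vU).
by apply: cvgM; [exact: cvg_cst|exact: cU].
Qed.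

Lemma flat_sourceE p : coneB X p ->
  flat_source h f u p = p.1 ^- 2 * cone_lift a (fun z => H z - a ^+ 2 * U z) p.
Proof.
move=> Xp; have p0 := coneB_gt0 Xp; rewrite /cone_lift /flat_rhs addrK log_coneK// /cone_pow/=.
rewrite [in p.1 ^- 2](_ : p.1 = expR (ln p.1)); last by rewrite lnK.
rewrite -expRM_natl -expRN mulrA -expRD mulrA -expRD -/a.
have -> : - (2 * ln p.1) + (- a * ln p.1 + (a + 2) * ln p.1) = 0 by ring.
by rewrite expR0 mul1r.
Qed.

Lemma cone_approx p0 : coneB X p0 -> exists r, [/\ 0 < r,
  forall p, 0 < p.1 -> sqdist (log_cone p) (log_cone p0) <= r ^+ 2 -> coneB X p &
  forall e, 0 < e -> exists2 F, ispol F &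
  forall p, 0 < p.1 -> sqdist (log_cone p) (log_cone p0) <= r ^+ 2 ->
   [/\ `|u p - cone_lift a F p| <= e,
       `|flat_source h f u p - p.1 ^- 2 * cone_lift a (fun z => laplacian F z - a ^+ 2 * F z) p| <= e &
       forall i, `|cone_derive i u p - cone_derive i (cone_lift a F) p| <= e]].
Proof.
move=> Xp0; have Oz := log_domain_log Xp0; set z := log_cone p0 in Oz *.
have /nbhs_coord[r0 r00 r0O] : nbhs z O by exact: open_nbhs_nbhs.
pose r := r0 / 2; have r_gt0 : 0 < r by rewrite divr_gt0.
have rO : cube r z `<=` O.
  by move=> w wr; apply: r0O => i; apply: le_lt_trans (wr i) _; rewrite /r ltr_pdivrMr// ltr_pMr// ltr1n.
set d := r / (4 * n.-1.+1%:R).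
have d0 : 0 < d by rewrite divr_gt0// mulr_gt0// ltr0n.
have dr : d <= r.
  rewrite ler_pdivrMr ?mulr_gt0 ?ltr0n// ler_peMr ?(ltW r_gt0)//.
  by apply: (@le_trans _ _ (4 * 1)); rewrite ?ler_pM2l ?ler1n// mulr1 ler1n.
have dz p : sqdist (log_cone p) z <= d ^+ 2 -> cube d z (log_cone p).
  by apply: disk_cube; exact: ltW.
have dX p : 0 < p.1 -> sqdist (log_cone p) z <= d ^+ 2 -> coneB X p.
  move=> pp /dz pd; rewrite -(log_coneK pp); apply/log_domainE/rO => i.
  exact: le_trans (pd i) dr.
exists d; split => // e e0.
(* On the disk [- ln t <= |z.1| + d], so [B] bounds both [t^-a] and [t^-(a+2)]. In [C] below,
   [1 + a + a^2] dominates the constants of the three errors: 1 for the values, [1 + a] for the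
   derivatives through [twist], [1 + a^2] for the source. *)
pose B := expR ((a + 2) * (`|z.1| + d)).
have B0 : 0 < B by exact: expR_gt0.
pose C := B * (1 + a + a ^+ 2).
have C0 : 0 < C by rewrite mulr_gt0// ltr_wpDr ?sqr_ge0// ltr_wpDr.
have e1 : 0 < e / C by rewrite divr_gt0.
have [F pF FU] := flat_derive_approx oO cU cH vU r_gt0 e1 rO.
exists F => // p pp pz; have Xp := dX p pp pz.
have [F1 F2 F3] := FU _ (dz p pz).
have zp : - ln p.1 <= `|z.1| + d.
  have := dz p pz None => /=; rewrite ler_norml => /andP[h1 _].
  by have := lerNnormlW (lexx `|z.1|); move: h1; rewrite /log_cone/=; lra.
have zd0 : 0 <= `|z.1| + d by rewrite addr_ge0// ltW.
have powB : cone_pow a p <= B.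
  rewrite ler_expR mulNr -mulrN; apply: (le_trans (ler_wpM2l a0 zp)).
  by rewrite ler_wpM2r// lerDl.
have pow2B : p.1 ^- 2 * cone_pow a p <= B.
  rewrite [in p.1 ^- 2](_ : p.1 = expR (ln p.1)); last by rewrite lnK.
  rewrite -expRM_natl -expRN /cone_pow -expRD ler_expR.
  have -> : - (2 * ln p.1) + - a * ln p.1 = (a + 2) * (- ln p.1) by ring.
  by rewrite ler_wpM2l// addr_ge0.
have C1 : B * (e / C) <= e.
  rewrite mulrA ler_pdivrMr// mulrC ler_wpM2l ?(ltW e0)// /C ler_peMr ?(ltW B0)//.
  by rewrite -addrA lerDl addr_ge0// sqr_ge0.
have Ca : B * ((1 + a) * (e / C)) <= e.
  rewrite mulrA mulrA ler_pdivrMr// mulrC ler_wpM2l ?(ltW e0)// /C ler_wpM2l ?(ltW B0)//.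
  by rewrite lerDl sqr_ge0.
have Ca2 : B * ((1 + a ^+ 2) * (e / C)) <= e.
  rewrite mulrA mulrA ler_pdivrMr// mulrC ler_wpM2l ?(ltW e0)// /C ler_wpM2l ?(ltW B0)//.
  by rewrite lerD2r lerDl.
have pw0 := ltW (cone_pow_gt0 a p).
split.
- rewrite (flat_uE u Xp) /cone_lift -/a -mulrBr normrM ger0_norm//.
  by apply: le_trans C1; rewrite ler_pM.
- rewrite flat_sourceE// -mulrBr /cone_lift -mulrBr mulrA normrM ger0_norm; last first.
    by rewrite mulr_ge0// invr_ge0 sqr_ge0.
  apply: le_trans Ca2; apply: ler_pM => //; first by rewrite mulr_ge0// invr_ge0 sqr_ge0.
  rewrite (_ : _ - _ - _ = (H (log_cone p) - laplacian F (log_cone p)) -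
    a ^+ 2 * (U (log_cone p) - F (log_cone p))); last by ring.
  apply: le_trans (ler_normB _ _) _; rewrite mulrDl mul1r lerD// normrM ger0_norm ?sqr_ge0//.
  by rewrite ler_wpM2l// sqr_ge0.
- move=> i; rewrite cone_derive_solution// cone_derive_lift//; last exact: ispol_derivable.
  rewrite /cone_lift -mulrBr normrM ger0_norm//; apply: le_trans Ca; apply: ler_pM => //.
  set b : R := if i is None then a else 0.
  have b0 : 0 <= b by rewrite /b; case: (i).
  have ba : b <= a by rewrite /b; case: (i).
  rewrite (_ : twist a i U _ - _ = ('D_(ebase i) U (log_cone p) - 'D_(ebase i) F (log_cone p)) -
    b * (U (log_cone p) - F (log_cone p))); last by rewrite /twist -/b; ring.
  apply: le_trans (ler_normB _ _) _; rewrite mulrDl mul1r; apply: lerD; first exact: F3.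
  by rewrite normrM ger0_norm//; apply: ler_pM.
Qed.

(** [K] does not depend on [p], even as [t] tends to 0: on a disk of radius [r <= 1] the size of [U]
    is at most [exp (a + a s) M] at [s = ln t], and lifting back multiplies by [exp (- a s)]. *)
Lemma cone_gradient_bound M N : 0 <= M -> 0 <= N ->
  (forall p, coneB X p -> `|u p| <= M) -> (forall p, coneB X p -> `|flat_source h f u p| <= N) ->
  exists2 K, 0 <= K & forall p r i, coneB X p -> 0 < r -> r <= 1 ->
    cube r (log_cone p) `<=` O -> `|cone_derive i u p| <= K / r.
Proof.
move=> M0 N0 uM fN.
pose m1 : R := n.-1.+1%:R; have m10 : 0 < m1 by rewrite ltr0n.
have m11 : 1 <= m1 by rewrite ler1n.
pose N1 := N + a ^+ 2 * M; have N10 : 0 <= N1 by rewrite addr_ge0// mulr_ge0// sqr_ge0.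
(* [4 * m1 ^+ 2 * M] is [m1 * M] divided by [1 / (4 * m1)], the ratio of the inner radius to [r];
   the source term carries [r ^+ 2 / (4 * m1) <= 1]. The extra [a * M] comes from the zero-order
   part of [twist]. *)
pose K0 := expR a * (4 * m1 ^+ 2 * M + N1).
have K00 : 0 <= K0 by rewrite mulr_ge0 ?expR_ge0// addr_ge0// mulr_ge0// mulr_ge0// sqr_ge0.
exists (K0 + a * M); first by rewrite addr_ge0// mulr_ge0.
move=> p r i Xp r0 r1 rO; set z := log_cone p in rO *.
have S0 : 0 <= expR (a + a * z.1) by exact: expR_ge0.
have inO w : open_disk r z w -> [/\ O w & a * w.1 <= a + a * z.1].
  move=> wr; have wc : cube r z w by apply: disk_cube; [exact: ltW|exact: ltW].
  split; first exact: rO.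
  have : w.1 <= 1 + z.1 by have := wc None; rewrite /= ler_norml => /andP[_]; lra.
  by move=> /(ler_wpM2l a0); rewrite mulrDr mulr1.
have UM w : open_disk r z w -> `|U w| <= expR (a + a * z.1) * M.
  move=> /inO[Ow wz]; rewrite /flat_u normrM ger0_norm ?expR_ge0//.
  by apply: ler_pM; rewrite ?expR_ge0 ?ler_expR//; apply/uM/log_domainE.
have HN w : open_disk r z w -> `|H w| <= expR (a + a * z.1) * N1.
  move=> wr; have [Ow wz] := inO w wr; rewrite /flat_rhs /N1 [leRHS]mulrDr.
  apply: le_trans (ler_normD _ _) _; apply: lerD.
    rewrite normrM ger0_norm ?expR_ge0//; apply: ler_pM; rewrite ?expR_ge0//.
      rewrite ler_expR; apply: le_trans wz; rewrite -/a mulrDl gerDl.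
      by case: Ow => /ltW w0 _; rewrite pmulr_rle0.
    by apply/fN/log_domainE.
  rewrite normrM ger0_norm ?sqr_ge0// mulrCA; apply: ler_wpM2l; first exact: sqr_ge0.
  exact: UM.
have := flat_derive_bound oO cU cH vU i r0 rO (mulr_ge0 S0 M0) (mulr_ge0 S0 N10) UM HN.
rewrite -/m1 => DU.
rewrite cone_derive_solution// /cone_lift /twist -/z mulrBr.
apply: le_trans (ler_normB _ _) _; rewrite mulrDl; apply: lerD.
  rewrite normrM ger0_norm ?(ltW (cone_pow_gt0 _ _))//.
  apply: le_trans (ler_wpM2l (ltW (cone_pow_gt0 _ _)) DU) _.
  rewrite [leLHS](_ : _ = (cone_pow a p * expR (a + a * z.1)) * (4 * m1 ^+ 2 * M + N1 * r ^+ 2 / (4 * m1)) / r); last first.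
    by field; rewrite !gt_eqF.
  rewrite ler_pM2r ?invr_gt0// /cone_pow -expRD mulNr addrCA addNr addr0.
  rewrite ler_wpM2l ?expR_ge0// lerD2l -mulrA ler_piMr// ler_pdivrMr ?mulr_gt0// mul1r.
  by apply: (@le_trans _ _ 1); [rewrite expr_le1// ltW|lra].
set b : R := if i is None then a else 0.
have -> : cone_pow a p * (b * U z) = b * u p by rewrite (flat_uE u Xp) /cone_lift; ring.
have b0 : 0 <= b by rewrite /b; case: (i).
have ba : b <= a by rewrite /b; case: (i).
rewrite normrM ger0_norm//; apply: (@le_trans _ _ (a * M)); first by rewrite ler_pM// uM.
by rewrite ler_pdivlMr// ler_piMr// mulr_ge0.
Qed.

End ConeRegularity.

(** * Integration against [dt/t dx] *)

Section C1.
Variables (R : realType) (m : nat).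
Local Notation E := (R * 'rV[R]_m)%type.
Implicit Types (f g : E -> R) (p q z w v : E) (i : option 'I_m) (O : set E).

Definition C1on O f := forall p, O p ->
  [/\ {for p, continuous f}, forall i, derivable f p (ebase i) &
      forall i, {for p, continuous (fun q => 'D_(ebase i) f q)}].

Lemma Ck_C1on O f : Ck 1 O f -> C1on O f.
Proof.
move=> [cf df] p Op; split; first exact: cf.
  by move=> i; have [d _] := df (ebase i); exact: d.
by move=> i; have [_ [c _]] := df (ebase i); exact: c.
Qed.

Lemma C1on_ext O f g : open O -> (forall p, O p -> f p = g p) -> C1on O f -> C1on O g.
Proof.
move=> oO fg Cf p Op; have [c d c'] := Cf p Op.
have n1 : \forall q \near p, f q = g q by exact: near_open fg.
split; first exact: near_continuous c.
  by move=> i; apply: near_eq_derivable (d i).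
move=> i; apply: near_continuous (c' i).
apply: (near_open oO Op) => q Oq; apply: near_eq_derive.
exact: (near_open oO Oq fg).
Qed.

Lemma C1on_sub O O' f : O `<=` O' -> C1on O' f -> C1on O f.
Proof. by move=> sub Cf p /sub; exact: Cf. Qed.

Lemma C1on_add O f g : open O -> C1on O f -> C1on O g -> C1on O (fun p => f p + g p).
Proof.
move=> oO Cf Cg p Op; have [cf df Df] := Cf p Op; have [cg dg Dg] := Cg p Op.
split; first exact: cvgD.
  by move=> i; exact: derivableD.
move=> i; apply: (@near_continuous _ _ (fun q => 'D_(ebase i) f q + 'D_(ebase i) g q)); last first.
  by apply: cvgD; [exact: Df|exact: Dg].
apply: (near_open oO Op) => q Oq; have [_ df' _] := Cf q Oq; have [_ dg' _] := Cg q Oq.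
by rewrite deriveD.
Qed.

Lemma C1on_mul O f g : open O -> C1on O f -> C1on O g -> C1on O (fun p => f p * g p).
Proof.
move=> oO Cf Cg p Op; have [cf df Df] := Cf p Op; have [cg dg Dg] := Cg p Op.
split; first exact: cvgM.
  by move=> i; exact: derivableM.
move=> i; apply: (@near_continuous _ _ (fun q => f q * 'D_(ebase i) g q + g q * 'D_(ebase i) f q)).
  apply: (near_open oO Op) => q Oq; have [_ df' _] := Cf q Oq; have [_ dg' _] := Cg q Oq.
  by rewrite (deriveM (df' i) (dg' i)).
by apply: cvgD; apply: cvgM => //; [exact: Dg|exact: Df].
Qed.

Lemma C1on_comp O f (k dk : R -> R) : open O -> (forall x, is_derive x (1 : R) k (dk x)) -> continuous dk ->
  C1on O f -> C1on O (fun p => k (f p)).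
Proof.
move=> oO kE cdk Cf p Op; have [cf df Df] := Cf p Op.
have ck : continuous k.
  by move=> x; apply: differentiable_continuous; apply/derivable1_diffP; have [] := kE x.
have kd q i : O q -> is_derive q (ebase i) (fun q => k (f q)) (dk (f q) * 'D_(ebase i) f q).
  move=> Oq; have [_ df' _] := Cf q Oq; exact: (is_derive_comp_dir (DeriveDef (df' i) erefl) (kE _)).
split; first by apply: (@cvg_comp _ _ _ f k); [exact: cf|exact: ck].
  by move=> i; have [] := kd p i Op.
move=> i; apply: (@near_continuous _ _ (fun q => dk (f q) * 'D_(ebase i) f q)).
  by apply: (near_open oO Op) => q Oq; have [_ ->] := kd q i Oq.
apply: cvgM; last exact: Df.
by apply: (@cvg_comp _ _ _ f dk); [exact: cf|exact: cdk].
Qed.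

Lemma C1on_cst O (c : R) : C1on O (fun=> c).
Proof. by apply: Ck_C1on; exact: Ck_cst. Qed.

Lemma C1on_sum O (J : Type) (s : seq J) (F : J -> E -> R) : open O ->
  (forall j, C1on O (F j)) -> C1on O (fun p => \sum_(j <- s) F j p).
Proof.
move=> oO CF; elim: s => [|j s IH].
  by under eq_fun do rewrite big_nil; exact: C1on_cst.
by under eq_fun do rewrite big_cons; exact: C1on_add.
Qed.

Lemma C1on_inv O f : open O -> (forall p, O p -> f p != 0) -> C1on O f -> C1on O (fun p => (f p)^-1).
Proof.
move=> oO f0 Cf p Op; have [cf df Df] := Cf p Op.
have ci : {for p, continuous (fun q => (f q)^-1)} by exact: (cvgV (f0 p Op) cf).
split; [exact: ci|by move=> i; apply: derivableV; [exact: f0|exact: df]|move=> i].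
apply: (@near_continuous _ _ (fun q => - ((f q)^-1 * (f q)^-1) * 'D_(ebase i) f q)).
  apply: (near_open oO Op) => q Oq; have [_ df' _] := Cf q Oq.
  by rewrite (deriveV (f0 q Oq) (df' i)) /GRing.scale/= -invfM -expr2.
exact: (cvgM (cvgN (cvgM ci ci)) (Df i)).
Qed.

(** The bumps of the partition of unity are squares of positive parts, only C^1, so the weak
    identity is proved in this class, larger than [test_fun]. *)
Definition C1c O f := C1on O f /\ exists K, [/\ compact K, K `<=` O & forall p, ~ K p -> f p = 0].

Lemma compact_open_cube (K : set E) : compact K -> exists2 r, 0 < r & K `<=` open_cube r 0.
Proof.
move=> cK; have [[p0 Kp0]|] := pselect (exists p, K p); last first.
  by move=> nK; exists 1 => // p Kp; exfalso; apply: nK; exists p.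
have [||c _ cmax] := @compact_EVT_max E R (sqdist^~ 0) K _ cK; first by exists p0.
  by apply: continuous_subspaceT; exact: sqdist_continuous.
have s0 := sqdist_ge0 c (0 : E).
(* With [x] the largest squared distance, [x <= (x + 1) ^+ 2] avoids a square root; the second 1
   makes the cube open. *)
exists (sqdist c 0 + 2); first by rewrite ltr_wpDl.
move=> p Kp i.
have : cube (sqdist c 0 + 1) 0 p.
  apply: disk_cube; first by rewrite addr_ge0.
  by have := cmax p (mem_set Kp); rewrite /disk/=; nra.
by move=> /(_ i); lra.
Qed.

Lemma closed_compact (K : set E) : compact K -> closed K.
Proof. by move=> cK; apply: compact_closed => //; exact: norm_hausdorff. Qed.

Lemma near_notin (K : set E) p : compact K -> ~ K p -> \forall q \near p, ~ K q.
Proof.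
move=> cK Kp; apply: (@open_nbhs_nbhs E p (~` K)); split => //.
by rewrite openC; exact: closed_compact.
Qed.

Lemma derive_off (K : set E) f p v : compact K -> (forall p, ~ K p -> f p = 0) -> ~ K p ->
  is_derive p v f 0.
Proof.
move=> cK f0 Kp; apply: near_eq_is_derive (is_derive_cst 0 p v).
by apply: filterS (near_notin cK Kp) => q /f0 ->.
Qed.

Lemma compact_bounded_continuous O (K : set E) f : compact K -> K `<=` O ->
  (forall p, O p -> {for p, continuous f}) ->
  exists2 C, 0 <= C & forall p, K p -> `|f p| <= C.
Proof.
move=> cK KO cf; have [[p0 Kp0]|] := pselect (exists p, K p); last first.
  by move=> nK; exists 0 => // p Kp; exfalso; apply: nK; exists p.
have [||c _ cmax] := @compact_EVT_max E R (fun p => `|f p|) K _ cK; first by exists p0.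
  apply: continuous_in_subspaceT => p; rewrite inE => /KO Op.
  by apply: cvg_norm; exact: cf.
by exists `|f c| => // p Kp; apply: cmax; rewrite inE.
Qed.

Lemma C1c_integral0 O f i : open O -> C1c O f ->
  (\int[lebesgue_measure \x lebesgue_rV m]_(p in O) ('D_(ebase i) f p)%:E = 0)%E.
Proof.
move=> oO [Cf [K [cK KO f0]]].
have D0 p : ~ K p -> 'D_(ebase i) f p = 0.
  by move=> Kp; have [_ ->] := derive_off (ebase i) cK f0 Kp.
have dv p : derivable f p (ebase i).
  have [/KO Op|Kp] := pselect (K p); first by have [_ d _] := Cf p Op.
  by have [] := derive_off (ebase i) cK f0 Kp.
have cD p : {for p, continuous (fun q => 'D_(ebase i) f q)}.
  have [/KO Op|Kp] := pselect (K p); first by have [_ _ d] := Cf p Op.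
  apply: (@near_continuous _ _ (fun=> 0)); last exact: cvg_cst.
  by apply: filterS (near_notin cK Kp) => q /D0 ->.
transitivity (\int[lebesgue_measure \x lebesgue_rV m]_p ('D_(ebase i) f p)%:E)%E.
  rewrite integral_mkcond; apply: eq_integral => p _; rewrite patchE; case: ifPn => //.
  by rewrite notin_setE => Op; rewrite D0// => /KO.
apply: ((integral_line_derivative0 R m).1 i f (fun q => 'D_(ebase i) f q)); split.
- by apply: measurable_fun_continuous => //; exact: openT.
- have [|C C0 DC] := @compact_bounded_continuous setT K (fun q => 'D_(ebase i) f q) cK _ (fun p _ => cD p).
    by [].
  exists C => p; have [/DC//|Kp] := pselect (K p).
  by rewrite D0// normr0.
- have [r r0 Kr] := compact_open_cube cK; exists r => // z zr.
  by have Kz : ~ K z by [move/Kr]; rewrite f0// D0.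
- split=> z.
    by have := @derive_line R E f z (ebase i) 0; rewrite scale0r addr0 => /(_ (dv z)).
  move=> t; apply: (@cvg_comp _ _ _ (fun t : R => z + t *: ebase i) (fun q => 'D_(ebase i) f q)); last exact: cD.
  by apply: cvgD; [exact: cvg_cst|exact: cvgZl].
Qed.

End C1.

Section Mellin.
Variables (R : realType) (n : nat) (X : set 'rV[R]_n.-1).
Local Notation E := (R * 'rV[R]_n.-1)%type.
Hypothesis oX : open X.
Implicit Types (k l f g v psi : E -> R) (p q : E) (i : option 'I_n.-1) (K : set E).

Local Notation B := (coneB X).
Local Notation leb := (leb R n).

Let oB : open B. Proof. exact: open_coneB. Qed.
Local Notation T := (measurableTypeR R * 'rV[R]_n.-1)%type.
Let mB : @measurable _ T B. Proof. exact: (measurable_open oB). Qed.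
Let mcompact K : compact K -> @measurable _ T K. Proof. exact: measurable_compact. Qed.

Definition mint k := leb.-integrable B (fun p => (k p / p.1)%:E).

Lemma mint_ext k l : (forall p, B p -> k p = l p) -> mint k -> mint l.
Proof. by move=> kl; apply: eq_integrable => // p; rewrite inE => /kl ->. Qed.

Lemma mint_add k l : mint k -> mint l -> mint (fun p => k p + l p).
Proof.
move=> ik il; have := integrableD mB ik il; apply: eq_integrable => // p _ /=.
by rewrite mulrDl.
Qed.

Lemma mint_scale (c : R) k : mint k -> mint (fun p => c * k p).
Proof.
move=> ik; have := integrableZl mB c ik; apply: eq_integrable => // p _ /=.
by rewrite -EFinM mulrA.
Qed.

Lemma eq_mellin k l : (forall p, B p -> k p = l p) -> mellin_int B k = mellin_int B l.
Proof. by move=> kl; apply: eq_integral => p; rewrite inE => /kl ->. Qed.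

Lemma mellin_add k l : mint k -> mint l ->
  (mellin_int B (fun p => k p + l p)%R = mellin_int B k + mellin_int B l)%E.
Proof.
move=> ik il; rewrite /mellin_int -integralD_EFin//.
by apply: eq_integral => p _ /=; rewrite mulrDl.
Qed.

Lemma mellin_scale (c : R) k : mint k -> (mellin_int B (fun p => c * k p)%R = c%:E * mellin_int B k)%E.
Proof.
move=> ik; rewrite /mellin_int -integralZl//.
by apply: eq_integral => p _ /=; rewrite -EFinM mulrA.
Qed.

Lemma mint_fin k : mint k -> mellin_int B k \is a fin_num.
Proof. by move=> ik; apply: integrable_fin_num. Qed.

Lemma mint_sum (J : Type) (s : seq J) (k : J -> E -> R) : (forall j, mint (k j)) ->
  mint (fun p => \sum_(j <- s) k j p).
Proof.
move=> ik; elim: s => [|j s IH].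
  apply: (@mint_ext (fun=> 0)); first by move=> p _; rewrite big_nil.
  apply: (@eq_integrable _ _ _ _ _ _ (cst 0%E)) => //; last exact: integrable0.
  by move=> p _; rewrite mul0r.
by apply: mint_ext (mint_add (ik j) IH) => p _; rewrite big_cons.
Qed.

Lemma mellin_sum (J : Type) (s : seq J) (k : J -> E -> R) : (forall j, mint (k j)) ->
  (mellin_int B (fun p => \sum_(j <- s) k j p)%R = \sum_(j <- s) mellin_int B (k j))%E.
Proof.
move=> ik; elim: s => [|j s IH].
  rewrite big_nil /mellin_int; under eq_integral do rewrite big_nil mul0r.
  exact: integral0.
rewrite big_cons -IH -mellin_add//; last exact: mint_sum.
by apply: eq_mellin => p _; rewrite big_cons.
Qed.

Lemma compact_leb K : compact K -> (leb K < +oo)%E.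
Proof.
move=> cK; have [r r0 Kr] := compact_open_cube cK.
apply: (@le_lt_trans _ _ (leb (open_cube r 0))); last by rewrite open_cube_leb// ltry.
by apply: le_measure; rewrite ?inE//; [exact: measurable_compact|exact: measurable_open_cube].
Qed.

Lemma continuous_fst_inv p : B p -> {for p, continuous (fun q : E => q.1^-1)}.
Proof.
move=> Bp; have p0 : p.1 != 0 by rewrite gt_eqF// (coneB_gt0 Bp).
have c1 : q.1 @[q --> p] --> p.1 by exact: cvg_fst.
exact: (cvgV p0 c1).
Qed.

Lemma measurable_div_fst k : measurable_fun B k -> measurable_fun B (fun p => k p / p.1).
Proof.
move=> mk; apply: measurable_funM => //.
by apply: measurable_fun_continuous => // p; exact: continuous_fst_inv.
Qed.

Lemma compact_inv_bound K : compact K -> K `<=` B ->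
  exists2 C, 0 < C & forall p, K p -> 0 <= p.1^-1 <= C.
Proof.
move=> cK KB; have [C C0 KC] := compact_bounded_continuous cK KB continuous_fst_inv.
exists (C + 1); first by rewrite ltr_wpDl.
move=> p Kp; have p0 := coneB_gt0 (KB p Kp); rewrite invr_ge0 (ltW p0)/=.
by apply: (le_trans (ler_norm _)); apply: (le_trans (KC _ Kp)); rewrite lerDl.
Qed.

Lemma mint_bounded k K C : compact K -> K `<=` B -> measurable_fun B k ->
  (forall p, K p -> `|k p| <= C) -> (forall p, B p -> ~ K p -> k p = 0) -> mint k.
Proof.
move=> cK KB mk kC k0; have [D D0 KD] := compact_inv_bound cK KB.
apply: (@integrable_bounded R _ T leb K B (fun p => k p / p.1) (C * D)) => //.
- exact: measurable_compact.
- exact: compact_leb.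
- exact: measurable_div_fst.
- move=> p Kp; have /andP[h1 h2] := KD p Kp.
  by rewrite normrM [X in _ * X]ger0_norm// ler_pM// kC.
- by move=> p Bp Kp; rewrite k0// mul0r.
Qed.

Lemma mint_continuous k K : compact K -> K `<=` B -> (forall p, B p -> {for p, continuous k}) ->
  (forall p, B p -> ~ K p -> k p = 0) -> mint k.
Proof.
move=> cK KB ck k0; have [C C0 kC] := compact_bounded_continuous cK KB ck.
by apply: mint_bounded kC k0 => //; exact: measurable_fun_continuous.
Qed.

Lemma mint_L1loc g psi K : L1loc X g -> compact K -> K `<=` B -> (forall p, B p -> {for p, continuous psi}) ->
  (forall p, ~ K p -> psi p = 0) -> mint (fun p => g p * psi p).
Proof.
move=> [mg gK] cK KB cpsi psi0.
have [C C0 pC] := compact_bounded_continuous cK KB cpsi.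
have mK := mcompact cK.
have mpsi : measurable_fun B psi by exact: measurable_fun_continuous.
have mgt : measurable_fun B (fun p => g p / p.1) by exact: measurable_div_fst.
have iK : leb.-integrable K (fun p => (g p / p.1)%:E).
  apply/integrableP; split; first by apply/measurable_EFinP; exact: measurable_funS mgt.
  have := gK K cK KB; congr (_ < _)%E; apply: eq_integral => p; rewrite inE => Kp /=.
  by rewrite normrM [in RHS](@ger0_norm _ p.1^-1)// invr_ge0 ltW// (coneB_gt0 (KB p Kp)).
have bpsi : [bounded psi p | p in K].
  exists C; split; first exact: num_real.
  by move=> x Cx p Kp; exact: le_trans (pC p Kp) (ltW Cx).
have iK2 := integrableMl mK iK (measurable_funS mB KB mpsi) bpsi.
have iK3 : leb.-integrable (B `&` K) (fun p => (g p * psi p / p.1)%:E).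
  rewrite setIidr//; apply: eq_integrable iK2 => // p _ /=.
  by rewrite -EFinM; congr (_%:E); ring.
have /(integrable_restrict leb mK mB) := iK3.
apply: eq_integrable => // p; rewrite inE => Bp; rewrite patchE.
by case: ifPn => //; rewrite notin_setE => /psi0 ->; rewrite mulr0 mul0r.
Qed.

Lemma mellin_restrict k K : K `<=` B -> (forall p, B p -> ~ K p -> k p = 0) ->
  mellin_int B k = mellin_int K k.
Proof.
move=> KB k0; rewrite /mellin_int [LHS]integral_mkcond [RHS]integral_mkcond.
apply: eq_integral => p _; rewrite !patchE.
case: ifPn; rewrite ?inE ?notin_setE => Bp.
  by case: ifPn => //; rewrite notin_setE => Kp; rewrite k0// mul0r.
by rewrite ifF//; apply/negP; rewrite inE => /KB.
Qed.

Lemma L1loc_continuous k : (forall p, B p -> {for p, continuous k}) -> L1loc X k.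
Proof.
move=> ck; have mk : measurable_fun B k by exact: measurable_fun_continuous.
split=> // K cK KB; have [C C0 kC] := compact_bounded_continuous cK KB ck.
have [D D0 KD] := compact_inv_bound cK KB.
have mK := mcompact cK.
have iK : leb.-integrable K (fun p => (k p / p.1)%:E).
  apply: (@integrable_bounded R _ T leb K K (fun p => k p / p.1) (C * D)) => //.
  - exact: compact_leb.
  - by apply: measurable_funS (measurable_div_fst mk).
  - move=> p Kp; have /andP[h1 h2] := KD p Kp.
    by rewrite normrM [X in _ * X]ger0_norm// ler_pM// kC.
move/integrableP: iK => [_]; congr (_ < _)%E; apply: eq_integral => p; rewrite inE => Kp /=.
by rewrite normrM (@ger0_norm _ p.1^-1)// invr_ge0 ltW// (coneB_gt0 (KB p Kp)).
Qed.

(** [C] depends on [K] alone, so that integrals over a fixed support can pass to a uniform limit. *)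
Lemma mellin_small K : compact K -> K `<=` B -> exists2 C, 0 < C &
  forall k e, 0 <= e -> mint k -> (forall p, K p -> `|k p| <= e) -> (forall p, B p -> ~ K p -> k p = 0) ->
  (`|mellin_int B k| <= (C * e)%:E)%E.
Proof.
move=> cK KB; have [D D0 KD] := compact_inv_bound cK KB.
have mK := mcompact cK; have fK := compact_leb cK.
have fK' : leb K \is a fin_num by rewrite ge0_fin_numE.
exists (D * (fine (leb K) + 1)); first by rewrite mulr_gt0// ltr_wpDl// fine_ge0.
move=> k e e0 ik ke k0; rewrite (mellin_restrict KB k0).
have iK : leb.-integrable K (fun p => (k p / p.1)%:E) by exact: integrableS ik.
apply: (le_trans (le_abse_integral leb mK (measurable_int _ iK))).
apply: (@le_trans _ _ ((e * D)%:E * leb K)%E).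
  apply: integral_le_bound => //.
  - by case/integrableP: iK.
  - by rewrite lee_fin mulr_ge0// ltW.
  - apply: aeW => p Kp; have /andP[h1 h2] := KD p Kp.
    by rewrite lee_fin normrM [X in _ * X]ger0_norm// ler_pM// ke.
rewrite -(fineK fK') -EFinM lee_fin; have x0 : 0 <= fine (leb K) by rewrite fine_ge0.
rewrite [leRHS](_ : _ = e * D * (fine (leb K) + 1)); last by ring.
by rewrite ler_wpM2l ?lerDl// mulr_ge0// ltW.
Qed.

Lemma C1c_mul v psi : C1on B v -> C1c B psi -> C1c B (fun p => v p * psi p).
Proof.
move=> Cv [Cpsi [K [cK KB p0]]]; split; first exact: C1on_mul.
by exists K; split => // p /p0 ->; rewrite mulr0.
Qed.

Lemma C1on_fst_inv : C1on B (fun p : E => p.1^-1).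
Proof.
apply: (@C1on_sub _ _ _ (@positive R n.-1)); first by move=> p; exact: coneB_gt0.
exact/Ck_C1on/Ck_pow_inv.
Qed.

Lemma cone_derive_continuous v p (i : option 'I_n.-1) : C1on B v -> B p -> {for p, continuous (cone_derive i v)}.
Proof.
move=> Cv Bp; have [_ _ dv] := Cv p Bp; case: i => [j|]; first exact: dv.
have c1 : q.1 @[q --> p] --> p.1 by exact: cvg_fst.
exact: (cvgM c1 (dv None)).
Qed.

Lemma cone_derive_off K psi p (i : option 'I_n.-1) : compact K -> (forall p, ~ K p -> psi p = 0) -> ~ K p ->
  cone_derive i psi p = 0.
Proof.
move=> cK p0 Kp; rewrite /cone_derive; have [_ ->] := derive_off (ebase i) cK p0 Kp.
by case: i => [j|] //; rewrite mulr0.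
Qed.

(** Against [dt/t dx] the operator [t d/dt] becomes a plain [d/dt], and [1 / t] commutes with the
    derivatives in [x]; either way a Lebesgue integral of a derivative remains. *)
Lemma mellin_ibp psi (i : option 'I_n.-1) : C1c B psi -> mellin_int B (cone_derive i psi) = 0%E.
Proof.
move=> Cpsi; case: i => [j|].
  rewrite -(C1c_integral0 (Some j) oB (C1c_mul C1on_fst_inv Cpsi)).
  apply: eq_integral => p; rewrite inE => Bp; congr (_%:E).
  have [_ d1 _] := C1on_fst_inv Bp; have [_ d2 _] := Cpsi.1 p Bp.
  rewrite (deriveM (d1 _) (d2 _)) /cone_derive /=.
  have -> : 'D_(ebase (Some j)) (fun q : E => q.1^-1) p = 0.
    have p0 : p.1 != 0 by rewrite gt_eqF// (coneB_gt0 Bp).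
    have [dc dcE] := @is_derive_coord R n.-1 None p (ebase (Some j)).
    by rewrite (deriveV p0 dc) dcE/= scaler0.
  by rewrite scaler0 addr0 mulrC.
rewrite -(C1c_integral0 None oB Cpsi).
apply: eq_integral => p; rewrite inE => Bp; congr (_%:E).
by rewrite /cone_derive mulrAC mulfV ?mul1r// gt_eqF// (coneB_gt0 Bp).
Qed.

Lemma cone_deriveM v psi p (i : option 'I_n.-1) : C1on B v -> C1on B psi -> B p ->
  cone_derive i (fun q => v q * psi q) p = v p * cone_derive i psi p + cone_derive i v p * psi p.
Proof.
move=> Cv Cp Bp; have [_ d1 _] := Cv p Bp; have [_ d2 _] := Cp p Bp.
rewrite /cone_derive; rewrite (deriveM (d1 i) (d2 i)) /GRing.scale/=.
by case: i => [j|]; rewrite [psi p * _]mulrC// mulrDr mulrA mulrCA !mulrA.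
Qed.

Lemma mint_C1c_l v psi : (forall p, B p -> {for p, continuous v}) -> C1c B psi -> mint (fun p => v p * psi p).
Proof.
move=> cv [Cp [K [cK KB p0]]]; apply: (mint_continuous cK KB).
  by move=> p Bp; apply: cvgM; [exact: cv|by have [] := Cp p Bp].
by move=> p _ /p0 ->; rewrite mulr0.
Qed.

Lemma mint_C1c_r v psi (i : option 'I_n.-1) : (forall p, B p -> {for p, continuous v}) -> C1c B psi ->
  mint (fun p => v p * cone_derive i psi p).
Proof.
move=> cv [Cp [K [cK KB p0]]]; apply: (mint_continuous cK KB).
  by move=> p Bp; apply: cvgM; [exact: cv|exact: cone_derive_continuous].
by move=> p _ Kp; rewrite (cone_derive_off i cK p0 Kp) mulr0.
Qed.

Lemma mellin_by_parts v psi (i : option 'I_n.-1) : C1on B v -> C1c B psi ->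
  (mellin_int B (fun p => cone_derive i v p * psi p)%R =
   - mellin_int B (fun p => v p * cone_derive i psi p)%R)%E.
Proof.
move=> Cv Cp.
have cv p : B p -> {for p, continuous v} by move=> Bp; have [] := Cv p Bp.
have i1 := mint_C1c_l (fun p Bp => @cone_derive_continuous v p i Cv Bp) Cp.
have i2 := mint_C1c_r i cv Cp.
have := mellin_ibp i (C1c_mul Cv Cp).
rewrite (eq_mellin (fun p Bp => cone_deriveM i Cv Cp.1 Bp)) mellin_add//.
rewrite -(fineK (mint_fin i1)) -(fineK (mint_fin i2)) -EFinD -EFinN => H0.
have /eqP := congr1 fine H0; rewrite /= addrC addr_eq0 => /eqP ->.
by [].
Qed.

Lemma test_C1c psi : test_fun X psi -> C1c B psi.
Proof.
case=> sp cK KB; split; last first.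
  exists (closure [set p | psi p != 0]); split=> // p Kp; apply: contrapT => /eqP p0.
  by apply: Kp; exact: subset_closure.
by apply: (@C1on_sub _ _ _ setT) => //; apply: Ck_C1on; exact: sp.
Qed.

Lemma Ck_setU (O O' : set E) (k : nat) f : Ck k O f -> Ck k O' f -> Ck k (O `|` O') f.
Proof.
elim: k f => [|k IH] f [c1 d1] [c2 d2]; split => //.
- by move=> p [/c1|/c2].
- by move=> p [/c1|/c2].
move=> v; have [d3 C3] := d1 v; have [d4 C4] := d2 v; split; last exact: IH.
by move=> p [/d3|/d4].
Qed.

(** [g] may be singular at [t = 0], as [1 / t] is; smoothness of the product on the whole space is
    checked on the open cover by [positive] and the complement of the support of [psi]. *)
Lemma test_mul (g psi : E -> R) : (forall k : nat, Ck k (@positive R n.-1) g) -> test_fun X psi ->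
  test_fun X (fun p => g p * psi p).
Proof.
move=> Cg [sp cK KB]; set K := closure _ in cK KB.
have psi0 p : ~ K p -> psi p = 0.
  by move=> Kp; apply: contrapT => /eqP p0; apply: Kp; exact: subset_closure.
have sub : closure [set p | g p * psi p != 0] `<=` K.
  apply: closureS => p /=; apply: contra_neq => ->; exact: mulr0.
split; last 2 first.
- by apply: (subclosed_compact _ cK sub); exact: closed_closure.
- exact: subset_trans sub KB.
move=> k; rewrite (_ : setT = @positive R n.-1 `|` ~` K); last first.
  apply/seteqP; split => // p _; have [/KB Bp|Kp] := pselect (K p); last by right.
  by left; exact: coneB_gt0 Bp.
have oK : open (~` K) by rewrite openC; exact: closed_closure.
apply: Ck_setU.
  apply: Ck_mul; [exact: open_positive|exact: Cg|].
  have := sp k; clear; elim: k psi => [|k IH] psi [c d]; split=> //.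
    by move=> p _; exact: c.
    by move=> p _; exact: c.
  by move=> v; have [d1 C1] := d v; split; [move=> p _; exact: d1|exact: IH].
by apply: Ck_ext oK _ (Ck_cst _ 0 k) => p /psi0 ->; rewrite mulr0.
Qed.

Lemma test_cone_derive psi (i : option 'I_n.-1) : test_fun X psi -> test_fun X (cone_derive i psi).
Proof.
move=> [sp cK KB]; set K := closure _ in cK KB.
have psi0 p : ~ K p -> psi p = 0.
  by move=> Kp; apply: contrapT => /eqP p0; apply: Kp; exact: subset_closure.
have sub : closure [set p | cone_derive i psi p != 0] `<=` K.
  rewrite closureE; apply: smallest_sub; first exact: closed_closure.
  move=> p /= dp; apply: contrapT => Kp; move: dp.
  by rewrite (cone_derive_off i cK psi0 Kp) eqxx.
split; last 2 first.
- by apply: (subclosed_compact _ cK sub); exact: closed_closure.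
- exact: subset_trans sub KB.
move=> k; have [_ d] := sp k.+1; have [_ Cd] := d (ebase i).
case: i {sub d} Cd => [j|] Cd; first exact: Cd.
by apply: Ck_mul => //; [exact: openT|exact: (@Ck_coord R n.-1 setT None)].
Qed.

Lemma C1on_weak_deriv v (i : option 'I_n.-1) : C1on B v -> weak_deriv X (cone_derive i) v (cone_derive i v).
Proof.
move=> Cv; split.
- by apply: L1loc_continuous => p Bp; have [] := Cv p Bp.
- by apply: L1loc_continuous => p Bp; exact: cone_derive_continuous.
- by move=> psi /test_C1c Cp; exact: mellin_by_parts.
Qed.

End Mellin.

(** * The weak formulation *)

Section PositivePartSquare.
Variable R : realType.

(** The profile of the bump functions. At 0 it is approximated by the zero function with error
    [t^2 <= e |t|]. *)
Lemma is_derive_maxr_sqr (x : R) :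
  is_derive x (1 : R) (fun y : R => Num.max 0 y ^+ 2) (2 * Num.max 0 x).
Proof.
case: (ltgtP 0 x) => [x0|x0|<-].
- apply: (@near_eq_is_derive _ _ _ (fun y : R => y ^+ 2)).
    near=> y; rewrite max_r//; apply: ltW; near: y; exact: lt_nbhsr.
  have := is_deriveX 2 (@is_derive_id R R x (1 : R)); move=> /is_derive_eq; apply.
  by rewrite /GRing.scale/= expr1 mulr1; ring.
- rewrite mulr0; apply: (@near_eq_is_derive _ _ _ (cst (0 : R))).
    near=> y; rewrite max_l ?expr0n//=; apply: ltW; near: y; exact: lt_nbhsl.
rewrite ?maxxx mulr0.
have small (e : R) : 0 < e -> \forall t \near (0 : R),
    `|(Num.max 0 (0 + t *: (1 : R)) ^+ 2 - 0) - (Num.max 0 0 ^+ 2 - 0)| <= e * `|t|.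
  move=> e0; near=> t; rewrite add0r [t *: 1]mulr1 maxxx expr0n/= !subr0.
  have te : `|t| <= e by apply: ltW; near: t; exact: (@nbhs0_lt R R e e0).
  have [t0|t0] := leP t 0; first by rewrite expr0n normr0 mulr_ge0// ltW.
  rewrite normrX expr2 ler_wpM2r//.
have d0 : derivable (fun y : R => Num.max 0 y ^+ 2) 0 1.
  apply: derivable_approx => e e0; exists (cst 0); first exact: derivable_cst.
  exact: small.
apply: DeriveDef => //; apply/eqP; rewrite -normr_le0; apply/ler_addgt0Pr => e e0; rewrite add0r.
apply: derive_lipschitz_le => //; apply: filterS (small e e0) => t.
by rewrite !subr0.
Unshelve. all: by end_near. Qed.

Lemma continuous_maxr0 : continuous (fun x : R => 2 * Num.max 0 x).
Proof.
move=> x; apply: cvgM; first exact: cvg_cst.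
have c1 : (fun=> (0 : R)) @ x --> (0 : R) by exact: cvg_cst.
exact: (continuous_max c1 (@cvg_id _ (nbhs x))).
Qed.

End PositivePartSquare.

Section WeakForm.
Variables (R : realType) (n : nat) (X : set 'rV[R]_n.-1).
Local Notation E := (R * 'rV[R]_n.-1)%type.
Variables (h : R -> R) (f u : E -> R).
Hypothesis n2 : (2 <= n)%N.
Hypothesis oX : open X.
Hypothesis hcont : continuous h.
Hypothesis cf : forall p, coneB X p -> {for p, continuous f}.
Hypothesis usol : viscosity_solution X h f u.
Local Notation B := (coneB X).
Implicit Types (psi chi s : E -> R) (p q : E) (K : set E).

Let oB : open B. Proof. exact: open_coneB. Qed.
Let a : R := (n%:R - 2) / 2.

(* The integrand of [dirichlet_form - weak_rhs] for a gradient [D] and [s = f - h u]. *)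
Definition weak_density (D : option 'I_n.-1 -> E -> R) s psi p : R :=
  p.1 ^- 2 * (\sum_i D i p * cone_derive i psi p) - (- s p + n%:R * p.1 ^- 2 * D None p) * psi p.

Let lift_source F p : R := p.1 ^- 2 * cone_lift a (fun z => laplacian F z - a ^+ 2 * F z) p.

Let C1_lift F : ispol F -> C1on B (cone_lift a F).
Proof.
move=> pF; apply: (@C1on_sub _ _ _ (@positive R n.-1)); first by move=> p; exact: coneB_gt0.
exact/Ck_C1on/Ck_cone_lift.
Qed.

Let lift_derive F p i : ispol F -> B p -> cone_derive i (cone_lift a F) p = cone_lift a (twist a i F) p.
Proof. by move=> pF Bp; apply: cone_derive_lift; [exact: (coneB_gt0 Bp)|exact: ispol_derivable]. Qed.

Let C1_lift_derive F i : ispol F -> C1on B (cone_derive i (cone_lift a F)).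
Proof.
move=> pF; apply: (@C1on_ext _ _ _ (cone_lift a (twist a i F))) => //.
  by move=> p Bp; rewrite lift_derive.
by apply: C1_lift; exact: ispol_twist.
Qed.

Let C1_inv2 : C1on B (fun p : E => p.1^-1 * p.1^-1).
Proof. by apply: C1on_mul => //; exact: C1on_fst_inv. Qed.

Let cone_derive_inv2 p i : B p -> cone_derive i (fun p : E => p.1^-1 * p.1^-1) p =
  if i is None then - 2 * p.1 ^- 2 else 0.
Proof.
move=> Bp; have p0 : p.1 != 0 by rewrite gt_eqF// (coneB_gt0 Bp).
have Ci := @C1on_fst_inv R n X; rewrite (cone_deriveM i Ci Ci Bp).
have -> : cone_derive i (fun q : E => q.1^-1) p = if i is None then - p.1^-1 else 0.
  have [dc dcE] := @is_derive_coord R n.-1 None p (ebase i).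
  rewrite /cone_derive (deriveV p0 dc) dcE; case: i dc dcE => [j|] _ _ /=.
    by rewrite scaler0.
  by rewrite /GRing.scale/= mulr1; field.
by case: i => [j|]; [rewrite mulr0 mul0r addr0|field].
Qed.

(** The density is the divergence of [t^-2 psi] times the cone gradient of [phi]. Differentiating
    [t^-2] contributes [- 2 t^-2 (t d/dt phi)], and [n = 2 a + 2] turns the coefficient [n - 2] of
    the operator into the [n] of the weak form. *)
Lemma lift_weak_identity F psi : ispol F -> C1c B psi ->
  mint X (weak_density (fun i => cone_derive i (cone_lift a F)) (lift_source F) psi) /\
  mellin_int B (weak_density (fun i => cone_derive i (cone_lift a F)) (lift_source F) psi) = 0%E.
Proof.
move=> pF Cp; set phi := cone_lift a F.
pose v i p : R := p.1^-1 * p.1^-1 * cone_derive i phi p.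
have Cv i : C1on B (v i) by apply: C1on_mul => //; exact: C1_lift_derive.
have Cvp i : C1c B (fun p => v i p * psi p) by exact: C1c_mul.
have wE p : B p -> weak_density (fun i => cone_derive i phi) (lift_source F) psi p =
    \sum_i cone_derive i (fun q => v i q * psi q) p.
  move=> Bp; have p0 := coneB_gt0 Bp.
  have vE i : cone_derive i (fun q => v i q * psi q) p =
      p.1 ^- 2 * (cone_derive i phi p * cone_derive i psi p) +
      (p.1 ^- 2 * cone_derive i (cone_derive i phi) p +
       (if i is None then - 2 * p.1 ^- 2 else 0) * cone_derive i phi p) * psi p.
    rewrite (cone_deriveM i (Cv i) Cp.1 Bp).
    rewrite (cone_deriveM i C1_inv2 (C1_lift_derive i pF) Bp).
    by rewrite cone_derive_inv2// /v -invfM -expr2; congr (_ + _); rewrite mulrA.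
  under eq_bigr do rewrite vE.
  rewrite big_split/= -mulr_sumr -mulr_suml big_split/= -mulr_sumr.
  rewrite [X in _ + (_ + X) * _](bigD1 None)//= [X in _ + (_ + (_ + X)) * _]big1 ?addr0; last first.
    by case=> [j|]// _; rewrite mul0r.
  rewrite /weak_density /lift_source -cone_operator_lift// -/phi.
  have -> : n%:R = 2 * a + 2 :> R by rewrite /a; field.
  by rewrite -[p.1 * 'D_(1, 0) phi p]/(cone_derive None phi p); ring.
have iv i : mint X (cone_derive i (fun q => v i q * psi q)).
  have [Cw [K [cK KB w0]]] := Cvp i.
  apply: (mint_continuous oX cK KB); first by move=> p Bp; exact: (cone_derive_continuous (i := i) Cw Bp).
  by move=> p _ Kp; exact: (cone_derive_off i cK w0 Kp).
split.
  apply: (mint_ext oX (k := fun p => \sum_i cone_derive i (fun q => v i q * psi q) p)); last exact: mint_sum.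
  by move=> p Bp; rewrite wE.
rewrite (eq_mellin wE) mellin_sum// big1// => i _; exact: mellin_ibp.
Qed.

Lemma solution_C1on : C1on B u.
Proof.
move=> p Bp; split.
- by case: usol => -[us _] [ls _]; exact: semicontinuous_continuous us ls p Bp.
- by move=> i; exact: (derivable_solution oX hcont cf usol).
- move=> i; have cD := continuous_cone_derive_solution oX hcont cf usol (i := i) Bp.
  case: i cD => [j|] cD; first exact: cD.
  apply: (@near_continuous _ _ (fun q => q.1^-1 * cone_derive None u q)).
    apply: (near_open oB Bp) => q Bq; rewrite /cone_derive mulrA mulVf ?mul1r// gt_eqF//.
    exact: (coneB_gt0 Bq).
  exact: (cvgM (continuous_fst_inv Bp) cD).
Qed.

Local Notation density := (weak_density (fun i => cone_derive i u) (flat_source h f u)).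

Let cdens_rhs p : B p -> {for p, continuous
   (fun q => - flat_source h f u q + n%:R * (q.1^-1 * q.1^-1) * cone_derive None u q)}.
Proof.
move=> Bp; have ci := continuous_fst_inv Bp.
have cs := flat_source_continuous oX hcont cf usol Bp.
have cD := cone_derive_continuous (i := None) solution_C1on Bp.
exact: (cvgD (cvgN cs) (cvgM (cvgM (cvg_cst _) (cvgM ci ci)) cD)).
Qed.

Lemma mint_density psi : C1c B psi -> mint X (density psi).
Proof.
move=> Cp; have iD i : mint X (fun p => p.1^-1 * p.1^-1 * cone_derive i u p * cone_derive i psi p).
  apply: (@mint_C1c_r _ _ _ oX (fun p => p.1^-1 * p.1^-1 * cone_derive i u p)) => // p Bp.
  have ci := continuous_fst_inv Bp.
  exact: (cvgM (cvgM ci ci) (cone_derive_continuous (i := i) solution_C1on Bp)).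
have ir := mint_C1c_l oX cdens_rhs Cp.
have i1 := mint_add oX (mint_sum oX (index_enum (option 'I_n.-1)) iD) (mint_scale oX (-1) ir).
apply: mint_ext i1 => // p Bp; rewrite /weak_density mulN1r -invfM -expr2; congr (_ - _).
by rewrite mulr_sumr; apply: eq_bigr => i _; rewrite mulrA.
Qed.

(* [u] is a limit in [C^1] of lifts of polynomials, for which the identity is
   integration by parts. *)
Lemma local_weak_identity p0 : B p0 -> exists r, [/\ 0 < r,
  forall p, 0 < p.1 -> sqdist (log_cone p) (log_cone p0) <= r ^+ 2 -> B p &
  forall psi, C1c B psi -> (forall p, B p -> r ^+ 2 < sqdist (log_cone p) (log_cone p0) -> psi p = 0) ->
  mellin_int B (density psi) = 0%E].
Proof.
move=> Bp0; have [r [r0 rB approx]] := cone_approx n2 oX hcont cf usol Bp0.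
exists r; split => // psi Cp psi0.
have id := mint_density Cp.
have [_ [K [cK KB pK]]] := Cp.
have [C C0 small] := mellin_small oX cK KB.
(* The density is affine in the gradient and the source, so errors of at most [d] in each change it
   by at most [d * beta]. *)
pose beta p := (p.1^-1 * p.1^-1) * (\sum_i `|cone_derive i psi p|) + (1 + n%:R * (p.1^-1 * p.1^-1)) * `|psi p|.
have cbeta p : B p -> {for p, continuous beta}.
  move=> Bp; have ci := continuous_fst_inv Bp.
  have c2 : {for p, continuous (fun q => q.1^-1 * q.1^-1)} by exact: (cvgM ci ci).
  have cp : {for p, continuous psi} by have [] := Cp.1 p Bp.
  have cs : {for p, continuous (fun q => \sum_i `|cone_derive i psi q|)}.
    rewrite /prop_for /continuous_at; elim: (index_enum _) => [|i s IH].
      by under eq_fun do rewrite big_nil; rewrite big_nil; exact: cvg_cst.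
    under eq_fun do rewrite big_cons; rewrite big_cons.
    exact: (cvgD (cvg_norm (cone_derive_continuous (i := i) Cp.1 Bp)) IH).
  have cn : {for p, continuous (fun q => `|psi q|)} by exact: (cvg_norm cp).
  have c3 : {for p, continuous (fun q => 1 + n%:R * (q.1^-1 * q.1^-1))}.
    by apply: cvgD; [exact: cvg_cst|apply: cvgM; [exact: cvg_cst|exact: c2]].
  have c4 : {for p, continuous (fun q => q.1^-1 * q.1^-1 * (\sum_i `|cone_derive i psi q|))} by exact: (cvgM c2 cs).
  have c5 : {for p, continuous (fun q => (1 + n%:R * (q.1^-1 * q.1^-1)) * `|psi q|)} by exact: (cvgM c3 cn).
  exact: (cvgD c4 c5).
have [b b0 betab] := compact_bounded_continuous cK KB cbeta.
have fM := mint_fin oX id.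
apply/eqP; rewrite -(fineK fM) eqe -normr_le0; apply/ler_addgt0Pr => e e0; rewrite add0r.
pose d := e / (C * (b + 1)).
have b1 : 0 < b + 1 by rewrite ltr_wpDl.
have Cb : 0 < C * (b + 1) by rewrite mulr_gt0.
have d0 : 0 < d by rewrite divr_gt0.
have [F pF FU] := approx d d0.
have [il Ml] := lift_weak_identity pF Cp.
pose diff p := density psi p + (-1) * weak_density (fun i => cone_derive i (cone_lift a F)) (lift_source F) psi p.
have idiff : mint X diff by apply: mint_add => //; exact: mint_scale.
have Mdiff : mellin_int B diff = mellin_int B (density psi).
  rewrite /diff mellin_add//; last exact: mint_scale.
  by rewrite mellin_scale// Ml mule0 adde0.
(* The outside of the closed disk is open, so the derivatives of [psi] vanish there too; on the
   closed disk itself the approximation holds. *)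
have psiD p i : B p -> r ^+ 2 < sqdist (log_cone p) (log_cone p0) -> cone_derive i psi p = 0.
  move=> Bp rp; have n0 : \forall q \near p, psi q = cst 0 q.
    have cs : {for p, continuous (fun q => sqdist (log_cone q) (log_cone p0))}.
      apply: (@cvg_comp _ _ _ log_cone (sqdist^~ (log_cone p0))); last exact: sqdist_continuous.
      exact: continuous_log_cone (coneB_gt0 Bp).
    have nr : \forall q \near p, r ^+ 2 < sqdist (log_cone q) (log_cone p0) by exact: (cvgr_gt _ cs _ rp).
    have nB : \forall q \near p, B q by exact: (open_nbhs_nbhs (conj oB Bp)).
    by apply: filterS2 nB nr => q; exact: psi0.
  rewrite (near_cone_derive i n0) /cone_derive derive_cst.
  by case: i => [j|]//; rewrite mulr0.
have db0 : 0 <= d * b := mulr_ge0 (ltW d0) b0.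
have diffb p : K p -> `|diff p| <= d * b.
  move=> Kp; have Bp := KB p Kp; have p1 := coneB_gt0 Bp.
  have [pr|pr] := leP (sqdist (log_cone p) (log_cone p0)) (r ^+ 2); last first.
    rewrite /diff /weak_density (psi0 p Bp pr) !mulr0 !subr0.
    rewrite !big1 ?mulr0 ?addr0 ?normr0 ?db0//.
    - by move=> i _; rewrite psiD// mulr0.
    - by move=> i _; rewrite psiD// mulr0.
  have [_ F2 F3] := FU p p1 pr.
  apply: (@le_trans _ _ (d * beta p)); last first.
    by rewrite ler_wpM2l ?(ltW d0)//; apply: le_trans (betab p Kp); exact: ler_norm.
  have p2 : 0 <= p.1 ^- 2 by rewrite invr_ge0 sqr_ge0.
  have -> : diff p = p.1 ^- 2 * (\sum_i (cone_derive i u p - cone_derive i (cone_lift a F) p) * cone_derive i psi p)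
      + ((flat_source h f u p - lift_source F p) -
         n%:R * p.1 ^- 2 * (cone_derive None u p - cone_derive None (cone_lift a F) p)) * psi p.
    rewrite /diff /weak_density.
    under [X in _ = _ * X + _]eq_bigr do rewrite mulrBl.
    by rewrite sumrB; ring.
  rewrite /beta [leRHS]mulrDr; apply: le_trans (ler_normD _ _) _; rewrite -invfM -expr2; apply: lerD.
    rewrite normrM ger0_norm// mulrCA ler_wpM2l// mulr_sumr.
    apply: le_trans (ler_norm_sum _ _ _) _; apply: ler_sum => i _.
    by rewrite normrM ler_wpM2r// F3.
  rewrite normrM mulrA ler_wpM2r//; apply: le_trans (ler_normB _ _) _.
  rewrite [leRHS]mulrDr mulr1; apply: lerD; first exact: F2.
  rewrite normrM ger0_norm ?mulr_ge0// mulrC ler_wpM2r ?mulr_ge0//; exact: F3.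
have diff0 p : B p -> ~ K p -> diff p = 0.
  move=> Bp Kp; rewrite /diff /weak_density (pK p Kp) !mulr0 !subr0.
  by rewrite !big1 ?mulr0 ?addr0// => i _; rewrite (cone_derive_off i cK pK Kp) mulr0.
have := small diff (d * b) db0 idiff diffb diff0.
rewrite Mdiff -{1}(fineK fM) lee_fin => /le_trans; apply.
rewrite [leRHS](_ : _ = C * (d * (b + 1))); last by rewrite /d; field; rewrite !gt_eqF.
by rewrite ler_wpM2l ?(ltW C0)// ler_wpM2l ?(ltW d0)// lerDl.
Qed.

End WeakForm.

(** * Partition of unity *)

Section PartitionOfUnity.
Variables (R : realType) (n : nat) (X : set 'rV[R]_n.-1).
Local Notation E := (R * 'rV[R]_n.-1)%type.
Hypothesis oX : open X.
Local Notation B := (coneB X).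
Implicit Types (psi s : E -> R) (p q z : E) (r : R).

Let oB : open B. Proof. exact: open_coneB. Qed.

Lemma weak_density_sum (D : option 'I_n.-1 -> E -> R) s psi (J : Type) (l : seq J) (chi : J -> E -> R) p :
  (forall j, C1on B (chi j)) -> (forall q, B q -> psi q = \sum_(j <- l) chi j q) -> B p ->
  weak_density D s psi p = \sum_(j <- l) weak_density D s (chi j) p.
Proof.
move=> Cchi psiE Bp.
have DE i : cone_derive i psi p = \sum_(j <- l) cone_derive i (chi j) p.
  rewrite (near_cone_derive i (near_open oB Bp psiE)) /cone_derive.
  have dE j : is_derive p (ebase i) (chi j) ('D_(ebase i) (chi j) p).
    by have [_ d _] := Cchi j p Bp; exact: DeriveDef.
  have [_ ->] := is_derive_bigsum l xpredT dE.
  by case: i dE => [k|] _//; rewrite mulr_sumr.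
rewrite /weak_density psiE//.
under eq_bigr do rewrite DE mulr_sumr.
by rewrite exchange_big mulr_sumr mulr_sumr -sumrB.
Qed.

Definition cone_bump r z p : R := Num.max 0 (r ^+ 2 - sqdist (log_cone p) (log_cone z)) ^+ 2.

Lemma C1on_cone_bump r z : C1on B (cone_bump r z).
Proof.
apply: (C1on_comp (f := fun p => r ^+ 2 - sqdist (log_cone p) (log_cone z)) oB
  (@is_derive_maxr_sqr R) (@continuous_maxr0 R)).
apply: (@C1on_sub _ _ _ (@positive R n.-1)); first by move=> p; exact: coneB_gt0.
apply: Ck_C1on; apply: (@Ck_pol_log _ _ (fun w => r ^+ 2 - sqdist w (log_cone z))).
by apply: ispol_sub; [exact: ispol_cst|exists 3%N; exact: pol_sqdist].
Qed.

Lemma cone_bump_ge0 r z p : 0 <= cone_bump r z p.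
Proof. exact: sqr_ge0. Qed.

Definition log_disk r z : set E := [set p | 0 < p.1 /\ sqdist (log_cone p) (log_cone z) < r ^+ 2].

Lemma cone_bump_gt0 r z p : log_disk r z p -> 0 < cone_bump r z p.
Proof. by move=> [_ pr]; rewrite exprn_gt0// lt_max subr_gt0 pr orbT. Qed.

Lemma cone_bump_out r z p : r ^+ 2 < sqdist (log_cone p) (log_cone z) -> cone_bump r z p = 0.
Proof. by move=> pr; rewrite /cone_bump max_l ?expr0n// subr_le0 ltW. Qed.

Lemma open_log_disk r z : open (log_disk r z).
Proof.
rewrite openE => p [p0 pr].
have cs : {for p, continuous (fun q => sqdist (log_cone q) (log_cone z))}.
  apply: (@cvg_comp _ _ _ log_cone (sqdist^~ (log_cone z))); last exact: sqdist_continuous.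
  exact: continuous_log_cone p0.
have nr : \forall q \near p, sqdist (log_cone q) (log_cone z) < r ^+ 2 by exact: (cvgr_lt _ cs _ pr).
have n0 : \forall q \near p, positive q by exact: (open_nbhs_nbhs (conj (@open_positive R n.-1) p0)).
by apply: filterS2 n0 nr => q.
Qed.

(** Finitely many log-disks cover the support, [S] is the sum of their bumps, and [psi] is cut into
    the products of each bump with [psi / S]. [S] may vanish off the support, so [psi / S] is C^1
    for two reasons: as a quotient where [S > 0], and as the zero function off the support. *)
Lemma C1c_partition psi (r : E -> R) : (forall z, B z -> 0 < r z) -> C1c B psi ->
  exists (l : seq E) (chi : E -> E -> R),
  [/\ forall z, z \in l -> B z, forall z, C1c B (chi z),
      forall p, B p -> psi p = \sum_(z <- l) chi z p &
      forall z p, r z ^+ 2 < sqdist (log_cone p) (log_cone z) -> chi z p = 0].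
Proof.
move=> r0 [Cp [K [cK KB p0]]].
pose T : ptopologicalType := HB.pack E (isPointed.Build E (0 : E)).
have cov : @cover_compact T K.
  by have e := congr1 (@^~ K) (@compact_cover T); rewrite -[cover_compact _]e.
have [||l lB Kl] := cov _ B (fun z => log_disk (r z) z).
- by move=> z _; exact: open_log_disk.
- move=> p Kp; exists p; first exact: KB.
  by split; [exact: coneB_gt0 (KB p Kp)|rewrite sqdistxx exprn_gt0// r0//; exact: KB].
pose S p := \sum_(z <- finmap.enum_fset l) cone_bump (r z) z p.
have S0 p : K p -> 0 < S p.
  move=> /Kl[z /= zl zp]; rewrite /S (big_rem z)//=.
  by rewrite ltr_pwDl ?cone_bump_gt0// sumr_ge0// => j _; exact: cone_bump_ge0.
have CS : C1on B S by apply: C1on_sum => // z; exact: C1on_cone_bump.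
pose W := [set p | B p /\ 0 < S p].
have oW : open W.
  rewrite openE => p [Bp Sp].
  have cS : {for p, continuous S} by have [] := CS p Bp.
  have n1 : \forall q \near p, 0 < S q by exact: (cvgr_gt _ cS _ Sp).
  have n2 : \forall q \near p, B q by exact: (open_nbhs_nbhs (conj oB Bp)).
  exact: filterS2 n2 n1.
pose psi' p := (S p)^-1 * psi p.
have Cp' : C1c B psi'.
  split; last by exists K; split=> // p /p0; rewrite /psi' => ->; rewrite mulr0.
  move=> p Bp; have [Kp|Kp] := pselect (K p).
    have WB : W `<=` B by move=> q [].
    have CW : C1on W psi'.
      apply: C1on_mul => //; last exact: (C1on_sub WB).
      by apply: C1on_inv => //; [move=> q [_ /gt_eqF ->]|exact: (C1on_sub WB)].
    by apply: CW; split=> //; exact: S0.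
  have oK : open (~` K) by rewrite openC; exact: closed_compact.
  have CK : C1on (~` K) psi'.
    apply: (C1on_ext (f := fun=> 0) oK); last exact: C1on_cst.
    by move=> q /p0; rewrite /psi' => ->; rewrite mulr0.
  exact: CK.
exists (finmap.enum_fset l), (fun z p => cone_bump (r z) z p * psi' p); split.
- by move=> z /lB; rewrite inE.
- by move=> z; apply: C1c_mul => //; exact: C1on_cone_bump.
- move=> p Bp; rewrite -mulr_suml -/(S p) /psi'; have [Kp|Kp] := pselect (K p).
    by rewrite mulrA mulfV ?mul1r// gt_eqF// S0.
  by rewrite p0// !mulr0.
- by move=> z p zp; rewrite cone_bump_out// mul0r.
Qed.

End PartitionOfUnity.

Section GlobalWeakForm.
Variables (R : realType) (n : nat) (X : set 'rV[R]_n.-1).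
Local Notation E := (R * 'rV[R]_n.-1)%type.
Variables (h : R -> R) (f u : E -> R).
Hypothesis n2 : (2 <= n)%N.
Hypothesis oX : open X.
Hypothesis hcont : continuous h.
Hypothesis cf : forall p, coneB X p -> {for p, continuous f}.
Hypothesis usol : viscosity_solution X h f u.
Local Notation B := (coneB X).
Implicit Types (psi s : E -> R) (p q z : E) (r : R).

Lemma weak_identity psi : C1c B psi ->
  mellin_int B (weak_density (fun i => cone_derive i u) (flat_source h f u) psi) = 0%E.
Proof.
move=> Cp; set dens := weak_density _ _.
have /choice[r rE] : forall z, exists r, B z -> 0 < r /\
    forall chi, C1c B chi -> (forall p, B p -> r ^+ 2 < sqdist (log_cone p) (log_cone z) -> chi p = 0) ->
    mellin_int B (dens chi) = 0%E.
  move=> z; have [Bz|] := pselect (B z); last by exists 0.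
  by have [r [r0 _ rE]] := local_weak_identity n2 oX hcont cf usol Bz; exists r.
have [|l [chi [lB Cchi psiE chi0]]] := C1c_partition oX _ Cp (r := r).
  by move=> z /rE[].
have dE p : B p -> dens psi p = \sum_(z <- l) dens (chi z) p.
  by apply: weak_density_sum => // z; exact: (Cchi z).1.
rewrite (eq_mellin dE) mellin_sum//; last first.
  by move=> z; exact: mint_density.
rewrite big_seq big1// => z zl; have [_] := rE z (lB z zl); apply => // p _.
exact: chi0.
Qed.

End GlobalWeakForm.

Section WeakSolution.
Variables (R : realType) (n : nat) (X : set 'rV[R]_n.-1).
Local Notation E := (R * 'rV[R]_n.-1)%type.
Variables (h : R -> R) (f u : E -> R).
Hypothesis n2 : (2 <= n)%N.
Hypothesis oX : open X.
Hypothesis hcont : continuous h.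
Hypothesis cf : forall p, coneB X p -> {for p, continuous f}.
Hypothesis usol : viscosity_solution X h f u.
Local Notation B := (coneB X).
Local Notation s := (flat_source h f u).
Implicit Types (psi chi : E -> R) (p q z : E) (D G : option 'I_n.-1 -> E -> R).

Let Cu : C1on B u. Proof. exact: solution_C1on usol. Qed.

Let Cinv k : Ck k (@positive R n.-1) (fun p => p.1^-1).
Proof. exact: Ck_pow_inv. Qed.

Lemma test_inv2 psi : test_fun X psi -> test_fun X (fun p => p.1^-1 * (p.1^-1 * psi p)).
Proof. by move=> tp; do 2 apply: test_mul => //. Qed.

Lemma L1loc_test_mint g psi : L1loc X g -> test_fun X psi -> mint X (fun p => g p * psi p).
Proof.
move=> Lg tp; have [C1 [K [cK KB p0]]] := test_C1c tp.
by apply: (mint_L1loc oX Lg cK KB) => // p Bp; have [] := C1 p Bp.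
Qed.

(** The weight [t^-2] is moved onto the test function, so that only pairings of a single [D i] with
    a test function remain; these are what a weak derivative determines. *)
Lemma weak_pairing D psi : (forall i, L1loc X (D i)) -> test_fun X psi ->
  let chi i p := p.1^-1 * (p.1^-1 * cone_derive i psi p) in
  let chi0 p := p.1^-1 * (p.1^-1 * psi p) in
  [/\ mint X (fun p => p.1 ^- 2 * (\sum_i D i p * cone_derive i psi p)),
      mint X (fun p => (- s p + n%:R * p.1 ^- 2 * D None p) * psi p),
     (mellin_int B (fun p => (p.1 ^- 2 * (\sum_i D i p * cone_derive i psi p))%R) =
      \sum_i mellin_int B (fun p => (D i p * chi i p)%R))%E &
     (mellin_int B (fun p => ((- s p + n%:R * p.1 ^- 2 * D None p) * psi p)%R) =
      mellin_int B (fun p => (- s p * psi p)%R) + n%:R%:E * mellin_int B (fun p => (D None p * chi0 p)%R))%E].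
Proof.
move=> LD tp chi chi0.
have i1 i : mint X (fun p => D i p * chi i p).
  by apply: L1loc_test_mint => //; apply: test_inv2; exact: test_cone_derive.
have i2 : mint X (fun p => D None p * chi0 p) by apply: L1loc_test_mint => //; exact: test_inv2.
have i3 : mint X (fun p => - s p * psi p).
  apply: mint_C1c_l (test_C1c tp) => // p Bp; apply: cvgN.
  exact: (flat_source_continuous oX hcont cf usol Bp).
have E1 p : B p -> \sum_i D i p * chi i p = p.1 ^- 2 * (\sum_i D i p * cone_derive i psi p).
  by move=> _; rewrite mulr_sumr; apply: eq_bigr => i _; rewrite /chi mulrA -invfM -expr2 mulrCA.
have E2 p : B p -> - s p * psi p + n%:R * (D None p * chi0 p) = (- s p + n%:R * p.1 ^- 2 * D None p) * psi p.
  by move=> _; rewrite /chi0 expr2 invfM; ring.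
split.
- by apply: (mint_ext oX E1); exact: mint_sum.
- by apply: (mint_ext oX E2); apply: mint_add => //; exact: mint_scale.
- by rewrite -(eq_mellin E1) mellin_sum.
- by rewrite -(eq_mellin E2) mellin_add ?mellin_scale//; exact: mint_scale.
Qed.

(* A weak gradient and the classical one pair alike with the test functions
   [t^-2 cone_derive i psi] and [t^-2 psi]. *)
Lemma weak_form gt gx psi : weak_grad X u gt gx -> test_fun X psi ->
  dirichlet_form X gt gx psi = weak_rhs X h f u gt psi.
Proof.
move=> [wt wx] tp; pose G (i : option 'I_n.-1) := if i is Some j then gx j else gt.
pose Du i := cone_derive i u.
have wG i : weak_deriv X (cone_derive i) u (G i) by case: i => [j|]; [exact: wx|exact: wt].
have wD i : weak_deriv X (cone_derive i) u (Du i) by exact: C1on_weak_deriv.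
have LG i : L1loc X (G i) by have [] := wG i.
have LD i : L1loc X (Du i) by have [] := wD i.
have GD i chi : test_fun X chi -> mellin_int B (fun p => G i p * chi p) = mellin_int B (fun p => Du i p * chi p).
  by move=> tc; have [_ _ ->//] := wG i; have [_ _ ->//] := wD i.
have [G1 G2 G3 G4] := weak_pairing LG tp.
have [D1 D2 D3 D4] := weak_pairing LD tp.
have -> : dirichlet_form X gt gx psi = mellin_int B (fun p => p.1 ^- 2 * (\sum_i G i p * cone_derive i psi p)).
  apply: eq_mellin => p _; congr (_ * _); rewrite [RHS](bigD1 None)//=; congr (_ + _).
  rewrite [RHS](reindex_omap Some id)/=; last by case.
  by apply: eq_big => [i|i _]//; rewrite eqxx.
have -> : weak_rhs X h f u gt psi = mellin_int B (fun p => (- s p + n%:R * p.1 ^- 2 * G None p) * psi p).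
  by apply: eq_mellin => p _; rewrite /flat_source opprB [h _ - _]addrC.
rewrite G3 G4 GD; last exact: test_inv2.
rewrite (eq_bigr _ (fun i _ => GD i _ (test_inv2 (test_cone_derive i tp)))).
rewrite -D3 -D4.
pose a p := p.1 ^- 2 * (\sum_i Du i p * cone_derive i psi p).
pose b p := (- s p + n%:R * p.1 ^- 2 * Du None p) * psi p.
have : mellin_int B (fun p => a p + (-1) * b p) = 0%E.
  rewrite -[RHS](weak_identity n2 oX hcont cf usol (test_C1c tp)).
  by apply: eq_mellin => p _; rewrite mulN1r.
rewrite mellin_add//; last exact: mint_scale.
rewrite mellin_scale// -(fineK (mint_fin oX D1)) -(fineK (mint_fin oX D2)).
by move=> /(congr1 fine)/= /eqP; rewrite mulN1r subr_eq0 => /eqP ->.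
Qed.

End WeakSolution.

(** * Weighted bounds *)

Section DistanceToBoundary.
Variables (R : realType) (m : nat).
Implicit Types (X : set 'rV[R]_m) (x y : 'rV[R]_m) (r : R).

Lemma enorm_le x r : 0 <= r -> (forall i, `|x ord0 i| <= r) -> enorm x <= m.+1%:R * r.
Proof.
move=> r0 xr; have mr0 : 0 <= m.+1%:R * r by rewrite mulr_ge0.
rewrite -[leRHS](ger0_norm mr0) -sqrtr_sqr ler_wsqrtr//.
apply: (@le_trans _ _ (\sum_(i < m) r ^+ 2)).
  by apply: ler_sum => i _; rewrite -real_normK ?num_real// ler_pXn2r ?nnegrE.
rewrite sumr_const card_ord exprMn -[leLHS]mulr_natl ler_wpM2r ?sqr_ge0//.
by rewrite -natrX ler_nat; nia.
Qed.

Lemma bdist_ge0 X x : 0 <= bdist X x.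
Proof.
rewrite /bdist; set S := [set _ | _ in _].
have [S0|S0] := pselect (S !=set0).
  by apply: lb_le_inf => // _ [y _ <-]; exact: sqrtr_ge0.
(* Without boundary points the infimum takes its default value 0. *)
by rewrite inf_out// => -[].
Qed.

Lemma bdist_le X x y : boundary X y -> bdist X x <= enorm (x - y).
Proof.
move=> Xy; apply: ge_inf; last by exists y.
by exists 0 => _ [z _ <-]; exact: sqrtr_ge0.
Qed.

(* The segment from [x] to a point outside [X] meets the boundary. *)
Lemma bdist_cube X x y r : open X -> X x -> 0 <= r -> (forall i, `|y ord0 i - x ord0 i| <= r) ->
  m.+1%:R * r < bdist X x -> X y.
Proof.
move=> oX Xx r0 yr rd; pose g (t : R) := x + t *: (y - x).
have cg : continuous g by move=> t; apply: cvgD; [exact: cvg_cst|exact: cvgZl].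
have gn t : `[0, 1]%classic t -> ~ boundary X (g t).
  rewrite /= in_itv/= => /andP[t0 t1] /(bdist_le x); apply/negP; rewrite -ltNge.
  apply: le_lt_trans rd; apply: enorm_le => // i.
  rewrite !mxE opprD addrA subrr add0r normrN normrM ger0_norm//.
  by rewrite -[leRHS]mul1r ler_pM.
(* As the segment avoids the boundary, the preimages of [X] and of its closure coincide on it; this
   set is open, closed and non-empty in a connected interval. *)
have /seteqP[_ sub] : `[0, 1]%classic `&` g @^-1` X = `[0, 1]%classic.
  apply: segment_connected.
  - by exists 0; split; rewrite /= ?in_itv/= ?lexx ?ler01// /g scale0r addr0.
  - by exists (g @^-1` X) => //; apply: open_comp => // t _; exact: cg.
  - exists (g @^-1` closure X).
      by apply: preimage_closed; [move=> t _; exact: cg|exact: closed_closure].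
    apply/seteqP; split => t [t01 Xt]; split => //; first exact: subset_closure.
    apply: contrapT => nX; apply: (gn t t01); split=> //.
    by move/interior_subset.
have [] := sub 1; first by rewrite /= in_itv/= ler01 lexx.
by rewrite /g/= scale1r addrC subrK.
Qed.

Lemma bounded_coord X : bounded_set X -> exists2 M, 0 < M & forall x i, X x -> `|x ord0 i| <= M.
Proof.
move=> /pinfty_ex_gt0[M M0 XM]; exists M => // x i Xx; apply: le_trans (XM x Xx).
rewrite /Num.norm/= mx_normrE.
by have := le_bigmax 0 (fun ij : 'I_1 * 'I_m => `|x ij.1 ij.2|) (ord0, i).
Qed.

Lemma bdist_bounded X : bounded_set X -> exists2 D, 0 < D & forall x, X x -> bdist X x <= D.
Proof.
move=> /bounded_coord[M M0 XM].
exists (m.+1%:R * (2 * M)); first by rewrite !mulr_gt0.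
move=> x Xx; have [[y By]|nB] := pselect (exists y, boundary X y); last first.
  rewrite /bdist inf_out ?mulr_ge0 ?(ltW M0)// => -[[_ [y By _]] _].
  by apply: nB; exists y.
apply: le_trans (bdist_le x By) _; apply: enorm_le; first by rewrite mulr_ge0// ltW.
move=> i; rewrite !mxE; apply: le_trans (ler_normB _ _) _.
have yM : `|y ord0 i| <= M.
  have cl : closed [set z : 'rV[R]_m | `|z ord0 i| <= M].
    apply: (@preimage_closed _ _ (fun z : 'rV[R]_m => `|z ord0 i|) [set t | t <= M]); last exact: closed_le.
    move=> z _; have cz : v ord0 i @[v --> z] --> z ord0 i by exact: coord_continuous.
    exact: (cvg_norm cz).
  have [clX _] := By; have := @closureS _ X _ (fun z Xz => XM z i Xz) _ clX.
  by rewrite -(closure_id _).1.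
by have := XM x i Xx; lra.
Qed.

End DistanceToBoundary.

Section NonnegativeIntegral.
Context d (T : measurableType d) (R : realType) (mu : {measure set T -> \bar R}).

(* Unlike [ge0_le_integral], no measurability is assumed; here [f] involves [bdist]. *)
Lemma ge0_integral_mono (D : set T) (f g : T -> \bar R) :
  (forall x, D x -> (0 <= f x)%E) -> (forall x, D x -> (f x <= g x)%E) ->
  (\int[mu]_(x in D) f x <= \int[mu]_(x in D) g x)%E.
Proof.
move=> f0 fg; have g0 x : D x -> (0 <= g x)%E by move=> Dx; apply: le_trans (f0 x Dx) (fg x Dx).
rewrite !ge0_integralE//; apply: ereal_sup_le => _ [k /= kf <-]; exists k => // x.
by apply: le_trans (kf x) _; exact: lee_restrict.
Qed.

End NonnegativeIntegral.

Section WeightedNorm.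
Variables (R : realType) (n : nat) (X : set 'rV[R]_n.-1).
Local Notation E := (R * 'rV[R]_n.-1)%type.
Hypothesis oX : open X.
Hypothesis bX : bounded_set X.
Local Notation B := (coneB X).
Implicit Types (v : E -> R) (p : E).

Lemma leb_coneB : (leb R n B < +oo)%E.
Proof.
have [M M0 XM] := bounded_coord bX.
have M1 : 0 < M + 1 by rewrite ltr_wpDr.
apply: (@le_lt_trans _ _ (leb R n (open_cube (M + 1) 0))); last by rewrite open_cube_leb// ltry.
apply: le_measure; rewrite ?inE; [exact: measurable_open (open_coneB oX)|exact: measurable_open_cube|].
move=> p [/= + Xp]; rewrite in_itv/= => /andP[p0 p1] [j|] /=.
  by rewrite mxE subr0; have := XM _ j Xp; lra.
by rewrite subr0 ger0_norm ?ltW//; lra.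
Qed.

(** The weight has exponent 1 for this [gamma], so the integrand is
    [(t (1 - t) d |v|)^2 / t <= t C^2]: the factor [t] of the weight absorbs the singular density,
    and [coneB X] has finite measure. *)
Lemma wL_bounded v C : (forall p, B p -> {for p, continuous v}) ->
  (forall p, B p -> (1 - p.1) * bdist X p.2 * `|v p| <= C) -> wL X ((n%:R - 2) / 2) 2 v.
Proof.
move=> cv vC; split; first exact: measurable_fun_continuous (open_coneB oX) cv.
apply: poweR_lty.
have mB : measurable (B : set (measurableTypeR R * 'rV[R]_n.-1)).
  exact: measurable_open (open_coneB oX).
apply: (@le_lt_trans _ _ (\int[leb R n]_(p in B) (cst (C ^+ 2)%:E p))%E); last first.
  rewrite integral_cst// lte_mul_pinfty ?lee_fin ?sqr_ge0//; exact: leb_coneB.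
rewrite (_ : n%:R / 2 - _ = 1 :> R); last by field.
have w0 p : B p -> 0 <= p.1 * (1 - p.1) * bdist X p.2.
  move=> [/= + _]; rewrite in_itv/= => /andP[/ltW p0 /ltW p1].
  by rewrite !mulr_ge0 ?bdist_ge0// subr_ge0.
apply: ge0_integral_mono => p Bp.
  by rewrite lee_fin divr_ge0 ?powR_ge0// ltW// (coneB_gt0 Bp).
have p0 := coneB_gt0 Bp; have p1 : p.1 <= 1.
  by move: Bp => [/= + _]; rewrite in_itv/= => /andP[_ /ltW].
rewrite lee_fin powR_mulrn ?normr_ge0// /weight powRr1 ?w0// ler_pdivrMr//.
set c := (1 - p.1) * bdist X p.2 * `|v p|.
have c0 : 0 <= c by rewrite !mulr_ge0 ?bdist_ge0// subr_ge0.
have cC : c ^+ 2 <= C ^+ 2 by rewrite ler_pXn2r ?nnegrE ?vC// (le_trans c0)// vC.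
rewrite normrM (ger0_norm (w0 p Bp)) (_ : _ * `|v p| = p.1 * c); last by rewrite /c !mulrA.
rewrite exprMn mulrC; apply: ler_pM => //; rewrite ?sqr_ge0//.
by rewrite expr2 ler_piMl// ltW.
Qed.

End WeightedNorm.

Section WeightedGradient.
Variables (R : realType) (n : nat) (X : set 'rV[R]_n.-1).
Local Notation E := (R * 'rV[R]_n.-1)%type.
Variables (h : R -> R) (f u : E -> R).
Hypothesis n2 : (2 <= n)%N.
Hypothesis oX : open X.
Hypothesis bX : bounded_set X.
Hypothesis hcont : continuous h.
Hypothesis cf : forall p, coneB X p -> {for p, continuous f}.
Hypothesis usol : viscosity_solution X h f u.
Local Notation B := (coneB X).

Lemma weighted_gradient_bound M N : 0 <= M -> 0 <= N ->
  (forall p, B p -> `|u p| <= M) -> (forall p, B p -> `|flat_source h f u p| <= N) ->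
  exists C, forall i p, B p -> (1 - p.1) * bdist X p.2 * `|cone_derive i u p| <= C.
Proof.
move=> M0 N0 uM fN.
have [K K0 gK] := cone_gradient_bound n2 oX hcont cf usol M0 N0 uM fN.
have [D0 D00 XD] := bdist_bounded bX.
pose m1 : R := n.-1.+1%:R; have m10 : 0 < m1 by rewrite ltr0n.
(* Makes both [b / D] and [m1 / D] at most 1/2, so that [r = (1 - t) b / D] satisfies
   [r <= (1 - t) / 2 < - ln t] and [m1 * r < b]: the cube then leaves the domain neither through
   [t = 1] nor through the boundary of [X]. *)
pose D := 2 * (D0 + m1); have Dgt0 : 0 < D by rewrite mulr_gt0// addr_gt0.
exists (K * D) => i p Bp.
have p0 := coneB_gt0 Bp; have p1 : 0 < 1 - p.1.
  by rewrite subr_gt0; move: Bp => [/= + _]; rewrite in_itv/= => /andP[].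
have Xp : X p.2 by case: Bp.
have := bdist_ge0 X p.2; rewrite le_eqVlt => /orP[/eqP <-|b0].
  by rewrite mulr0 mul0r mulr_ge0// ltW.
set b := bdist X p.2 in b0 *.
have bD : b / D <= 2^-1.
  by rewrite ler_pdivrMr// mulrA mulVf// mul1r; have := XD _ Xp; rewrite -/b; lra.
have mD : m1 / D <= 2^-1 by rewrite ler_pdivrMr// mulrA mulVf// mul1r lerDr ltW.
pose r := (1 - p.1) * (b / D); have r0 : 0 < r by rewrite mulr_gt0// divr_gt0.
have r2 : r <= (1 - p.1) / 2 by rewrite ler_pM2l.
have sub : cube r (log_cone p) `<=` log_domain X.
  move=> w wr; split.
    have h1 : ln p.1 <= p.1 - 1.
      have : ln (1 + (p.1 - 1)) <= p.1 - 1 by apply: le_ln1Dx; rewrite ltrBrDr addNr.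
      by rewrite addrCA subrr addr0.
    by have := wr None; rewrite /= ler_norml => /andP[_]; lra.
  apply: (bdist_cube (r := r) oX Xp (ltW r0)); first by move=> j; exact: (wr (Some j)).
  rewrite -/m1 -/b (_ : m1 * r = (1 - p.1) * (m1 / D) * b); last by rewrite /r; field; rewrite gt_eqF.
  rewrite -[ltRHS]mul1r ltr_pM2r//; apply: (@le_lt_trans _ _ (1 * 2^-1)).
    by apply: ler_pM => //; [exact: ltW|rewrite divr_ge0// ltW|rewrite gerBl ltW].
  by rewrite mul1r invf_lt1// ltr1n.
have r1 : r <= 1 by apply: le_trans r2 _; lra.
have := gK p r i Bp r0 r1 sub; rewrite ler_pdivlMr// => h1.
rewrite (_ : _ * `|_| = (`|cone_derive i u p| * r) * D); last by rewrite /r; field; rewrite gt_eqF.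
by rewrite ler_pM2r.
Qed.

Lemma solution_H1 : Linfty X f -> Linfty X u -> {homo h : a b /~ a <= b} -> H1 X ((n%:R - 2) / 2) u.
Proof.
move=> bf bu hmono.
have Cu := solution_C1on oX hcont cf usol.
have cu p : B p -> {for p, continuous u} by move=> Bp; have [] := Cu p Bp.
have [M M0 uM] := Linfty_bounded oX cu bu.
have [N N0 fN] := Linfty_bounded oX cf bf.
(* Monotonicity traps [h(u)] between [h M] and [h (- M)]. *)
have hM p : B p -> `|h (u p)| <= `|h M| + `|h (- M)|.
  move=> Bp; have := uM p Bp; rewrite ler_norml => /andP[/hmono h1 /hmono h2].
  rewrite ler_norml; have := ler_norm (h (- M)); have := lerNnormlW (lexx `|h M|).
  have := normr_ge0 (h M); have := normr_ge0 (h (- M)); lra.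
have sN p : B p -> `|flat_source h f u p| <= N + (`|h M| + `|h (- M)|).
  by move=> Bp; apply: le_trans (ler_normB _ _) _; rewrite lerD ?fN ?hM.
have [C gC] := weighted_gradient_bound M0 (addr_ge0 N0 (addr_ge0 (normr_ge0 _) (normr_ge0 _))) uM sN.
have wg i : wL X ((n%:R - 2) / 2) 2 (cone_derive i u).
  by apply: (wL_bounded oX bX (C := C)) => // p Bp; [exact: (cone_derive_continuous Cu Bp)|exact: gC].
split.
  have [D D0 XD] := bdist_bounded bX.
  apply: (wL_bounded oX bX (C := D * M)) => // p Bp.
  have [p01 Xp] : 0 <= 1 - p.1 <= 1 /\ X p.2.
    move: Bp => [/= + Xp]; rewrite in_itv/= => /andP[/ltW p0 /ltW p1]; split => //.
    by rewrite subr_ge0 p1 gerBl.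
  have /andP[p0 p1] := p01.
  apply: ler_pM => //; [by rewrite mulr_ge0// bdist_ge0|by rewrite -[leRHS]mul1r ler_pM// ?bdist_ge0// XD|exact: uM].
exists (tdt u), (fun i => dx i u); split; last 2 first.
- exact: (wg None).
- by move=> i; exact: (wg (Some i)).
split; first exact: (C1on_weak_deriv oX None Cu).
by move=> i; exact: (C1on_weak_deriv oX (Some i) Cu).
Qed.

End WeightedGradient.

Theorem proposition1p2 (R : realType) (n : nat) (hn : (3 <= n)%N)
    (X : set 'rV[R]_n.-1)
    (Xbounded : bounded_set X) (Xconvex : convex_set X) (Xopen : open X)
    (Xsmooth : smooth_boundary X)
    (h : R -> R) (hcont : continuous h)
    (hmono : {homo h : a b /~ a <= b}) (h0 : h 0 = 0)
    (f u : R * 'rV[R]_n.-1 -> R)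
    (fcont : {within coneBbar X, continuous f}) (fbounded : Linfty X f)
    (ubounded : Linfty X u)
    (usol : viscosity_solution X h f u) :
  weak_solution X h f u /\ H1 X ((n%:R - 2) / 2) u.
Proof.
have n2 : (2 <= n)%N by exact: ltnW.
have cf p : coneB X p -> {for p, continuous f}.
  have sub : coneB X `<=` coneBbar X.
    move=> q [/= + Xq]; rewrite in_itv/= => /andP[q0 /ltW q1].
    by split; [rewrite /= in_itv/= q0|exact: subset_closure].
  have := continuous_subspaceW sub fcont.
  rewrite continuous_open_subspace; last exact: open_coneB.
  by move=> cf Bp; apply: cf; rewrite inE.
have uH1 : H1 X ((n%:R - 2) / 2) u by exact: (solution_H1 n2 Xopen Xbounded hcont cf usol).
have hL : L1loc X (h \o u).
  apply: L1loc_continuous => // p Bp; have [cu _ _] := solution_C1on Xopen hcont cf usol Bp.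
  by apply: (@cvg_comp _ _ _ u h); [exact: cu|exact: hcont].
split=> //; split; split=> //; try by exists ((n%:R - 2) / 2).
- by move=> gt gx wg psi tp _; rewrite (weak_form n2 Xopen hcont cf usol wg tp).
- by move=> gt gx wg psi tp _; rewrite (weak_form n2 Xopen hcont cf usol wg tp).
Qed.
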